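(* Let $X$ be a conservative Hunt process on $E$ under $\mathbb{Q}=(\mathbb{Q}_x)_{x\in E}$, let $r\ge0$ be a short rate function, and let $m$ be a reference measure on $E$, all as specified in the context, with pricing semigroup $\mathscr{P}_tf(x)=\mathbb{E}^{\mathbb Q}_x[e^{-\int_0^tr(X_s)ds}f(X_t)]$ and dual semigroup $(\hat{\mathscr{P}}_t)$ with respect to $m$. Suppose that: (A1) there is a family of continuous and strictly positive functions $p(t,\cdot,\cdot)$ on $E\times E$ such that for all $(t,x)\in(0,\infty)\times E$ and all non-negative functions $f$ on $E$, $\mathscr{P}_tf(x)=\int_Ep(t,x,y)f(y)m(dy)$ and $\hat{\mathscr{P}}_tf(x)=\int_Ep(t,y,x)f(y)m(dy)$; (A2) $\int_E\int_Ep^2(t,x,y)m(dx)m(dy)<\infty$ for all $t>0$; (A3) there is $T>0$ such that $\sup_{x\in E}\int_Ep^2(t,x,y)m(dy)<\infty$ and $\sup_{x\in E}\int_Ep^2(t,y,x)m(dy)<\infty$ for all $t\ge T$. Then: (i) $X$ is $m$-irreducible and satisfies the absolute continuity assumption with respect to $m$. (ii) $\mathscr{P}_t$ and $\hat{\mathscr{P}}_t$ possess unique (up to multiplicative constants) positive, continuous, bounded eigenfunctions $\pi$ and $\hat\pi$ belonging to $L^2(E,m)$: with some $\lambda\ge0$, $$\int_Ep(t,x,y)\pi(y)m(dy)=e^{-\lambda t}\pi(x),\qquad\int_Ep(t,y,x)\hat\pi(y)m(dy)=e^{-\lambda t}\hat\pi(x)$$ for each $t>0$ and every $x\in E$. (iii)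 Let $C=\int_E\pi(x)\hat\pi(x)m(dx)$. There exist constants $c,\alpha>0$ and $T'>0$ such that for $t\ge T'$ $$\left|Ce^{\lambda t}p(t,x,y)-\pi(x)\hat\pi(y)\right|\le ce^{-\alpha t},\qquad x,y\in E.$$ (iv) Under $\mathbb{Q}^\pi$, defined by $\mathbb{Q}^\pi_x|_{\mathscr{F}_t}=e^{-\int_0^tr(X_s)ds+\lambda t}\frac{\pi(X_t)}{\pi(X_0)}\mathbb{Q}_x|_{\mathscr{F}_t}$, $X$ is recurrent in the sense (R0) and in the sense (R1). Moreover $X$ is positive recurrent under $\mathbb{Q}^\pi$ with stationary distribution $\varsigma(dx)=C^{-1}\pi(x)\hat\pi(x)m(dx)$. (v) If in addition $m(E)<\infty$, then for any payoff $f\in L^2(E,m)$ and all $t\ge T'$ $$\left|\mathscr{P}_tf(x)-c_fe^{-\lambda t}\pi(x)\right|\le K\|f\|_{L^2(E,m)}e^{-(\lambda+\alpha)t},$$ where $c_f=\int_E\frac{f(x)}{\pi(x)}\varsigma(dx)=C^{-1}\int_Ef(x)\hat\pi(x)m(dx)$ and $K$ is a constant independent of $f$, $x$ and $t$.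
   Context: $E$ is a locally compact separable metric space (with at least two points). $X$, under the given risk-neutral laws $(\mathbb{Q}_x)_{x\in E}$, is a conservative Hunt process on $E$: a right-continuous strong Markov process whose paths have left limits and which is quasi-left continuous, with infinite lifetime; $(\mathscr{F}_t)$ is its minimum augmented admissible filtration. The short rate $r:E\to[0,\infty)$ is Borel with $\int_0^tr(X_s)ds<\infty$ a.s. for all finite $t$. $X^r$ denotes $X$ killed at rate $r$; its transition semigroup is the pricing semigroup $(\mathscr{P}_t)$. $m$ is a positive sigma-finite measure on $E$ with full support such that $X^r$ has a dual with respect to $m$: there is a strong Markov process on $E$ with semigroup $(\hat{\mathscr{P}}_t)_{t\ge0}$ such that $\int_Ef\,\mathscr{P}_tg\,dm=\int_Eg\,\hat{\mathscr{P}}_tf\,dm$ for all $t>0$ and non-negative $f,g$. For a given family of laws, $R(x,B)$ is the expected value of $\int_0^\infty1_B(X_t)dt$ started from $x$, and $R_\alpha(x,B)$ that of $\int_0^\infty e^{-\alpha t}1_B(X_t)dt$. $X$ is $\varphi$-irreducible ($\varphi$ a non-trivial sigma-finite measure) if $\varphi(B)>0$ implies $R(x,B)>0$ for all $x\in E$. A maximal irreducibility measure $\psi$ is an irreducibility measure such that $X$ is $\varphi'$-irreducible iff $\varphi'\ll\psi$; it is unique up to equivalence. Absolute continuity assumption with respect to $m$: for some (hence all) $\alpha>0$ and all $x\in E$, $R_\alpha(x,\cdot)\ll m$. (R0): for each universally measurable $B\subseteq E$, either $R(x,B)=0$ for all $x\in E$ or $R(x,B)=\infty$ for all $x\in E$.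 (R1): $X$ is irreducible with maximal irreducibility measure $\psi$ and every Borel $B$ with $\psi(B)>0$ satisfies $R(x,B)=\infty$ for all $x\in B$. Positive recurrent means recurrent with a stationary probability distribution. *)

(* Defs.v *)
From HB Require Import structures.
From mathcomp Require Import all_boot all_order all_algebra.
From mathcomp Require Import all_classical all_reals all_analysis.
From mathcomp Require Import measurable_realfun.

Set Implicit Arguments.
Unset Strict Implicit.
Unset Printing Implicit Defensive.

Import Order.TTheory GRing.Theory Num.Theory.
Import numFieldNormedType.Exports.

Local Open Scope classical_set_scope.
Local Open Scope ring_scope.

HB.mixin Record isBorelMetric (d : measure_display) (R : realType) T
    & Metric R T & Measurable d T := {
  borel_measurableE : @measurable d T = <<s @open T >>
}.

#[short(type="borelMetricType")]
HB.structure Definition BorelMetric (d : measure_display) (R : realType) :=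
  {T of Metric R T & Measurable d T & isBorelMetric d R T}.

(* The state space E together with a cemetery None; a subset is measurable
   when its trace on E is. *)
Definition with_cemetery (E : Type) : Type := option E.

Section cemetery.
Context (d : measure_display) (E : measurableType d).

HB.instance Definition _ := Choice.copy (with_cemetery E) (option E).
HB.instance Definition _ := Pointed.copy (with_cemetery E) (option E).

Definition cemetery_measurable : set (set (with_cemetery E)) :=
  [set A | measurable ((@Some E) @^-1` A)].

Lemma cemetery_measurable0 : cemetery_measurable set0.
Proof. by rewrite /cemetery_measurable /= preimage_set0. Qed.

Lemma cemetery_measurableC (A : set (with_cemetery E)) :
  cemetery_measurable A -> cemetery_measurable (~` A).
Proof.
by rewrite /cemetery_measurable /= preimage_setC; exact: measurableC.
Qed.

Lemma cemetery_measurable_bigcup (F : (set (with_cemetery E))^nat) :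
  (forall i, cemetery_measurable (F i)) ->
  cemetery_measurable (\bigcup_i F i).
Proof.
move=> mF; rewrite /cemetery_measurable /= preimage_bigcup.
exact: bigcupT_measurable.
Qed.

HB.instance Definition _ := @isMeasurable.Build d (with_cemetery E)
  cemetery_measurable cemetery_measurable0 cemetery_measurableC
  cemetery_measurable_bigcup.

End cemetery.

(* A process is a map Y : R -> Omega -> S of which only the times t >= 0
   matter, with one law P x on Omega for each starting point x : S. *)
Section processes.
Context (R : realType) (d dS : measure_display).
Context (Omega : measurableType d) (S : measurableType dS).
Variables (Y : R -> Omega -> S) (P : S -> probability Omega R).

Local Open Scope ereal_scope.

Definition natural_filtration (t : R) : set (set Omega) :=
  <<s [set A | exists s B,
        [/\ (0 <= s <= t)%R, measurable B & A = Y s @^-1` B]] >>.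

Definition natural_sigma_algebra : set (set Omega) :=
  <<s [set A | exists s B, [/\ (0 <= s)%R, measurable B & A = Y s @^-1` B]] >>.

(* Expectation of a nonnegative random variable under the law with initial
   distribution mu.  The integral of a nonnegative function is, in the library,
   the supremum of the integrals of the simple measurable functions below it;
   on a function which is only measurable for the completed sigma-algebra it
   therefore agrees with the integral for the completed measure. *)
Definition expectation_from (mu : probability S R) (Z : Omega -> \bar R) :
    \bar R :=
  \int[mu]_x \int[P x]_w Z w.

Definition null_from (mu : probability S R) (N : set Omega) :=
  exists A, [/\ natural_sigma_algebra A, \int[mu]_x P x A = 0 & N `<=` A].

(* Minimum augmented admissible filtration: for each initial distribution mu
   add the mu-null sets, then intersect over mu. *)
Definition augmented (G : set (set Omega)) : set (set Omega) :=
  [set A | forall mu : probability S R, exists2 A',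
     G A' & null_from mu ((A `\` A') `|` (A' `\` A))].

Definition augmented_filtration (t : R) := augmented (natural_filtration t).

Definition stopping_time (tau : Omega -> \bar R) :=
  (forall w, 0 <= tau w) /\
  forall t : R, (0 <= t)%R ->
    augmented_filtration t [set w | tau w <= t%:E].

Definition stopped_sigma_algebra (tau : Omega -> \bar R) : set (set Omega) :=
  [set A | augmented natural_sigma_algebra A /\
     forall t : R, (0 <= t)%R ->
       augmented_filtration t (A `&` [set w | tau w <= t%:E])].

Definition at_time (tau : Omega -> \bar R) (w : Omega) : S :=
  Y (fine (tau w)) w.

Definition finite_event (tau : Omega -> \bar R) : set Omega :=
  [set w | tau w < +oo].

Definition strong_markov_process :=
  [/\ forall t, (0 <= t)%R -> measurable_fun setT (Y t),
      forall t (B : set S), (0 <= t)%R -> measurable B ->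
        measurable_fun setT (fun x => P x (Y t @^-1` B)),
      forall x, {ae P x, forall w, Y 0%R w = x},
      forall tau (B : set S), stopping_time tau -> measurable B ->
        stopped_sigma_algebra tau (finite_event tau `&` at_time tau @^-1` B) &
      forall (mu : probability S R) tau (s : R) (A : set Omega) (B : set S),
        stopping_time tau -> (0 <= s)%R ->
        stopped_sigma_algebra tau A -> measurable B ->
        expectation_from mu (fun w =>
          (\1_(A `&` finite_event tau
               `&` at_time (fun w' => tau w' + s%:E)%E @^-1` B) w)%:E) =
        expectation_from mu (fun w =>
          (\1_(A `&` finite_event tau) w)%:E
          * P (at_time tau w) (Y s @^-1` B))].

(* For a universally measurable B both integrands below may fail to be
   measurable; the remark on expectation_from applies to them. *)
Definition potential (x : S) (B : set S) : \bar R :=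
  \int[P x]_w \int[lebesgue_measure]_(t in `[0%R, +oo[) (\1_B (Y t w))%:E.

Definition resolvent (alpha : R) (x : S) (B : set S) : \bar R :=
  \int[P x]_w \int[lebesgue_measure]_(t in `[0%R, +oo[)
    (expR (- (alpha * t)) * \1_B (Y t w))%:E.

Definition irreducible_for (phi : {sigma_finite_measure set S -> \bar R}) :=
  0 < phi setT /\
  forall B, measurable B -> 0 < phi B -> forall x, 0 < potential x B.

Definition maximal_irreducibility_measure
    (psi : {sigma_finite_measure set S -> \bar R}) :=
  irreducible_for psi /\
  forall phi : {sigma_finite_measure set S -> \bar R}, 0 < phi setT ->
    (irreducible_for phi <-> phi `<< psi).

(* Asking this of one alpha or of all of them is the same. *)
Definition absolute_continuity (m : {sigma_finite_measure set S -> \bar R}) :=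
  forall (alpha : R) x, (0 < alpha)%R -> resolvent alpha x `<< m.

Definition universally_measurable (B : set S) :=
  forall mu : probability S R, exists B1 B2,
    [/\ measurable B1, measurable B2, B1 `<=` B, B `<=` B2 &
        mu (B2 `\` B1) = 0].

Definition recurrent_R0 :=
  forall B, universally_measurable B ->
    (forall x, potential x B = 0) \/ (forall x, potential x B = +oo).

Definition recurrent_R1 :=
  exists2 psi : {sigma_finite_measure set S -> \bar R},
    maximal_irreducibility_measure psi &
    forall B, measurable B -> 0 < psi B -> forall x, B x -> potential x B = +oo.

Definition stationary (nu : probability S R) :=
  forall (t : R) B, (0 <= t)%R -> measurable B ->
    \int[nu]_x P x (Y t @^-1` B) = nu B.

End processes.

Section hunt.
Context (R : realType) (d dE : measure_display).
Context (Omega : measurableType d) (E : borelMetricType dE R).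
Variables (X : R -> Omega -> E) (Q : E -> probability Omega R).

Definition cadlag_paths := forall w,
  (forall t, 0 <= t -> X s w @[s --> t^'+] --> X t w) /\
  (forall t, 0 < t -> exists y : E, X s w @[s --> t^'-] --> y).

Definition quasi_left_continuous :=
  forall (mu : probability E R) (taun : nat -> Omega -> \bar R)
    (tau : Omega -> \bar R),
  (forall n, stopping_time X Q (taun n)) -> stopping_time X Q tau ->
  (forall w n, (taun n w <= taun n.+1 w)%E) ->
  (forall w, taun n w @[n --> \oo] --> tau w) ->
  null_from X Q mu
    [set w | (tau w < +oo)%E /\
             ~ (at_time X (taun n) w @[n --> \oo] --> at_time X tau w)].

(* With values in E at all times, hence conservative. *)
Definition conservative_hunt_process :=
  [/\ strong_markov_process X Q, cadlag_paths & quasi_left_continuous].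

Variable r : E -> R.

Definition integrated_rate (t : R) (w : Omega) : \bar R :=
  (\int[lebesgue_measure]_(s in `[0%R, t]) (r (X s w))%:E)%E.

Definition short_rate :=
  [/\ forall x, 0 <= r x, measurable_fun setT r &
      forall x t, 0 <= t -> {ae Q x, forall w, (integrated_rate t w < +oo)%E}].

Definition discount (t : R) (w : Omega) : \bar R :=
  expeR (- integrated_rate t w)%E.

Definition pricing (t : R) (f : E -> \bar R) (x : E) : \bar R :=
  (\int[Q x]_w (discount t w * f (X t w)))%E.

Definition eigen_density (lam : R) (pi : E -> R) (t : R) (w : Omega) : \bar R :=
  (discount t w * (expR (lam * t) * (pi (X t w) / pi (X 0 w)))%:E)%E.

(* The change of measure is imposed on the non-augmented filtration: the
   augmented one contains the null sets of the whole path sigma-algebra, and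
   imposing it there would force absolute continuity at infinite horizon. *)
Definition eigen_measure (lam : R) (pi : E -> R)
    (Qpi : E -> probability Omega R) :=
  forall x t A, 0 <= t -> natural_filtration X t A ->
    Qpi x A = (\int[Q x]_(w in A) eigen_density lam pi t w)%E.

End hunt.

(* Process on E with a possibly finite lifetime, absorbed in the cemetery. *)
Section dual.
Context (R : realType) (d dE : measure_display).
Context (Omega : measurableType d) (E : measurableType dE).
Variables (Y : R -> Omega -> with_cemetery E).
Variables (P : with_cemetery E -> probability Omega R).

Definition killed_strong_markov_process :=
  strong_markov_process Y P /\
  forall w s t, 0 <= s <= t -> Y s w = None -> Y t w = None.

Definition killed_semigroup (t : R) (f : E -> \bar R) (x : E) : \bar R :=
  (\int[P (Some x)]_w (if Y t w is Some y then f y else 0))%E.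

End dual.

Section kernels.
Context (R : realType) (dE : measure_display) (E : borelMetricType dE R).
Variable m : {sigma_finite_measure set E -> \bar R}.

Definition full_support := forall U : set E, open U -> U !=set0 -> (0 < m U)%E.

Definition in_duality (T That : R -> (E -> \bar R) -> E -> \bar R) :=
  forall t (f g : E -> \bar R), 0 < t ->
    measurable_fun setT f -> measurable_fun setT g ->
    (forall x, 0 <= f x)%E -> (forall x, 0 <= g x)%E ->
    (\int[m]_x (f x * T t g x) = \int[m]_x (g x * That t f x))%E.

Definition has_density (T : R -> (E -> \bar R) -> E -> \bar R)
    (p : R -> E -> E -> R) :=
  forall t x (f : E -> \bar R), 0 < t ->
    measurable_fun setT f -> (forall y, 0 <= f y)%E ->
    (T t f x = \int[m]_y ((p t x y)%:E * f y))%E.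

Definition admissible_eigenfunction (f : E -> R) :=
  [/\ forall x, 0 < f x, continuous f,
      exists M, forall x, `|f x| <= M & f \in Lfun m 2%:E].

Definition eigenfunction_of (k : E -> E -> R) (kappa : R) (f : E -> R) :=
  forall x, (\int[m]_y (k x y * f y)%:E = (kappa * f x)%:E)%E.

(* Uniqueness up to a multiplicative constant of the admissible eigenfunction
   of the integral operator with kernel k, whatever the eigenvalue. *)
Definition unique_eigenfunction (k : E -> E -> R) (f : E -> R) :=
  forall g kappa, admissible_eigenfunction g -> eigenfunction_of k kappa g ->
    exists a, forall x, g x = a * f x.

End kernels.

(* Main.v *)
Require Import Defs.
From HB Require Import structures.
From mathcomp Require Import all_boot all_order all_algebra.
From mathcomp Require Import all_classical all_reals all_analysis.
From mathcomp Require Import measurable_realfun.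
From mathcomp Require Import ring lra.

Set Implicit Arguments.
Unset Strict Implicit.
Unset Printing Implicit Defensive.

Import Order.TTheory GRing.Theory Num.Theory.
Import numFieldNormedType.Exports.

Local Open Scope classical_set_scope.
Local Open Scope ring_scope.

(** The eigenfunctions are obtained without compact operators.  By (A3) and
    Chapman-Kolmogorov, [p t0 x y <= b x * a y] with [a * b] integrable, so that
    after conjugation [p t0] becomes a kernel with values in (0, 1] on a finite
    measure space.  Truncated Neumann series at parameters decreasing to the
    growth rate [rho] of the iterates are approximate eigenfunctions of the
    kernel and of its transpose; the limsup of the former satisfies
    [K w >= rho w], the liminf of the latter [K' v <= rho v], and pairing the
    two forces equality.  The gap comes from a contraction estimate on functions
    orthogonal to [v], for a norm mixing a sup bound and a [v]-weighted L^1
    bound.  The semigroup property then gives [rho ^ n = exp (- lam t)] and (iii).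

    For [X], the Markov property is lifted from coordinates to functionals of
    the right-continuous path, such as the discount factor; this yields the
    pricing semigroup and the consistency of the eigen-densities.  Under any
    family [Qpi] which they define, [Qpi x (X_t in B)] equals
    [exp (lam t) / pi x * P_t (pi 1_B) x]; by (iii) it stays bounded below for
    large [t] when [m B > 0], and it vanishes for all [t > 0] when [m B = 0], so
    that potentials are either infinite or zero. *)

(** * Positive kernels on a finite measure space *)

(** The kernel is positive at each point but has no uniform lower bound, so no minorisation over the
    whole space is available. Its substitute is [1 <= exp (- s) + s] with [s = n v]: the part of a
    bounded [f >= 0] living where [v] is small is damped by [exp (- n v)], whose integral over a
    finite measure tends to 0, and the rest costs a factor [n]. This yields the positivity of the
    liminf and both halves of the contraction estimate.

    The two limits have to be of opposite kinds: two limsups give inequalities in the same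
    direction, and pairing them gives nothing. The limsup keeps its mass, so [w] is not null; the
    liminf may lose mass but stays positive at every point, which the pairing needs of a weight.

    The time [4 * T] comes from two doublings. The L^2 bounds at [T] make [p (2 * T)] bounded; this
    turns Chapman-Kolmogorov at [2 * T + 2 * T], known only almost everywhere, into an identity at
    every point; Cauchy-Schwarz then gives the product bound. Full support and continuity of the
    kernels do the passage from almost every point to every point. *)

Section bounded_measurable.
Context {R : realType}.

(** This class is an algebra stable under kernel operators, and on a finite measure it settles every
    integrability condition. *)
Definition bounded_measurable d (T : measurableType d) (f : T -> R) :=
  measurable_fun setT f /\ exists M, forall x, `|f x| <= M.

Section closure.
Context d (T : measurableType d).
Implicit Types f g : T -> R.

Lemma bmf_cst c : bounded_measurable (fun _ : T => c).
Proof. by split; [exact: measurable_cst|exists `|c|]. Qed.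

Lemma bmfD f g : bounded_measurable f -> bounded_measurable g ->
  bounded_measurable (fun x => f x + g x).
Proof.
move=> [mf [M fM]] [mg [N gN]]; split; first exact: measurable_funD.
exists (M + N) => x; rewrite (le_trans (ler_normD _ _))//.
by rewrite lerD.
Qed.

Lemma bmfM f g : bounded_measurable f -> bounded_measurable g ->
  bounded_measurable (fun x => f x * g x).
Proof.
move=> [mf [M fM]] [mg [N gN]]; split; first exact: measurable_funM.
by exists (M * N) => x; rewrite normrM ler_pM.
Qed.

Lemma bmfZ c f : bounded_measurable f -> bounded_measurable (fun x => c * f x).
Proof. by move=> bf; apply: bmfM => //; exact: bmf_cst. Qed.

Lemma bmfN f : bounded_measurable f -> bounded_measurable (fun x => - f x).
Proof.
move=> bf; rewrite (_ : (fun _ => _) = fun x => -1 * f x); first exact: bmfZ.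
by apply/funext => x; rewrite mulN1r.
Qed.

Lemma bmfB f g : bounded_measurable f -> bounded_measurable g ->
  bounded_measurable (fun x => f x - g x).
Proof. by move=> bf bg; apply: bmfD => //; exact: bmfN. Qed.

Lemma bmf_norm f : bounded_measurable f -> bounded_measurable (fun x => `|f x|).
Proof.
move=> [mf [M fM]]; split; first exact: measurableT_comp.
by exists M => x; rewrite normr_id.
Qed.

Lemma bmf_sum n (F : nat -> T -> R) : (forall i, bounded_measurable (F i)) ->
  bounded_measurable (fun x => \sum_(i < n) F i x).
Proof.
move=> bF; elim: n => [|n IH].
  rewrite (_ : (fun _ => _) = fun=> 0); first exact: bmf_cst.
  by apply/funext => x; rewrite big_ord0.
rewrite (_ : (fun _ => _) = fun x => (\sum_(i < n) F i x) + F n x).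
  exact: bmfD.
by apply/funext => x; rewrite big_ord_recr.
Qed.

Lemma bmf_damp n f : measurable_fun setT f -> (forall x, 0 <= f x) ->
  bounded_measurable (fun x => expR (- (n%:R * f x))).
Proof.
move=> mf f0; split.
  apply: measurableT_comp => //; apply: measurableT_comp => //.
  exact: measurable_funM.
exists 1 => x; rewrite ger0_norm ?expR_ge0// -expR0 ler_expR oppr_le0.
by rewrite mulr_ge0.
Qed.

End closure.

Lemma bmf_comp d1 d2 (T1 : measurableType d1) (T2 : measurableType d2)
    (h : T1 -> T2) (f : T2 -> R) : measurable_fun setT h ->
  bounded_measurable f -> bounded_measurable (fun x => f (h x)).
Proof.
move=> mh [mf [M fM]]; split; first exact: measurableT_comp.
by exists M => x.
Qed.

End bounded_measurable.

Section finite_measure_integral.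
Context {R : realType} d (T : measurableType d).
Variable mu : {finite_measure set T -> \bar R}.
Implicit Types f g v : T -> R.

Lemma bmf_integrable f : bounded_measurable f ->
  mu.-integrable setT (EFin \o f).
Proof.
move=> [mf [M fM]]; apply: measurable_bounded_integrable => //.
  by rewrite ltey_eq fin_num_measure.
by exists M; split; [exact: num_real|move=> y My x _; exact: le_trans (fM x) (ltW My)].
Qed.

Lemma bmf_integralE f : bounded_measurable f ->
  (\int[mu]_x (f x)%:E)%E = (\int[mu]_x f x)%:E.
Proof.
move=> bf; rewrite /Rintegral fineK//.
exact: (integrable_fin_num _ (bmf_integrable bf)).
Qed.

Lemma bmf_intD f g : bounded_measurable f -> bounded_measurable g ->
  \int[mu]_x (f x + g x) = \int[mu]_x f x + \int[mu]_x g x.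
Proof. by move=> bf bg; rewrite RintegralD//; exact: bmf_integrable. Qed.

Lemma bmf_intB f g : bounded_measurable f -> bounded_measurable g ->
  \int[mu]_x (f x - g x) = \int[mu]_x f x - \int[mu]_x g x.
Proof. by move=> bf bg; rewrite RintegralB//; exact: bmf_integrable. Qed.

Lemma bmf_intZ c f : bounded_measurable f ->
  \int[mu]_x (c * f x) = c * \int[mu]_x f x.
Proof. by move=> bf; rewrite RintegralZl//; exact: bmf_integrable. Qed.

Lemma bmf_intZr c f : bounded_measurable f ->
  \int[mu]_x (f x * c) = (\int[mu]_x f x) * c.
Proof. by move=> bf; rewrite RintegralZr//; exact: bmf_integrable. Qed.

Lemma bmf_int_le f g : bounded_measurable f -> bounded_measurable g ->
  (forall x, f x <= g x) -> \int[mu]_x f x <= \int[mu]_x g x.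
Proof. by move=> bf bg fg; apply: le_Rintegral => //; exact: bmf_integrable. Qed.

Lemma int_ge0 f : (forall x, 0 <= f x) -> 0 <= \int[mu]_x f x.
Proof. by move=> f0; exact: Rintegral_ge0. Qed.

Lemma bmf_int_norm f : bounded_measurable f ->
  `|\int[mu]_x f x| <= \int[mu]_x `|f x|.
Proof. by move=> bf; apply: le_normr_Rintegral => //; exact: bmf_integrable. Qed.

Lemma bmf_int_sum n (F : nat -> T -> R) : (forall i, bounded_measurable (F i)) ->
  \int[mu]_x (\sum_(i < n) F i x) = \sum_(i < n) \int[mu]_x F i x.
Proof.
move=> bF; elim: n => [|n IH].
  rewrite big_ord0 (_ : (fun _ => _) = fun=> 0); first last.
    by apply/funext => x; rewrite big_ord0.
  by rewrite Rintegral_cst// mul0r.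
rewrite big_ord_recr /= -IH -bmf_intD//; last exact: bmf_sum.
by apply: eq_Rintegral => x _; rewrite big_ord_recr.
Qed.

Lemma int_cst c : \int[mu]_x c = c * fine (mu setT).
Proof. by rewrite Rintegral_cst. Qed.

Lemma bmf_dominated (F : nat -> T -> R) f M :
  (forall n, measurable_fun setT (F n)) -> measurable_fun setT f ->
  (forall n x, `|F n x| <= M) -> (forall x, F n x @[n --> \oo] --> f x) ->
  \int[mu]_x F n x @[n --> \oo] --> \int[mu]_x f x.
Proof.
move=> mF mf FM Ff.
have bF n : bounded_measurable (F n) by split => //; exists M.
have bf : bounded_measurable f.
  split => //; exists M => x.
  have h : `|F n x| @[n --> \oo] --> `|f x| by apply: cvg_norm; exact: Ff.
  rewrite -(cvg_lim _ h)//; apply: limr_le; first exact: cvgP h.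
  by near=> n; exact: FM.
suff : ((\int[mu]_x F n x)%:E @[n --> \oo] --> (\int[mu]_x f x)%:E)%E.
  by move/fine_cvgP => [].
rewrite -bmf_integralE//.
rewrite (_ : (fun n => _) = fun n => (\int[mu]_x (F n x)%:E)%E); last first.
  by apply/funext => n; rewrite bmf_integralE.
apply: (@dominated_cvg _ _ _ mu setT _ _ _ (fun=> M%:E)) => //.
- by move=> n; apply/measurable_EFinP.
- move=> x _; apply/fine_cvgP; split; [exact: nearW|exact: Ff].
- by have := bmf_integrable (bmf_cst T M).
- by move=> n x _; rewrite lee_fin.
Unshelve. all: by end_near. Qed.

(** [exp (- n v)] is the n-th power of a number below 1 at each point, so it tends to 0 pointwise,
    however small [v] may be; dominated convergence does the rest. *)
Lemma damp_cvg v g : measurable_fun setT v -> (forall x, 0 < v x) ->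
  bounded_measurable g ->
  \int[mu]_x (expR (- (n%:R * v x)) * g x) @[n --> \oo] --> (0 : R).
Proof.
move=> mv v0 [mg [M gM]].
have v0' x : 0 <= v x by exact: ltW.
rewrite (_ : 0 = \int[mu]_x (0 : R)); last by rewrite int_cst mul0r.
apply: (@bmf_dominated _ _ M) => //.
- by move=> n; apply: measurable_funM => //; have [] := bmf_damp n mv v0'.
- move=> n x; rewrite normrM ger0_norm ?expR_ge0//.
  rewrite -[leRHS]mul1r ler_pM ?expR_ge0//.
  by rewrite -expR0 ler_expR oppr_le0 mulr_ge0.
- move=> x; rewrite -[0](mul0r (g x)); apply: cvgM; last exact: cvg_cst.
  rewrite (_ : (fun n => _) = GRing.exp (expR (- v x))); last first.
    by apply/funext => n; rewrite -expRM_natl mulrN.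
  apply: cvg_expr; rewrite ger0_norm ?expR_ge0// -expR0 ltr_expR.
  by rewrite oppr_lt0.
Qed.

End finite_measure_integral.

Section kernel_operator.
Context {R : realType} d (T : measurableType d).
Variable mu : {finite_measure set T -> \bar R}.
Implicit Types (k : T -> T -> R) (f g : T -> R).

Definition bounded_kernel k := bounded_measurable (fun z : T * T => k z.1 z.2).

Definition kop k f x : R := \int[mu]_y (k x y * f y).

Lemma bounded_kernelC k : bounded_kernel k -> bounded_kernel (fun x y => k y x).
Proof.
by move=> bk; exact: (bmf_comp (@measurable_swap _ _ T T) bk).
Qed.

Lemma bounded_kernel1 k x : bounded_kernel k -> bounded_measurable (k x).
Proof. by move=> bk; exact: (bmf_comp (pair1_measurable x) bk). Qed.

Lemma bounded_kernel2 k y : bounded_kernel k -> bounded_measurable (k^~ y).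
Proof. by move=> bk; exact: (bmf_comp (pair2_measurable y) bk). Qed.

Lemma bmf_kop_term k f x : bounded_kernel k -> bounded_measurable f ->
  bounded_measurable (fun y => k x y * f y).
Proof. by move=> /(@bounded_kernel1 _ x) bk bf; exact: bmfM. Qed.

Lemma bounded_kernel_integrable k : bounded_kernel k ->
  (mu \x mu)%E.-integrable setT (fun z : T * T => (k z.1 z.2)%:E).
Proof.
move=> [mk [M kM]].
apply: (@measurable_bounded_integrable _ _ _ (mu \x mu)%E (fun z : T * T => k z.1 z.2)) => //.
  have := product_measure1E mu mu (@measurableT _ T) (@measurableT _ T).
  rewrite setXTT => h.
  have : (mu setT * mu setT < +oo)%E by rewrite ltey_eq fin_numM// fin_num_measure.
  by rewrite -h.
by exists M; split; [exact: num_real|move=> y My x _; exact: le_trans (kM x) (ltW My)].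
Qed.

Lemma bmf_int_kernel k : bounded_kernel k ->
  bounded_measurable (fun x => \int[mu]_y k x y).
Proof.
move=> bk; have [_ [M kM]] := bk; split.
  have := measurable_fubini_F (bounded_kernel_integrable bk).
  rewrite /fubini_F/= => mF.
  by apply: measurableT_comp => //.
exists (M * fine (mu setT)) => x.
apply: le_trans (bmf_int_norm _ (bounded_kernel1 x bk)) _.
rewrite -int_cst; apply: bmf_int_le.
- exact/bmf_norm/bounded_kernel1.
- exact: bmf_cst.
- by move=> y; exact: kM (x, y).
Qed.

Lemma bmf_fubini k : bounded_kernel k ->
  \int[mu]_x \int[mu]_y k x y = \int[mu]_y \int[mu]_x k x y.
Proof.
move=> bk; have bkC := bounded_kernelC bk.
apply: EFin_inj; rewrite -(bmf_integralE _ (bmf_int_kernel bk)).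
rewrite -(bmf_integralE _ (bmf_int_kernel bkC)).
transitivity (\int[mu]_x \int[mu]_y (k x y)%:E)%E.
  apply: eq_integral => x _.
  by rewrite -(bmf_integralE _ (bounded_kernel1 x bk)).
rewrite (Fubini (bounded_kernel_integrable bk)); apply: eq_integral => y _ /=.
by rewrite (bmf_integralE _ (bounded_kernel2 y bk)).
Qed.

Lemma bmf_kop k f : bounded_kernel k -> bounded_measurable f ->
  bounded_measurable (kop k f).
Proof.
move=> bk bf; apply: (@bmf_int_kernel (fun x y => k x y * f y)).
by apply: bmfM => //; exact: (bmf_comp (@measurable_snd _ _ T T) bf).
Qed.

Lemma kop_adj k f g : bounded_kernel k -> bounded_measurable f ->
  bounded_measurable g ->
  \int[mu]_x (g x * kop k f x) = \int[mu]_y (kop (fun x y => k y x) g y * f y).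
Proof.
move=> bk bf bg.
transitivity (\int[mu]_x \int[mu]_y (g x * (k x y * f y))).
  by apply: eq_Rintegral => x _; rewrite bmf_intZ//; exact: bmf_kop_term.
rewrite (@bmf_fubini (fun x y => g x * (k x y * f y))); last first.
  apply: bmfM; first exact: (bmf_comp (@measurable_fst _ _ T T) bg).
  by apply: bmfM => //; exact: (bmf_comp (@measurable_snd _ _ T T) bf).
apply: eq_Rintegral => y _; rewrite -bmf_intZr//; last first.
  exact: (bmfM (bounded_kernel2 y bk) bg).
by apply: eq_Rintegral => x _; rewrite mulrCA mulrA.
Qed.

Lemma kopD k f g x : bounded_kernel k -> bounded_measurable f ->
  bounded_measurable g ->
  kop k (fun y => f y + g y) x = kop k f x + kop k g x.
Proof.
move=> bk bf bg; rewrite /kop -bmf_intD; try exact: bmf_kop_term.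
by apply: eq_Rintegral => y _; rewrite mulrDr.
Qed.

Lemma kopZ k c f x : bounded_kernel k -> bounded_measurable f ->
  kop k (fun y => c * f y) x = c * kop k f x.
Proof.
move=> bk bf; rewrite /kop -bmf_intZ; last exact: bmf_kop_term.
by apply: eq_Rintegral => y _; rewrite mulrCA.
Qed.

Lemma kopB k f g x : bounded_kernel k -> bounded_measurable f ->
  bounded_measurable g ->
  kop k (fun y => f y - g y) x = kop k f x - kop k g x.
Proof.
move=> bk bf bg; rewrite /kop -bmf_intB; try exact: bmf_kop_term.
by apply: eq_Rintegral => y _; rewrite mulrBr.
Qed.

Lemma kop_sum k n (F : nat -> T -> R) x : bounded_kernel k ->
  (forall i, bounded_measurable (F i)) ->
  kop k (fun y => \sum_(i < n) F i y) x = \sum_(i < n) kop k (F i) x.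
Proof.
move=> bk bF; rewrite /kop -(@bmf_int_sum _ _ _ mu n (fun i y => k x y * F i y)).
  by apply: eq_Rintegral => y _; rewrite mulr_sumr.
by move=> i; exact: bmf_kop_term.
Qed.

Lemma kop_le k f g x : bounded_kernel k -> (forall x y, 0 <= k x y) ->
  bounded_measurable f -> bounded_measurable g ->
  (forall y, f y <= g y) -> kop k f x <= kop k g x.
Proof.
move=> bk k0 bf bg fg; apply: bmf_int_le; try exact: bmf_kop_term.
by move=> y; rewrite ler_wpM2l.
Qed.

Lemma kop_ge0 k f x : (forall x y, 0 <= k x y) -> (forall y, 0 <= f y) ->
  0 <= kop k f x.
Proof. by move=> k0 f0; apply: int_ge0 => y; rewrite mulr_ge0. Qed.

Lemma kop_norm k f x : bounded_kernel k -> (forall x y, 0 <= k x y) ->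
  bounded_measurable f -> `|kop k f x| <= kop k (fun y => `|f y|) x.
Proof.
move=> bk k0 bf; apply: le_trans (bmf_int_norm _ _) _; first exact: bmf_kop_term.
rewrite le_eqVlt; apply/orP; left; apply/eqP; apply: eq_Rintegral => y _.
by rewrite normrM ger0_norm.
Qed.

(* [1 <= exp (-s) + s]; damping by [exp (- n v)] costs a factor [n]. *)
Lemma int_damp_le n v f : bounded_measurable v -> (forall x, 0 <= v x) ->
  bounded_measurable f -> (forall x, 0 <= f x) ->
  \int[mu]_x f x <=
  \int[mu]_x (expR (- (n%:R * v x)) * f x) + n%:R * \int[mu]_x (v x * f x).
Proof.
move=> bv v0 bf f0; have [mv _] := bv; rewrite -bmf_intZ; last exact: bmfM.
rewrite -bmf_intD; first last.
- by apply: bmfZ; exact: bmfM.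
- by apply: bmfM => //; exact: bmf_damp.
apply: bmf_int_le => //.
  apply: bmfD; last by apply: bmfZ; exact: bmfM.
  by apply: bmfM => //; exact: bmf_damp.
move=> x; rewrite mulrA -mulrDl -[leLHS]mul1r ler_wpM2r//.
by have := expR_ge1Dx (- (n%:R * v x)); rewrite lerBlDr.
Qed.

(** By [int_damp_le] the integral of [f] is at most its damped version for every [n], and the latter
    tends to 0. *)
Lemma int_pos_mul_eq0 v f : bounded_measurable v -> (forall x, 0 < v x) ->
  bounded_measurable f -> (forall x, 0 <= f x) ->
  \int[mu]_x (v x * f x) = 0 -> \int[mu]_x f x = 0.
Proof.
move=> bv v0 bf f0 vf0; have v0' x : 0 <= v x by exact: ltW.
apply/eqP; rewrite eq_le int_ge0// andbT.
have [mv _] := bv.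
have h := damp_cvg mu mv v0 bf; rewrite -(cvg_lim _ h)//.
apply: limr_ge; first exact: cvgP h.
near=> n; have := int_damp_le n bv v0' bf f0.
by rewrite vf0 mulr0 addr0.
Unshelve. all: by end_near. Qed.

Lemma int_eq0_mul g f : bounded_measurable g ->
  bounded_measurable f -> (forall x, 0 <= f x) ->
  \int[mu]_x f x = 0 -> \int[mu]_x (g x * f x) = 0.
Proof.
move=> bg bf f0 If; have [_ [M gM]] := bg.
apply/eqP; rewrite -normr_le0.
apply: le_trans (bmf_int_norm _ (bmfM bg bf)) _.
suff: \int[mu]_x `|g x * f x| <= \int[mu]_x (M * f x).
  by rewrite bmf_intZ// If mulr0.
apply: bmf_int_le; [exact/bmf_norm/bmfM|exact: bmfZ|move=> x].
by rewrite normrM (ger0_norm (f0 x)) ler_wpM2r.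
Qed.

Lemma int_pos_mul_gt0 v f : bounded_measurable v -> (forall x, 0 < v x) ->
  bounded_measurable f -> (forall x, 0 <= f x) ->
  0 < \int[mu]_x f x -> 0 < \int[mu]_x (v x * f x).
Proof.
move=> bv v0 bf f0 If; rewrite lt0r int_ge0 ?andbT; last first.
  by move=> x; rewrite mulr_ge0// ltW.
by apply/eqP => /(int_pos_mul_eq0 bv v0 bf f0) If0; rewrite If0 ltxx in If.
Qed.

End kernel_operator.

(** * Growth rate of the iterates of a positive kernel *)

Section spectral_radius.
Context {R : realType} d (T : measurableType d).
Variables (mu : {finite_measure set T -> \bar R}) (k : T -> T -> R).
Hypothesis bk : bounded_kernel k.
Hypothesis k_gt0 : forall x y, 0 < k x y.
Hypothesis k_le1 : forall x y, k x y <= 1.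

Let k_ge0 x y : 0 <= k x y. Proof. exact: ltW. Qed.

Definition kpow n : T -> R := iter n (kop mu k) (fun=> 1).
Definition kmass n : R := \int[mu]_x kpow n x.

Lemma bmf_kpow n : bounded_measurable (kpow n).
Proof. by elim: n => [|n IH]; [exact: bmf_cst|exact: bmf_kop]. Qed.

Lemma kpow_ge0 n x : 0 <= kpow n x.
Proof. by elim: n x => [|n IH] x //=; exact: kop_ge0. Qed.

Lemma kmass_ge0 n : 0 <= kmass n.
Proof. by apply: int_ge0 => x; exact: kpow_ge0. Qed.

Lemma kop_le_int f x : bounded_measurable f -> (forall y, 0 <= f y) ->
  kop mu k f x <= \int[mu]_y f y.
Proof.
move=> bf f0; apply: bmf_int_le => //; first exact: bmf_kop_term.
by move=> y; rewrite -[leRHS]mul1r ler_wpM2r.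
Qed.

Lemma kpowS_le n x : kpow n.+1 x <= kmass n.
Proof. by apply: kop_le_int; [exact: bmf_kpow|exact: kpow_ge0]. Qed.

(** Since [k <= 1], one application of the operator is at most a plain integral; spending one of the
    [n + m + 1] applications in this way separates the other two groups. Hence the index shift: the
    submultiplicative sequence is [kmass n] numbered by [n + 1]. *)
Lemma kpow_add n m x : kpow (n + m).+1 x <= kmass m * kpow n x.
Proof.
elim: n x => [|n IH] x; first by rewrite add0n mulr1 kpowS_le.
rewrite addSn [kpow n.+1]/= -kopZ//; last exact: bmf_kpow.
apply: kop_le => //; first exact: (bmf_kpow (n + m).+1).
by apply: bmfZ; exact: bmf_kpow.
Qed.

Lemma kmass_add n m : kmass (n + m).+1 <= kmass n * kmass m.
Proof.
rewrite mulrC -bmf_intZ; last exact: bmf_kpow.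
apply: bmf_int_le; [exact: bmf_kpow|exact/bmfZ/bmf_kpow|].
by move=> x; exact: kpow_add.
Qed.

(** For the sequence numbered by [n + 1] this is the usual bound along multiples; the predecessor
    undoes the shift. *)
Lemma kmass_mul n j : kmass (j.+1 * n.+1).-1 <= kmass n ^+ j.+1.
Proof.
elim: j => [|j IH]; first by rewrite mul1n expr1.
rewrite mulSn addSn -[n.+1]add1n /= (_ : (n + (j.+1) * (1 + n)) = (n + (j.+1 * n.+1).-1).+1)%N; last first.
  by rewrite -addnS prednK// muln_gt0.
rewrite exprS (le_trans (kmass_add _ _))// ler_wpM2l//; exact: kmass_ge0.
Qed.

Variables (c : R) (f0 : T -> R).
Hypothesis c_gt0 : 0 < c.
Hypothesis bf0 : bounded_measurable f0.
Hypothesis f0_01 : forall x, 0 <= f0 x <= 1.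
Hypothesis f0_int : 0 < \int[mu]_x f0 x.
Hypothesis kf0 : forall x, c * f0 x <= kop mu k f0 x.

(** Positivity lets [c f0 <= K f0] be iterated; this is what keeps the growth rate away from 0. *)
Lemma kpow_lb n x : c ^+ n * f0 x <= kpow n x.
Proof.
elim: n x => [|n IH] x; first by rewrite expr0 mul1r; have /andP[] := f0_01 x.
have -> : c ^+ n.+1 * f0 x = c ^+ n * (c * f0 x) by rewrite exprSr mulrA.
apply: le_trans (_ : c ^+ n * kop mu k f0 x <= _).
  by rewrite ler_wpM2l// exprn_ge0// ltW.
rewrite -kopZ//; apply: kop_le => //; first exact: bmfZ.
exact: bmf_kpow.
Qed.

(** Its supremum is the infimum of the roots [kmass n ^ (1 / (n + 1))], which by submultiplicativity
    is also their limit, the growth rate of the iterates; this form avoids taking that limit. *)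
Let A := [set r : R | 0 <= r /\ forall n, r ^+ n.+1 <= kmass n].

Definition kop_radius := sup A.

Let A_ub : ubound A (kmass 0).
Proof. by move=> r [_ /(_ 0%N)]; rewrite expr1. Qed.

Let A_lb : A (Num.min c (\int[mu]_x f0 x)).
Proof.
set r := Num.min _ _.
have r0 : 0 <= r by rewrite le_min !ltW.
(* In [r ^ (n + 1)], one factor is bounded by the integral of [f0] and the other [n] by [c]: this is
   why the witness is a minimum. *)
split => // n; apply: (@le_trans _ _ (c ^+ n * \int[mu]_x f0 x)).
  rewrite exprSr ler_pM ?exprn_ge0//; last by rewrite ge_min lexx orbT.
  by rewrite lerXn2r ?nnegrE ?(ltW c_gt0)// ge_min lexx.
rewrite -bmf_intZ//; apply: bmf_int_le; [exact: bmfZ|exact: bmf_kpow|].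
exact: kpow_lb.
Qed.

Let A_sup : has_sup A.
Proof. by split; [exists (Num.min c (\int[mu]_x f0 x))|exists (kmass 0)]. Qed.

Lemma kop_radius_gt0 : 0 < kop_radius.
Proof.
apply: (@lt_le_trans _ _ (Num.min c (\int[mu]_x f0 x))).
  by rewrite lt_min c_gt0.
by apply: ub_le_sup; [exact: A_sup.2|exact: A_lb].
Qed.

(** The root of [kmass n] is an upper bound of the set, so the supremum is below it and inherits the
    defining inequality. *)
Lemma kop_radius_le n : kop_radius ^+ n.+1 <= kmass n.
Proof.
have n0 : (0 : R) < n.+1%:R by rewrite ltr0n.
have h : kop_radius <= kmass n `^ (n.+1%:R^-1).
  apply: ge_sup; first exact: A_sup.1.
  move=> r [r0 /(_ n) rn].
  have -> : r = (r ^+ n.+1) `^ (n.+1%:R^-1).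
    by rewrite -powR_mulrn// -powRrM mulfV ?gt_eqF// powRr1.
  by apply: ge0_ler_powR; rewrite ?nnegrE ?invr_ge0 ?exprn_ge0 ?kmass_ge0// ltW.
have := kop_radius_gt0 => /ltW rad0.
apply: (@le_trans _ _ ((kmass n `^ (n.+1%:R^-1)) ^+ n.+1)).
  by rewrite lerXn2r ?nnegrE ?powR_ge0.
by rewrite -powR_mulrn ?powR_ge0// -powRrM mulVf ?gt_eqF// powRr1// kmass_ge0.
Qed.

(** Above the supremum some [n] violates the defining inequality, and [kmass_mul] carries the
    violation to the multiple [(N0 + 1) (n + 1)], hence to indices as large as desired. *)
Lemma kop_radius_gt s N0 : kop_radius < s -> exists N, (N0 <= N)%N /\ kmass N <= s ^+ N.+1.
Proof.
move=> rs; have s0 : 0 <= s by rewrite (le_trans _ (ltW rs))// ltW// kop_radius_gt0.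
have [n hn] : exists n, kmass n < s ^+ n.+1.
  apply: contrapT => /forallNP h; move: rs; apply/negP; rewrite -leNgt.
  apply: ub_le_sup; first exact: A_sup.2.
  by split => // n; rewrite leNgt; exact/negP/h.
exists (N0.+1 * n.+1).-1; split.
  by rewrite -ltnS prednK ?muln_gt0// leq_pmulr.
rewrite (le_trans (kmass_mul _ _))// prednK ?muln_gt0// mulnC exprM.
by rewrite lerXn2r ?nnegrE ?kmass_ge0 ?exprn_ge0// ltW.
Qed.

End spectral_radius.

(** * Approximate eigenfunctions from truncated Neumann series *)

Section approximate_eigenfunctions.
Context {R : realType} d (T : measurableType d).
Variable mu : {finite_measure set T -> \bar R}.

(** The bound [M] and the mass one accompany the residual because they keep the limits from
    degenerating: the bound allows dominated convergence, the mass excludes zero. *)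
Definition approx_eigen (k : T -> T -> R) (rho M : R) (u : nat -> T -> R) :=
  forall j, [/\ bounded_measurable (u j), forall x, 0 <= u j x <= M,
    \int[mu]_x u j x = 1 &
    forall x, `|kop mu k (u j) x - rho * u j x| <= 5 / j.+1%:R].

(** Factors move from one side of the integral to the other one at a time, so the induction mixes
    [a] powers of the transpose with [b] powers of [k]. As a result both kernels have the same
    growth rate. *)
Lemma kmassC (k : T -> T -> R) n : bounded_kernel k ->
  kmass mu (fun x y => k y x) n = kmass mu k n.
Proof.
move=> bk; have bkC := bounded_kernelC bk.
suff h a b : \int[mu]_x (kpow mu (fun x y => k y x) a x * kpow mu k b x) =
    kmass mu k (a + b).
  have := h n 0%N; rewrite addn0 => <-.
  by apply: eq_Rintegral => x _; rewrite mulr1.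
elim: a b => [|a IH] b.
  by rewrite add0n; apply: eq_Rintegral => x _; rewrite mul1r.
rewrite addSnnS -IH -kop_adj//; exact: bmf_kpow.
Qed.

(** For the truncated series [U], the sum over [i <= N] of [s ^ -(i + 1) K^i 1], the difference
    [K U - s U] telescopes to [e - 1], and the last term [e] lies in [0, 1] because
    [K^(N + 1) 1 <= kmass N <= s ^ (N + 1)]. Division by the mass of [U], at least [delta], makes
    the residual small. *)
Lemma approx_one (k : T -> T -> R) (s delta : R) N : bounded_kernel k ->
  (forall x y, 0 < k x y) -> (forall x y, k x y <= 1) -> 0 < s -> 0 < delta ->
  kmass mu k N <= s ^+ N.+1 ->
  delta <= \sum_(i < N.+1) s ^- i.+1 * kmass mu k i ->
  exists u : T -> R, [/\ bounded_measurable u, forall x, 0 <= u x,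
    \int[mu]_x u x = 1 &
    forall x, `|kop mu k u x - s * u x| <= delta^-1].
Proof.
move=> bk k0 k1 s0 d0 hN hd.
have k0' x y : 0 <= k x y by exact: ltW.
pose F i x := s ^- i.+1 * kpow mu k i x.
have bF i : bounded_measurable (F i) by exact/bmfZ/bmf_kpow.
have F0 i x : 0 <= F i x by rewrite mulr_ge0 ?invr_ge0 ?exprn_ge0 ?kpow_ge0// ltW.
pose U x := \sum_(i < N.+1) F i x.
have bU : bounded_measurable U by exact: bmf_sum.
pose D := \int[mu]_x U x.
have DE : D = \sum_(i < N.+1) s ^- i.+1 * kmass mu k i.
  rewrite /D bmf_int_sum//; apply: eq_bigr => i _.
  by rewrite /F bmf_intZ//; exact: bmf_kpow.
have D0 : 0 < D by rewrite DE (lt_le_trans d0).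
have KU n x : \sum_(i < n.+1) kop mu k (F i) x =
    s * (\sum_(i < n.+1) F i x) - 1 + s ^- n.+1 * kpow mu k n.+1 x.
  elim: n => [|n IH].
    rewrite !big_ord1 /F expr1 kopZ//; last exact: bmf_kpow.
    by rewrite mulr1 divff ?gt_eqF// subrr add0r.
  have K1 : kop mu k (F n.+1) x = s ^- n.+2 * kpow mu k n.+2 x.
    by rewrite /F kopZ//; exact: bmf_kpow.
  have F1 : s * F n.+1 x = s ^- n.+1 * kpow mu k n.+1 x.
    by rewrite /F mulrA [s ^+ n.+2]exprS invfM mulrA divff ?gt_eqF// mul1r.
  rewrite big_ord_recr IH K1 [in RHS]big_ord_recr [in RHS]mulrDr F1.
  by congr (_ + _); rewrite addrAC.
exists (fun x => D^-1 * U x); split.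
- exact: bmfZ.
- by move=> x; rewrite mulr_ge0 ?invr_ge0 ?(ltW D0)// sumr_ge0.
- by rewrite bmf_intZ// mulVf ?gt_eqF.
- move=> x; rewrite kopZ//.
  have -> : kop mu k U x = \sum_(i < N.+1) kop mu k (F i) x by exact: kop_sum.
  rewrite KU -/(U x).
  set e := s ^- N.+1 * _.
  have e0 : 0 <= e by rewrite mulr_ge0 ?invr_ge0 ?exprn_ge0 ?kpow_ge0// ltW.
  have e1 : e <= 1.
    rewrite /e mulrC ler_pdivrMr ?exprn_gt0// mul1r.
    exact: (le_trans (kpowS_le mu bk k0 k1 N x)).
  have -> : D^-1 * (s * U x - 1 + e) - s * (D^-1 * U x) = D^-1 * (e - 1) by ring.
  rewrite normrM ger0_norm ?invr_ge0 ?(ltW D0)//.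
  apply: (@le_trans _ _ (D^-1 * 1)).
    rewrite ler_wpM2l ?invr_ge0 ?(ltW D0)//.
    by rewrite ler_norml; apply/andP; split; lra.
  by rewrite mulr1 lef_pV2 ?posrE// DE.
Qed.

Lemma bernoulli_ineq (y : R) n : 0 <= y <= 1 -> 1 - n%:R * y <= (1 - y) ^+ n.
Proof.
move=> /andP[y0 y1]; elim: n => [|n IH]; first by rewrite mul0r subr0 expr0.
rewrite exprS; apply: (@le_trans _ _ ((1 - y) * (1 - n%:R * y))); last first.
  by rewrite ler_wpM2l// subr_ge0.
rewrite -natr1 -subr_ge0.
have -> : (1 - y) * (1 - n%:R * y) - (1 - (n%:R + 1) * y) = n%:R * y ^+ 2 by ring.
by rewrite mulr_ge0// sqr_ge0.
Qed.

Lemma approx_eigen_exists (k : T -> T -> R) (rho : R) : bounded_kernel k ->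
  (forall x y, 0 < k x y) -> (forall x y, k x y <= 1) -> 0 < rho ->
  (forall n, rho ^+ n.+1 <= kmass mu k n) ->
  (forall s N0, rho < s ->
     exists N, (N0 <= N)%N /\ kmass mu k N <= s ^+ N.+1) ->
  exists u, approx_eigen k rho (3 / rho) u.
Proof.
move=> bk k0 k1 rho0 rho_le rho_gt.
suff h j : exists u : T -> R, [/\ bounded_measurable u,
    forall x, 0 <= u x <= 3 / rho, \int[mu]_x u x = 1 &
    forall x, `|kop mu k u x - rho * u x| <= 5 / j.+1%:R].
  by have [u hu] := choice h; exists u.
have k0' x y : 0 <= k x y by exact: ltW.
(* With this [y] and [s = rho / (1 - y)], each of the first [j + 1] terms of the series has mass at
   least [(1 - y) ^ (i + 1) >= 1 - (i + 1) y >= 1 / 2], whence [delta = (j + 1) / 2]. *)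
pose y : R := (2 * j.+1%:R)^-1.
have J0 : (0 : R) < j.+1%:R by rewrite ltr0n.
have J1 : (1 : R) <= j.+1%:R by rewrite ler1n.
have y0 : 0 < y by rewrite invr_gt0 mulr_gt0.
have y2 : y <= 2^-1 by rewrite lef_pV2 ?posrE ?mulr_gt0//; lra.
pose s := rho / (1 - y).
have y1 : 0 < 1 - y by lra.
have s0 : 0 < s by rewrite divr_gt0.
have rs : rho < s.
  rewrite ltr_pdivlMr// mulrBr mulr1 ltrBlDr ltrDl; exact: mulr_gt0.
have [N [jN hN]] := rho_gt s j rs.
have hd : j.+1%:R / 2 <= \sum_(i < N.+1) s ^- i.+1 * kmass mu k i.
  rewrite -(big_mkord xpredT (fun i => s ^- i.+1 * kmass mu k i)).
  rewrite (@big_cat_nat _ _ _ j.+1)//= ler_wpDr//.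
    apply: sumr_ge0 => i _.
    by rewrite mulr_ge0 ?invr_ge0 ?exprn_ge0 ?kmass_ge0// ltW.
  apply: (@le_trans _ _ (\sum_(0 <= i < j.+1) (2^-1 : R))).
    by rewrite sumr_const_nat subn0 -[leRHS]mulr_natr mulrC.
  rewrite [leLHS]big_nat [leRHS]big_nat; apply: ler_sum => i /andP[_ ij].
  apply: (@le_trans _ _ ((1 - y) ^+ i.+1)).
    apply: le_trans (bernoulli_ineq _ _); last by rewrite (ltW y0)/=; lra.
    have : i.+1%:R * y <= j.+1%:R * y by rewrite ler_wpM2r ?(ltW y0)// ler_nat.
    have : j.+1%:R * y = 2^-1 by rewrite /y; field; rewrite gt_eqF.
    by move=> ->; lra.
  have -> : 1 - y = rho / s by rewrite /s invf_div mulrA mulrC mulrA mulVf ?mul1r ?gt_eqF.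
  by rewrite expr_div_n mulrC ler_wpM2l ?invr_ge0 ?exprn_ge0// ltW.
have jd : (0 : R) < j.+1%:R / 2 by rewrite divr_gt0.
have [u [bu u0 u1 hu]] := approx_one bk k0 k1 s0 jd hN hd.
(* [s u <= K u + 2 / (j + 1) <= 1 + 2], since [K u] is at most the mass of [u], and [rho < s]. *)
have uM x : u x <= 3 / rho.
  have Ku : kop mu k u x <= 1 by rewrite -u1; exact: kop_le_int.
  have := hu x; rewrite ler_norml invf_div => /andP[h _].
  have : 2 / j.+1%:R <= (2 : R) by rewrite ler_pdivrMr// ler_peMr.
  move=> h2; rewrite ler_pdivlMr// mulrC.
  apply: (@le_trans _ _ (s * u x)); last first.
    move: h h2 Ku; set e := 2 / _; set K := kop _ _ _ _; set z := s * _.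
    by move=> *; lra.
  by rewrite ler_wpM2r// ltW.
exists u; split => //; first by move=> x; rewrite u0 uM.
move=> x; have := hu x; rewrite invf_div => hx.
have -> : kop mu k u x - rho * u x =
  (kop mu k u x - s * u x) + (s - rho) * u x by ring.
apply: le_trans (ler_normD _ _) _.
(* The 2 is the residual at [s]; the 3 is the cost of replacing [s] by [rho], from
   [s - rho <= rho / (j + 1)] and [u <= 3 / rho]. *)
have -> : 5 / j.+1%:R = 2 / j.+1%:R + 3 / j.+1%:R :> R by field; rewrite gt_eqF.
rewrite lerD// ger0_norm; last by rewrite mulr_ge0// subr_ge0 ltW.
apply: (@le_trans _ _ ((rho / j.+1%:R) * (3 / rho))); last first.
  rewrite le_eqVlt; apply/orP; left; apply/eqP; field.
  by rewrite !gt_eqF.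
apply: ler_pM => //; first by rewrite subr_ge0 ltW.
have -> : s - rho = rho * (y / (1 - y)).
  by rewrite /s; field; rewrite gt_eqF.
rewrite ler_wpM2l ?(ltW rho0)// ler_pdivrMr//.
have : j.+1%:R^-1 = 2 * y by rewrite /y; field; rewrite gt_eqF.
move=> ->; rewrite -subr_ge0.
have -> : 2 * y * (1 - y) - y = y * (1 - 2 * y) by ring.
by rewrite mulr_ge0 ?(ltW y0)//; lra.
Qed.

End approximate_eigenfunctions.

(** * Limits of the approximate eigenfunctions *)

Section perron.
Context {R : realType} d (T : measurableType d).
Variable mu : {finite_measure set T -> \bar R}.

(** [W n] is the supremum of the tail from [n] on and [w] the limsup. The last clause says that
    [W n x] is a least upper bound, which is all that the two limits need; the liminf is obtained by
    applying this to [M - u]. *)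
Lemma tail_sup (M : R) (u : nat -> T -> R) :
  (forall j, measurable_fun setT (u j)) -> (forall j x, 0 <= u j x <= M) ->
  exists (W : nat -> T -> R) (w : T -> R),
  [/\ forall n, measurable_fun setT (W n), measurable_fun setT w,
      forall n x, 0 <= W n x <= M,
      forall x, W n x @[n --> \oo] --> w x &
      forall n x, (forall j, (n <= j)%N -> u j x <= W n x) /\
        forall b, (forall j, (n <= j)%N -> u j x <= b) -> W n x <= b].
Proof.
move=> mu_ uM.
have ub x : has_ubound (range (u^~ x)).
  by exists M => _ [j _ <-]; have /andP[] := uM j x.
have lb x : has_lbound (range (u^~ x)).
  by exists 0 => _ [j _ <-]; have /andP[] := uM j x.
pose W n x := sups (u^~ x) n.
have Wc x : W n x @[n --> \oo] --> inf (range (sups (u^~ x))).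
  exact: cvg_sups_inf.
have mW n : measurable_fun setT (W n) by apply: measurable_fun_sups => //.
have Wle n x j : (n <= j)%N -> u j x <= W n x.
  move=> nj; apply: ub_le_sup; last by exists j.
  by exists M => _ [i _ <-]; have /andP[] := uM i x.
have leW n x b : (forall j, (n <= j)%N -> u j x <= b) -> W n x <= b.
  move=> h; apply: ge_sup; first by exists (u n x), n => //=.
  by move=> _ [j /= nj <-]; exact: h.
exists W, (fun x => inf (range (sups (u^~ x)))); split => //.
- apply: (@measurable_fun_cvg _ _ _ _ W) => //.
- move=> n x; apply/andP; split.
    by apply: le_trans (Wle n x n _) => //; have /andP[] := uM n x.
  by apply: leW => j _; have /andP[] := uM j x.
- by move=> n x; split; [exact: Wle|exact: leW].
Qed.

Lemma kop_cvg (k : T -> T -> R) (W : nat -> T -> R) (w : T -> R) M x :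
  bounded_kernel k -> (forall x y, 0 <= k x y) ->
  (forall n, measurable_fun setT (W n)) -> measurable_fun setT w ->
  (forall n x, 0 <= W n x <= M) -> (forall x, W n x @[n --> \oo] --> w x) ->
  kop mu k (W n) x @[n --> \oo] --> kop mu k w x.
Proof.
move=> bk k0 mW mw WM Ww.
have [mk [K kK]] := bounded_kernel1 x bk.
apply: (@bmf_dominated _ _ _ _ _ _ (K * M)).
- by move=> n; exact: measurable_funM.
- exact: measurable_funM.
- move=> n y; rewrite normrM ler_pM//.
  by have /andP[W0 WM'] := WM n y; rewrite ger0_norm.
- by move=> y; apply: cvgM; [exact: cvg_cst|exact: Ww].
Qed.

Lemma cvg_err (c : R) : c / n.+1%:R @[n --> \oo] --> 0.
Proof.
rewrite -(mulr0 c); apply: cvgM; first exact: cvg_cst.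
exact: cvg_harmonic.
Qed.

(** For [j >= n], [rho u_j <= K u_j + 5 / (j + 1) <= K W_n + 5 / (n + 1)]; the right side does not
    depend on [j], so it bounds [rho W_n], and [n] tends to infinity. The mass survives because
    [W_n >= u_n]. *)
Lemma limsup_eigen k rho M (u : nat -> T -> R) : bounded_kernel k ->
  (forall x y, 0 < k x y) -> 0 < rho -> approx_eigen mu k rho M u ->
  exists w, [/\ bounded_measurable w, forall x, 0 <= w x,
    1 <= \int[mu]_x w x & forall x, rho * w x <= kop mu k w x].
Proof.
move=> bk k0 rho0 hu; have k0' x y : 0 <= k x y by exact: ltW.
have bu j : bounded_measurable (u j) by have [] := hu j.
have uM j x : 0 <= u j x <= M by have [] := hu j.
have [|W [w [mW mw WM Ww hW]]] := tail_sup _ uM.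
  by move=> j; have [] := bu j.
have bW n : bounded_measurable (W n).
  by split => //; exists M => x; have /andP[W0 ?] := WM n x; rewrite ger0_norm.
have w0M x : 0 <= w x <= M.
  rewrite -(cvg_lim _ (Ww x))//; apply/andP; split.
    by apply: limr_ge; [exact: cvgP (Ww x)|near=> n; have /andP[] := WM n x].
  by apply: limr_le; [exact: cvgP (Ww x)|near=> n; have /andP[] := WM n x].
have bw : bounded_measurable w.
  by split => //; exists M => x; have /andP[w0 ?] := w0M x; rewrite ger0_norm.
exists w; split => //; first by move=> x; have /andP[] := w0M x.
- have h : \int[mu]_x W n x @[n --> \oo] --> \int[mu]_x w x.
    apply: (@bmf_dominated _ _ _ _ _ _ M) => // n x.
    by have /andP[W0 ?] := WM n x; rewrite ger0_norm.
  rewrite -(cvg_lim _ h)//; apply: limr_ge; first exact: cvgP h.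
  near=> n; have [_ _ <- _] := hu n; apply: bmf_int_le => // x.
  exact: (hW n x).1.
- move=> x.
  have hL : rho * W n x @[n --> \oo] --> rho * w x.
    by apply: cvgM; [exact: cvg_cst|exact: Ww].
  have hR : kop mu k (W n) x + 5 / n.+1%:R @[n --> \oo] --> kop mu k w x + 0.
    have hK := @kop_cvg k W w M x bk k0' mW mw WM Ww.
    exact: (cvgD hK (cvg_err 5)).
  rewrite -[leRHS]addr0 -(cvg_lim _ hL)// -(cvg_lim _ hR)//.
  apply: ler_lim; [exact: cvgP hL|exact: cvgP hR|near=> n].
  rewrite mulrC -ler_pdivlMr//; apply: (hW n x).2 => j nj.
  rewrite ler_pdivlMr// [leLHS]mulrC.
  have [_ _ _ /(_ x)] := hu j; rewrite ler_norml => /andP[h _].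
  have h1 : kop mu k (u j) x <= kop mu k (W n) x.
    by apply: kop_le => // y; exact: (hW n y).1.
  have h2 : 5 / j.+1%:R <= 5 / n.+1%:R :> R.
    by rewrite ler_wpM2l// lef_pV2 ?posrE// ler_nat ltnS.
  move: h h1 h2; set a := kop _ _ _ _; set b := kop _ _ _ _.
  set e := 5 / _; set f := 5 / _; set z := rho * _ => *; lra.
Unshelve. all: by end_near. Qed.

(** The inequality mirrors that of the limsup, with the infima [V n] of the tails. Strict positivity
    is a separate matter, settled point by point from the smoothing of the kernel. *)
Lemma liminf_eigen k rho M (v : nat -> T -> R) : bounded_kernel k ->
  (forall x y, 0 < k x y) -> 0 < rho ->
  approx_eigen mu (fun x y => k y x) rho M v ->
  exists w, [/\ bounded_measurable w, forall x, 0 < w x &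
    forall y, kop mu (fun x y => k y x) w y <= rho * w y].
Proof.
move=> bk k0 rho0; set kC := (fun x y => _).
have bkC : bounded_kernel kC by exact: bounded_kernelC.
move=> hv; have k0' x y : 0 <= kC x y by exact: (ltW (k0 y x)).
have bv j : bounded_measurable (v j) by have [] := hv j.
have vM j x : 0 <= v j x <= M by have [] := hv j.
have uM j x : 0 <= M - v j x <= M.
  by have /andP[v0 vM'] := vM j x; apply/andP; split; lra.
have [|W [w' [mW mw' WM Ww hW]]] := tail_sup _ uM.
  by move=> j; have [] := bmfB (bmf_cst _ M) (bv j).
pose V n x := M - W n x.
pose w x := M - w' x.
have mV n : measurable_fun setT (V n) by exact: measurable_funB.
have mw : measurable_fun setT w by exact: measurable_funB.
have VM n x : 0 <= V n x <= M.
  by have /andP[W0 WM'] := WM n x; rewrite /V; apply/andP; split; lra.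
have Vw x : V n x @[n --> \oo] --> w x.
  by apply: cvgB; [exact: cvg_cst|exact: Ww].
have Vle n x j : (n <= j)%N -> V n x <= v j x.
  by move=> nj; have := (hW n x).1 j nj; rewrite /V; lra.
have leV n x b : (forall j, (n <= j)%N -> b <= v j x) -> b <= V n x.
  move=> h; have : W n x <= M - b; last by rewrite /V; lra.
  by apply: (hW n x).2 => j nj; have := h j nj; lra.
have bV n : bounded_measurable (V n).
  by split => //; exists M => x; have /andP[V0 ?] := VM n x; rewrite ger0_norm.
have V_w n x : V n x <= w x.
  rewrite -(cvg_lim _ (Vw x))//; apply: limr_ge; first exact: cvgP (Vw x).
  near=> m; apply: leV => j mj; apply: Vle; apply: leq_trans mj.
  by near: m; exists n.
have w0M x : 0 <= w x <= M.
  rewrite -(cvg_lim _ (Vw x))//; apply/andP; split.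
    by apply: limr_ge; [exact: cvgP (Vw x)|near=> n; have /andP[] := VM n x].
  by apply: limr_le; [exact: cvgP (Vw x)|near=> n; have /andP[] := VM n x].
have bw : bounded_measurable w.
  by split => //; exists M => x; have /andP[w0 ?] := w0M x; rewrite ger0_norm.
have h5 (n j : nat) : (n <= j)%N -> 5 / j.+1%:R <= 5 / n.+1%:R :> R.
  by move=> nj; rewrite ler_wpM2l// lef_pV2 ?posrE// ler_nat ltnS.
exists w; split => // [y|y].
- have M0 : 0 <= M by have /andP[] := vM 0%N y; exact: le_trans.
  have [mky _] := bounded_kernel1 y bkC.
  have bky := bounded_kernel1 y bkC.
  have hd := damp_cvg mu mky (fun x => k0 x y) (bmf_cst T M).
  (* Mass one gives [1 <= \int exp (- n k) M + n K' v_j y], where the first term does not depend on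
     [j]; once it is below 1/2, [K' v_j y >= 1 / (2 n)] for all [j]. *)
  have [n hn] : exists n : nat,
      \int[mu]_x (expR (- (n%:R * kC y x)) * M) < 2^-1 /\ (0 < n)%N.
    have h12 : (0 : R) < 2^-1 by rewrite invr_gt0.
    near \oo => n; exists n; split; last by near: n; exists 1%N.
    near: n; exact: (cvgr_lt _ hd).
  have [hn1 n0] := hn.
  have nR : (0 : R) < n%:R by rewrite ltr0n.
  have lb j : (2 * n%:R)^-1 <= kop mu kC (v j) y.
    have [_ _ v1 _] := hv j.
    have := int_damp_le mu n bky (k0' y) (bv j) (fun x => (andP (vM j x)).1).
    rewrite v1 -/(kop mu kC (v j) y) => h1.
    have h2 : \int[mu]_x (expR (- (n%:R * kC y x)) * v j x) <=
              \int[mu]_x (expR (- (n%:R * kC y x)) * M).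
      apply: bmf_int_le.
      - by apply: bmfM => //; apply: bmf_damp => //; exact: k0'.
      - by apply: bmfM; [apply: bmf_damp => //; exact: k0'|exact: bmf_cst].
      - by move=> x; rewrite ler_wpM2l ?expR_ge0//; have /andP[] := vM j x.
    rewrite invfM ler_pdivrMr// [leRHS]mulrC.
    move: h1 h2 hn1; set a := Rintegral _ _ _; set b := Rintegral _ _ _.
    by set z := n%:R * kop _ _ _ _ => *; lra.
  have q0 : (0 : R) < (4 * n%:R)^-1 by rewrite invr_gt0 mulr_gt0.
  (* Half of the lower bound is given up to absorb the residual, for all [j >= J]. *)
  have [J hJ] : exists J : nat, 5 / J.+1%:R < (4 * n%:R)^-1 :> R.
    near \oo => J; exists J; near: J; exact: (cvgr_lt _ (cvg_err 5)).
  apply: lt_le_trans (V_w J y).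
  apply: (@lt_le_trans _ _ ((4 * n%:R)^-1 / rho)); first by rewrite divr_gt0.
  apply: leV => j Jj; rewrite ler_pdivrMr// [leRHS]mulrC.
  have [_ _ _ /(_ y)] := hv j; rewrite ler_norml => /andP[_ h].
  have := h5 J j Jj; have := lb j.
  have e4 : (2 * n%:R)^-1 = 2 * (4 * n%:R)^-1 :> R by field; rewrite gt_eqF.
  rewrite e4; move: h hJ; set a := kop _ _ _ _; set e := 5 / _; set f := 5 / _.
  by set z := rho * _; set q := (4 * _)^-1 => *; lra.
- have hL : kop mu kC (V n) y - 5 / n.+1%:R @[n --> \oo] --> kop mu kC w y - 0.
    have hK := @kop_cvg kC V w M y bkC k0' mV mw VM Vw.
    exact: (cvgB hK (cvg_err 5)).
  have hR : rho * V n y @[n --> \oo] --> rho * w y.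
    by apply: cvgM; [exact: cvg_cst|exact: Vw].
  rewrite -[leLHS]subr0 -(cvg_lim _ hL)// -(cvg_lim _ hR)//.
  apply: ler_lim; [exact: cvgP hL|exact: cvgP hR|near=> n].
  rewrite [leRHS]mulrC -ler_pdivrMr//; apply: leV => j nj.
  rewrite ler_pdivrMr// [leRHS]mulrC.
  have [_ _ _ /(_ y)] := hv j; rewrite ler_norml => /andP[_ h].
  have h1 : kop mu kC (V n) y <= kop mu kC (v j) y.
    by apply: kop_le => // x; exact: Vle.
  have := h5 n j nj.
  move: h h1; set a := kop _ _ _ _; set b := kop _ _ _ _.
  by set e := 5 / _; set f := 5 / _; set z := rho * _ => *; lra.
Unshelve. all: by end_near. Qed.

End perron.

Section perron_theorem.
Context {R : realType} d (T : measurableType d).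
Variable mu : {finite_measure set T -> \bar R}.

(** The defect [g = K w - rho w >= 0] has a nonpositive integral against [v'], because
    [K' v' <= rho v']; as [v' > 0], [g] has integral 0 and [K g = 0] at every point. Hence the
    eigenfunction is [u = K w] and not [w]: the extra application turns an almost everywhere
    equality into an exact one. The defect of [v'] is then paired with [u]. *)
Lemma perron_exists (k : T -> T -> R) (c : R) (f0 : T -> R) : bounded_kernel k ->
  (forall x y, 0 < k x y) -> (forall x y, k x y <= 1) ->
  0 < c -> bounded_measurable f0 -> (forall x, 0 <= f0 x <= 1) ->
  0 < \int[mu]_x f0 x -> (forall x, c * f0 x <= kop mu k f0 x) ->
  exists (rho : R) (u v : T -> R),
  [/\ 0 < rho, bounded_measurable u, bounded_measurable v &
  [/\ forall x, 0 < u x, forall x, 0 < v x,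
      forall x, kop mu k u x = rho * u x &
      forall y, kop mu (fun x y => k y x) v y = rho * v y]].
Proof.
move=> bk k0 k1 c0 bf0 f01 If0 kf0.
have bkC := bounded_kernelC bk.
pose rho := kop_radius mu k.
have rho0 : 0 < rho by exact: (kop_radius_gt0 bk k0 c0 bf0 f01 If0 kf0).
have rho_le := kop_radius_le bk k0 c0 bf0 f01 If0 kf0.
have rho_gt := fun s N0 => @kop_radius_gt _ _ _ mu k bk k0 k1 c f0 c0 bf0 f01 If0 kf0 s N0.
have [us hus] := approx_eigen_exists bk k0 k1 rho0 rho_le rho_gt.
have [vs hvs] : exists vs, approx_eigen mu (fun x y => k y x) rho (3 / rho) vs.
  apply: (approx_eigen_exists bkC (fun x y => k0 y x) (fun x y => k1 y x) rho0).
  - by move=> n; rewrite kmassC//; exact: rho_le.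
  - by move=> s N0 hs; have [N ?] := rho_gt s N0 hs; exists N; rewrite kmassC.
have [w [bw w0 w1 kw]] := limsup_eigen bk k0 rho0 hus.
have [v' [bv' v'0 kv']] := liminf_eigen bk k0 rho0 hvs.
have bKw : bounded_measurable (kop mu k w) by exact: bmf_kop.
have bKv : bounded_measurable (kop mu (fun x y => k y x) v') by exact: bmf_kop.
pose g x := kop mu k w x - rho * w x.
have bg : bounded_measurable g by apply: bmfB => //; exact: bmfZ.
have g0 x : 0 <= g x by rewrite subr_ge0.
have Ivg : \int[mu]_x (v' x * g x) = 0.
  apply/eqP; rewrite eq_le; apply/andP; split; last first.
    by apply: int_ge0 => x; rewrite mulr_ge0// ltW.
  rewrite (_ : \int[mu]_x (v' x * g x) =
    \int[mu]_x (v' x * kop mu k w x) - \int[mu]_x (rho * v' x * w x)); last first.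
    rewrite -bmf_intB; try exact: bmfM.
      by apply: eq_Rintegral => x _; rewrite /g mulrBr mulrCA mulrA.
    by apply: bmfM => //; exact: bmfZ.
  rewrite kop_adj// subr_le0; apply: bmf_int_le.
  - exact: bmfM.
  - by apply: bmfM => //; exact: bmfZ.
  - by move=> x; rewrite ler_wpM2r.
have Ig : \int[mu]_x g x = 0 by exact: (int_pos_mul_eq0 bv' v'0 bg g0 Ivg).
pose u := kop mu k w.
have ku x : kop mu k u x = rho * u x.
  have : kop mu k g x = 0 by exact: (int_eq0_mul (bounded_kernel1 x bk) bg g0 Ig).
  by rewrite /g kopB//; [rewrite kopZ// => /eqP; rewrite subr_eq0 => /eqP|exact: bmfZ].
have u0 x : 0 < u x.
  apply: (int_pos_mul_gt0 (bounded_kernel1 x bk)) => //.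
  by rewrite (lt_le_trans _ w1).
pose h x := rho * v' x - kop mu (fun x y => k y x) v' x.
have bh : bounded_measurable h by apply: bmfB => //; exact: bmfZ.
have h0 x : 0 <= h x by rewrite subr_ge0.
have Iuh : \int[mu]_x (u x * h x) = 0.
  rewrite (_ : \int[mu]_x (u x * h x) = \int[mu]_x (rho * u x * v' x) -
     \int[mu]_x (u x * kop mu (fun x y => k y x) v' x)); last first.
    rewrite -bmf_intB; first last.
    - exact: bmfM.
    - by apply: bmfM => //; exact: bmfZ.
    by apply: eq_Rintegral => x _; rewrite /h mulrBr mulrCA mulrA.
  rewrite kop_adj//; apply/eqP; rewrite subr_eq0; apply/eqP.
  by apply: eq_Rintegral => x _; rewrite -ku.
have Ih : \int[mu]_x h x = 0 by exact: (int_pos_mul_eq0 bKw u0 bh h0 Iuh).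
pose v := kop mu (fun x y => k y x) v'.
have kv y : kop mu (fun x y => k y x) v y = rho * v y.
  have : kop mu (fun x y => k y x) h y = 0.
    exact: (int_eq0_mul (bounded_kernel1 y bkC) bh h0 Ih).
  rewrite /h kopB//; last exact: bmfZ.
  by rewrite kopZ// => /eqP; rewrite subr_eq0 => /eqP.
have muT : 0 < \int[mu]_x (1 : R).
  by apply: lt_le_trans If0 _; apply: bmf_int_le => // [|x];
    [exact: bmf_cst|have /andP[] := f01 x].
have v0 y : 0 < v y.
  apply: (int_pos_mul_gt0 (bounded_kernel1 y bkC)) => //.
    by move=> x; exact: ltW.
  have := int_pos_mul_gt0 bv' v'0 (bmf_cst T 1) (fun=> ler01) muT.
  by under eq_Rintegral do rewrite mulr1.
by exists rho, u, v; split.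
Qed.

(** * Contraction on the functions orthogonal to the left eigenfunction *)

Section contraction.
Variables (k : T -> T -> R) (rho : R) (v : T -> R).
Hypotheses (bk : bounded_kernel k) (k0 : forall x y, 0 < k x y)
  (k1 : forall x y, k x y <= 1) (rho0 : 0 < rho)
  (bv : bounded_measurable v) (v0 : forall x, 0 < v x)
  (kv : forall y, kop mu (fun x y => k y x) v y = rho * v y)
  (mu0 : 0 < \int[mu]_x (1 : R)).

Let k0' x y : 0 <= k x y. Proof. exact: ltW. Qed.
Let v0' x : 0 <= v x. Proof. exact: ltW. Qed.

Let S (f : T -> R) x := rho^-1 * kop mu k f x.
Let B (f : T -> R) := \int[mu]_x (v x * `|f x|).

Let bS f : bounded_measurable f -> bounded_measurable (S f).
Proof. by move=> bf; exact/bmfZ/bmf_kop. Qed.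

Let B_ge0 f : 0 <= B f.
Proof. by apply: int_ge0 => x; rewrite mulr_ge0. Qed.

Let int_vS f : bounded_measurable f ->
  \int[mu]_x (v x * S f x) = \int[mu]_x (v x * f x).
Proof.
move=> bf; under eq_Rintegral do rewrite mulrCA.
rewrite bmf_intZ; last by apply: bmfM => //; exact: bmf_kop.
rewrite kop_adj//; under eq_Rintegral do rewrite kv -mulrA.
by rewrite bmf_intZ ?mulrA ?mulVf ?mul1r ?gt_eqF//; exact: bmfM.
Qed.

(** As [k <= 1], [|K f|] is at most the integral of [|f|], which damping by [exp (- n v)] splits
    into a small multiple of [Z] and [n] times the weighted mass. The factor 1/4 leaves room for the
    multiple of [Z] that comes back from the mass estimate. *)
Let sup_step : exists2 C : R, 0 < C & forall f Z, bounded_measurable f ->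
  (forall x, `|f x| <= Z) -> forall x, `|S f x| <= 4^-1 * Z + C * B f.
Proof.
have [mv _] := bv.
have hd := damp_cvg mu mv v0 (bmf_cst T 1).
have [n hn n0] : exists2 n : nat,
    \int[mu]_x (expR (- (n%:R * v x)) * 1) < rho / 4 & (0 < n)%N.
  have h4 : (0 : R) < rho / 4 by rewrite divr_gt0.
  near \oo => n; exists n; last by near: n; exists 1%N.
  near: n; exact: (cvgr_lt _ hd).
exists (rho^-1 * n%:R); first by rewrite mulr_gt0 ?invr_gt0// ltr0n.
move=> f Z bf fZ x.
have baf : bounded_measurable (fun x => `|f x|) by exact: bmf_norm.
rewrite /S normrM ger0_norm ?invr_ge0 ?(ltW rho0)//.
have -> : 4^-1 * Z + rho^-1 * n%:R * B f = rho^-1 * (rho / 4 * Z + n%:R * B f).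
  by field; rewrite gt_eqF.
rewrite ler_wpM2l ?invr_ge0 ?(ltW rho0)//.
apply: le_trans (kop_norm mu x bk k0' bf) _.
have af0 y : 0 <= `|f y| by [].
apply: le_trans (kop_le_int mu bk k1 x baf af0) _.
apply: le_trans (int_damp_le mu n bv v0' baf af0) _.
rewrite lerD2r//.
have Z0 : 0 <= Z by apply: le_trans (fZ x).
apply: (@le_trans _ _ (\int[mu]_x (expR (- (n%:R * v x)) * 1) * Z)); last first.
  by rewrite ler_wpM2r// ltW.
have bd : bounded_measurable (fun x => expR (- (n%:R * v x))) by exact: bmf_damp.
rewrite -bmf_intZr; last by apply: bmfM => //; exact: bmf_cst.
apply: bmf_int_le => [||y].
- exact: bmfM.
- by apply: bmfM; [apply: bmfM => //|]; exact: bmf_cst.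
- by rewrite mulr1 ler_wpM2l ?expR_ge0.
Unshelve. all: by end_near. Qed.

Let J (n : nat) := \int[mu]_x \int[mu]_y expR (- (n%:R * k x y)).

Let bdk (n : nat) : bounded_kernel (fun x y => expR (- (n%:R * k x y))).
Proof.
have [mk _] := bk.
exact: (@bmf_damp _ _ _ n (fun z : T * T => k z.1 z.2)).
Qed.

Let J_cvg : J n @[n --> \oo] --> (0 : R).
Proof.
rewrite (_ : 0 = \int[mu]_x (0 : R)); last by rewrite int_cst mul0r.
pose M := \int[mu]_x (1 : R).
have bJ n := bmf_int_kernel mu (bdk n).
apply: (@bmf_dominated _ _ _ _ _ _ M).
- by move=> n; have [] := bJ n.
- exact: measurable_cst.
- move=> n x; rewrite ger0_norm; last by apply: int_ge0 => y; exact: expR_ge0.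
  apply: bmf_int_le => [||y]; [exact: (bounded_kernel1 x (bdk n))|exact: bmf_cst|].
  by rewrite -expR0 ler_expR oppr_le0 mulr_ge0.
- move=> x; have [mkx _] := bounded_kernel1 x bk.
  have := damp_cvg mu mkx (k0 x) (bmf_cst T 1).
  by under eq_fun do under eq_Rintegral do rewrite mulr1.
Qed.

Let v_bound : exists2 V, 0 < V & forall x, v x <= V.
Proof.
have [_ [V vV]] := bv; exists (`|V| + 1) => [|x]; first by rewrite ltr_wpDl.
by rewrite (le_trans (ler_norm _))// (le_trans (vV x))// (le_trans (ler_norm _))// lerDl.
Qed.

(** A lower bound of [K f] by the mass of [f] although [k] has no lower bound: [int_damp_le] with
    weight [k x], after [v <= V] has converted weighted mass into plain mass. *)
Let kop_lb f Z V n x : bounded_measurable f -> (forall x, 0 <= f x <= Z) ->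
  0 < V -> (forall x, v x <= V) -> (0 < n)%N ->
  n%:R^-1 * (V^-1 * (\int[mu]_x (v x * f x)) -
             Z * \int[mu]_y expR (- (n%:R * k x y))) <= kop mu k f x.
Proof.
move=> bf f0Z V0 vV n0.
have f0 y : 0 <= f y by have /andP[] := f0Z y.
have bkx := bounded_kernel1 x bk.
have bdx := bounded_kernel1 x (bdk n).
rewrite mulrC ler_pdivrMr ?ltr0n// lerBlDl mulrC.
apply: (@le_trans _ _ (\int[mu]_x f x)).
  rewrite ler_pdivrMr// -bmf_intZr//.
  apply: bmf_int_le => [||y]; [exact: bmfM|exact: (bmfM bf (bmf_cst T V))|].
  by rewrite mulrC ler_wpM2l.
apply: le_trans (int_damp_le mu n bkx (k0' x) bf f0) _.
rewrite [X in _ <= _ + X]mulrC lerD2r// mulrC -bmf_intZr//.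
apply: bmf_int_le => [||y]; [exact: bmfM|exact: (bmfM bdx (bmf_cst T Z))|].
by rewrite ler_wpM2l ?expR_ge0//; have /andP[] := f0Z y.
Qed.

(** Orthogonality to [v] gives the positive and negative parts of [f] the same weighted mass
    [B f / 2]. Both images exceed the same function [G], so cancellation removes [2 G] from [K |f|].
    The price for the places where [k] is small is the term in [J n * Z]. *)
Let mass_step f Z V n : bounded_measurable f ->
  \int[mu]_x (v x * f x) = 0 -> (forall x, `|f x| <= Z) ->
  0 < V -> (forall x, v x <= V) -> (0 < n)%N ->
  B (S f) <= B f - (rho * n%:R * V)^-1 * (\int[mu]_x v x) * B f
             + 2 * (rho * n%:R)^-1 * V * J n * Z.
Proof.
move=> bf vf0 fZ V0 vV n0.
have n0' : (0 : R) < n%:R by rewrite ltr0n.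
have baf := bmf_norm bf.
pose fp x := 2^-1 * (`|f x| + f x).
pose fm x := 2^-1 * (`|f x| - f x).
have bfp : bounded_measurable fp by apply: bmfZ; exact: bmfD.
have bfm : bounded_measurable fm by apply: bmfZ; exact: bmfB.
have fpZ x : 0 <= fp x <= Z.
  have := fZ x; have := ler_norm (f x); have := ler_normr (f x) (- f x).
  have : - `|f x| <= f x by rewrite lerNl -normrN ler_norm.
  by rewrite /fp; move=> *; apply/andP; split; lra.
have fmZ x : 0 <= fm x <= Z.
  have := fZ x; have := ler_norm (f x).
  have : - `|f x| <= f x by rewrite lerNl -normrN ler_norm.
  by rewrite /fm; move=> *; apply/andP; split; lra.
have vfp : \int[mu]_x (v x * fp x) = 2^-1 * B f.
  transitivity (2^-1 * \int[mu]_x (v x * `|f x| + v x * f x)).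
    rewrite -bmf_intZ; last by apply: bmfD; exact: bmfM.
    by apply: eq_Rintegral => x _; rewrite /fp; ring.
  by rewrite bmf_intD; [rewrite vf0 addr0|exact: bmfM|exact: bmfM].
have vfm : \int[mu]_x (v x * fm x) = 2^-1 * B f.
  transitivity (2^-1 * \int[mu]_x (v x * `|f x| - v x * f x)).
    rewrite -bmf_intZ; last by apply: bmfB; exact: bmfM.
    by apply: eq_Rintegral => x _; rewrite /fm; ring.
  by rewrite bmf_intB; [rewrite vf0 subr0|exact: bmfM|exact: bmfM].
pose E x := \int[mu]_y expR (- (n%:R * k x y)).
have bE : bounded_measurable E by exact: (bmf_int_kernel mu (bdk n)).
pose G x := n%:R^-1 * (V^-1 * (2^-1 * B f) - Z * E x).
have bG : bounded_measurable G.
  by apply/bmfZ/bmfB; [exact: bmf_cst|exact: bmfZ].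
have Gp x : G x <= kop mu k fp x by rewrite /G -vfp; exact: kop_lb.
have Gm x : G x <= kop mu k fm x by rewrite /G -vfm; exact: kop_lb.
have SG x : `|S f x| <= rho^-1 * (kop mu k (fun y => `|f y|) x - 2 * G x).
  rewrite /S normrM ger0_norm ?invr_ge0 ?(ltW rho0)//.
  rewrite ler_wpM2l ?invr_ge0 ?(ltW rho0)//.
  have e1 : kop mu k (fun y => `|f y|) x = kop mu k fp x + kop mu k fm x.
    by rewrite -kopD//; congr kop; apply/funext => y; rewrite /fp /fm; field.
  have e2 : kop mu k f x = kop mu k fp x - kop mu k fm x.
    by rewrite -kopB//; congr kop; apply/funext => y; rewrite /fp /fm; field.
  have := Gp x; have := Gm x; rewrite e1 e2 ler_norml => ? ?.
  by apply/andP; split; lra.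
have bKa : bounded_measurable (kop mu k (fun y => `|f y|)) by exact: bmf_kop.
have bR : bounded_measurable (fun x => v x * (rho^-1 * (kop mu k (fun y => `|f y|) x - 2 * G x))).
  by apply/bmfM => //; apply/bmfZ/bmfB => //; exact: bmfZ.
apply: (@le_trans _ _ (\int[mu]_x (v x * (rho^-1 * (kop mu k (fun y => `|f y|) x - 2 * G x))))).
  apply: bmf_int_le => // [|x]; last by rewrite ler_wpM2l.
  by apply: bmfM => //; exact/bmf_norm/bS.
have -> : \int[mu]_x (v x * (rho^-1 * (kop mu k (fun y => `|f y|) x - 2 * G x)))
  = \int[mu]_x (v x * S (fun y => `|f y|) x) -
    2 * rho^-1 * \int[mu]_x (v x * G x).
  rewrite -bmf_intZ; last exact: bmfM.
  rewrite -bmf_intB; first last.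
  - by apply: bmfZ; exact: bmfM.
  - by apply: bmfM => //; exact: bS.
  by apply: eq_Rintegral => x _; rewrite /S; ring.
rewrite int_vS// -/(B f).
have vE : \int[mu]_x (v x * E x) <= V * J n.
  rewrite -bmf_intZ//; apply: bmf_int_le => [||x]; [exact: bmfM|exact: bmfZ|].
  by rewrite ler_wpM2r//; apply: int_ge0 => y; exact: expR_ge0.
have vG : n%:R^-1 * (V^-1 * (2^-1 * B f) * (\int[mu]_x v x) - Z * (V * J n)) <=
    \int[mu]_x (v x * G x).
  have -> : \int[mu]_x (v x * G x) = n%:R^-1 *
      (V^-1 * (2^-1 * B f) * (\int[mu]_x v x) - Z * \int[mu]_x (v x * E x)).
    rewrite -[_ * \int[mu]_x v x]bmf_intZ// -[Z * _]bmf_intZ; last exact: bmfM.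
    rewrite -bmf_intB; [|exact: bmfZ|by apply: bmfZ; exact: bmfM].
    rewrite -bmf_intZ; last first.
      by apply: bmfB; [exact: bmfZ|apply: bmfZ; exact: bmfM].
    by apply: eq_Rintegral => x _; rewrite /G; ring.
  have Z0 : 0 <= Z.
    by have /andP[h1 h2] := fpZ point; exact: le_trans h2.
  by rewrite ler_wpM2l ?invr_ge0 ?(ltW n0')// lerB// ler_wpM2l.
have rn0 : 0 < 2 * rho^-1 by rewrite mulr_gt0 ?invr_gt0.
have -> : B f - (rho * n%:R * V)^-1 * \int[mu]_x v x * B f
    + 2 * (rho * n%:R)^-1 * V * J n * Z =
  B f - 2 * rho^-1 * (n%:R^-1 * (V^-1 * (2^-1 * B f) * (\int[mu]_x v x) - Z * (V * J n))).
  by field; rewrite !gt_eqF.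
by rewrite lerB// ler_wpM2l// ltW.
Qed.

(** Neither estimate contracts alone: the first leaks [C B f], the second a multiple of [Z]. The
    weight [theta] makes the gain [theta kap B f = 2 C B f] beat the first leak. It grows like [n],
    but the second leak carries [1 / n], so their product is a constant times [J n * Z] and falls
    below [Z / 2] for large [n]. *)
Lemma contraction_step : exists (theta gamma : R),
  [/\ 0 < theta, 0 < gamma < 1 &
  forall f Z, bounded_measurable f -> \int[mu]_x (v x * f x) = 0 ->
    (forall x, `|f x| <= Z) -> exists Z', (forall x, `|S f x| <= Z') /\
      Z' + theta * B (S f) <= gamma * (Z + theta * B f)].
Proof.
have [C C0 hC] := sup_step.
have [V V0 vV] := v_bound.
pose I := \int[mu]_x v x.
have I0 : 0 < I.
  have := int_pos_mul_gt0 bv v0 (bmf_cst T 1) (fun=> ler01) mu0.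
  by under eq_Rintegral do rewrite mulr1.
(* The first condition bounds the leak of the mass estimate by [Z / 2]; the second one is
   [kap <= 1]. *)
have [n [hJ hk n0]] : exists n : nat,
    [/\ 8 * C * V ^+ 2 / I * J n <= 1, I / (rho * V) <= n%:R & (0 < n)%N].
  have hJ : 8 * C * V ^+ 2 / I * J m @[m --> \oo] --> 8 * C * V ^+ 2 / I * 0.
    by apply: cvgM; [exact: cvg_cst|exact: J_cvg].
  rewrite mulr0 in hJ.
  near \oo => n; exists n; split.
  - by apply: ltW; near: n; apply: (cvgr_lt _ hJ).
  - by near: n; exact: nbhs_infty_ger.
  - by near: n; exists 1%N.
have n0' : (0 : R) < n%:R by rewrite ltr0n.
pose kap := (rho * n%:R * V)^-1 * I.
have kap0 : 0 < kap by rewrite mulr_gt0 ?invr_gt0 ?mulr_gt0.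
have kap1 : kap <= 1.
  rewrite /kap mulrC ler_pdivrMr ?mulr_gt0// mul1r.
  by move: hk; rewrite ler_pdivrMr ?mulr_gt0// mulrC mulrAC.
pose theta := 2 * C / kap.
have theta0 : 0 < theta by apply: divr_gt0 => //; exact: mulr_gt0.
(* The coefficient of [Z] becomes [1/4 + 1/2], that of [B f] becomes
   [theta - C = theta (1 - kap / 2)]; as [kap <= 1], both ratios are at most [1 - kap / 4]. *)
pose gamma := 1 - kap / 4.
exists theta, gamma; split => //; first by rewrite /gamma; apply/andP; split; lra.
move=> f Z bf vf0 fZ; exists (4^-1 * Z + C * B f); split; first exact: hC.
have Z0 : 0 <= Z by apply: le_trans (fZ point).
have hB := mass_step bf vf0 fZ V0 vV n0.
have B0 := B_ge0 f.
apply: (@le_trans _ _ (4^-1 * Z + C * B f + theta *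
   (B f - kap * B f + 2 * (rho * n%:R)^-1 * V * J n * Z))).
  by rewrite lerD2l ler_wpM2l// ltW.
have e1 : theta * (2 * (rho * n%:R)^-1 * V * J n * Z) =
    2^-1 * (8 * C * V ^+ 2 / I * J n) * Z.
  rewrite /theta /kap; field; rewrite !gt_eqF//.
have e2 : theta * kap = 2 * C by rewrite /theta mulrAC -mulrA divff ?gt_eqF// mulr1.
have h1 : 2^-1 * (8 * C * V ^+ 2 / I * J n) * Z <= 2^-1 * Z.
  by rewrite ler_wpM2r//; lra.
have -> : 4^-1 * Z + C * B f + theta *
   (B f - kap * B f + 2 * (rho * n%:R)^-1 * V * J n * Z) =
   4^-1 * Z + C * B f + theta * B f - (theta * kap) * B f +
   theta * (2 * (rho * n%:R)^-1 * V * J n * Z) by ring.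
rewrite e1 e2.
have -> : gamma * (Z + theta * B f) =
   Z - kap / 4 * Z + theta * B f - (theta * kap) / 4 * B f by rewrite /gamma; ring.
rewrite e2.
have h2 : kap * Z <= Z by rewrite ler_piMl.
have h3 : 0 <= C * B f by rewrite mulr_ge0// ltW.
move: h1 h2 h3; set a := 2^-1 * (_) * Z; set b := C * B f.
have -> : 2 * C * B f = 2 * b by rewrite /b mulrA.
have -> : 2 * C / 4 * B f = 2^-1 * b by rewrite /b; field.
have -> : kap / 4 * Z = 4^-1 * (kap * Z) by field.
by set e := kap * Z; set g := theta * _ => *; lra.
Unshelve. all: by end_near. Qed.

(** [S] preserves the integral against [v], hence orthogonality, so the step can be iterated. Only
    the sup part of the mixed norm is kept at the end; [c] comes from [B f <= Z \int v]. *)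
Lemma kop_contraction : exists (c gamma : R), [/\ 0 < c, 0 < gamma < 1 &
  forall f Z, bounded_measurable f -> \int[mu]_x (v x * f x) = 0 ->
    (forall x, `|f x| <= Z) -> forall n x,
    `|iter n (kop mu k) f x| <= c * gamma ^+ n * rho ^+ n * Z].
Proof.
have [theta [gamma [theta0 g01 h]]] := contraction_step.
pose c := 1 + theta * \int[mu]_x v x.
have Iv0 : 0 <= \int[mu]_x v x by exact: int_ge0.
exists c, gamma; split => //.
  by rewrite /c ltr_wpDr// mulr_ge0// ltW.
have /andP[g0 g1] := g01.
move=> f Z bf vf0 fZ n.
have Sn : iter n (kop mu k) f = fun x => rho ^+ n * iter n S f x.
  elim: n => [|n IH]; first by apply/funext => x; rewrite expr0 mul1r.
  apply/funext => x /=; rewrite IH kopZ//; last first.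
    by elim: n {IH} => [|n IH] //=; exact: bS.
  by rewrite {2}/S exprSr; field; rewrite gt_eqF.
have [Z' [[bn vn] hZ' hn]] : exists Z', [/\ bounded_measurable (iter n S f) /\
    \int[mu]_x (v x * iter n S f x) = 0, (forall x, `|iter n S f x| <= Z') &
    Z' + theta * B (iter n S f) <= gamma ^+ n * (Z + theta * B f)].
  elim: n {Sn} => [|n [Z' [[bn vn] hZ' hn]]].
    by exists Z; rewrite expr0 mul1r.
  have [Z2 [h2 hn2]] := h _ _ bn vn hZ'.
  exists Z2; split => //=; first by split; [exact: bS|rewrite int_vS].
  apply: le_trans hn2 _; rewrite exprS -mulrA ler_wpM2l//; exact: ltW.
move=> x; rewrite Sn normrM ger0_norm; last by rewrite exprn_ge0// ltW.
rewrite [leRHS]mulrAC [leRHS]mulrC ler_wpM2l ?exprn_ge0 ?(ltW rho0)//.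
apply: le_trans (hZ' x) _.
apply: (@le_trans _ _ (Z' + theta * B (iter n S f))).
  by rewrite lerDl mulr_ge0// ltW.
apply: le_trans hn _.
rewrite mulrAC [leRHS]mulrC ler_wpM2l ?exprn_ge0 ?(ltW g0)//.
rewrite /c mulrDl mul1r lerD2l -mulrA ler_wpM2l ?(ltW theta0)//.
rewrite -bmf_intZr//; apply: bmf_int_le => [||y].
- by apply: bmfM => //; exact: bmf_norm.
- exact: (bmfM bv (bmf_cst T Z)).
- by rewrite ler_wpM2l.
Qed.

End contraction.
End perron_theorem.

(** * Nonnegative integration and densities *)

Section nonnegative_functions.
Import HBNNSimple.
Context {R : realType} d (T : measurableType d).
Local Open Scope ereal_scope.

(* No measurability: the integral of a nonnegative function is a supremum over
   the simple functions below it. *)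
Lemma le_integral_nonmeas (mu : {measure set T -> \bar R}) (f g : T -> \bar R) :
  (forall x, 0 <= f x) -> (forall x, f x <= g x) ->
  \int[mu]_x f x <= \int[mu]_x g x.
Proof.
move=> f0 fg; have g0 x : 0 <= g x by exact: le_trans (fg x).
rewrite !ge0_integralTE//; apply: le_ereal_sup => _ [h hf <-].
by exists h => // x; exact: le_trans (fg x).
Qed.

(** The strong Markov property integrates functions of the starting point which are not known to be
    measurable. The upper bound uses the measurable majorant equal to [f a] at [a] and to infinity
    elsewhere. *)
Lemma integral_dirac_nonmeas (a : T) (f : T -> \bar R) :
  measurable [set a] -> (forall x, 0 <= f x) -> \int[\d_a]_x f x = f a.
Proof.
move=> ma f0; have mna : measurable (~` [set a]) by exact: measurableC.
have m1 (c : \bar R) (A : set T) : measurable A ->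
    measurable_fun setT (fun x => c * (\1_A x)%:E).
  by move=> mA; apply: measurable_funeM; exact/measurable_EFinP.
have ia : \1_[set a] a = 1%R :> R by rewrite indicE mem_set.
have ina : \1_(~` [set a]) a = 0%R :> R by rewrite indicE memNset//; apply.
apply/eqP; rewrite eq_le; apply/andP; split.
- pose g x := f a * (\1_[set a] x)%:E + +oo * (\1_(~` [set a]) x)%:E.
  apply: (@le_trans _ _ (\int[\d_a]_x g x)).
    apply: le_integral_nonmeas => // x; rewrite /g.
    have [->|xa] := eqVneq x a; first by rewrite ia ina mule1 mule0 adde0.
    rewrite !indicE memNset; last exact/eqP.
    by rewrite mem_set ?mule0 ?mule1 ?add0e ?leey//; exact/eqP.
  rewrite integral_dirac//; last by apply: emeasurable_funD; exact: m1.
  by rewrite diracT mul1e /g ia ina mule1 mule0 adde0.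
- pose g x := f a * (\1_[set a] x)%:E.
  apply: (@le_trans _ _ (\int[\d_a]_x g x)); last first.
    apply: le_integral_nonmeas => x; rewrite /g indicE.
      by rewrite mule_ge0// lee_fin.
    have [->|xa] := eqVneq x a; first by rewrite mem_set// mule1.
    by rewrite memNset ?mule0//; exact/eqP.
  rewrite integral_dirac//; last exact: m1.
  by rewrite diracT mul1e /g ia mule1.
Qed.

(** Simple functions reduce [f] to indicators. In the decomposition of a nonnegative simple function
    a negative value has an empty preimage, which is why scaling by [c >= 0] is enough. *)
Lemma ge0_fun_ind (P : (T -> \bar R) -> Prop) :
  (forall A, measurable A -> P (fun x => (\1_A x)%:E)) ->
  (forall f g, measurable_fun setT f -> measurable_fun setT g ->
    (forall x, 0 <= f x) -> (forall x, 0 <= g x) -> P f -> P g ->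
    P (fun x => f x + g x)) ->
  (forall (c : R) f, (0 <= c)%R -> measurable_fun setT f ->
    (forall x, 0 <= f x) -> P f -> P (fun x => c%:E * f x)) ->
  (forall (F : nat -> T -> \bar R) f, (forall n, measurable_fun setT (F n)) ->
    (forall n x, 0 <= F n x) ->
    (forall x, {homo F^~ x : n m / (n <= m)%N >-> n <= m}) ->
    (forall x, F n x @[n --> \oo] --> f x) -> (forall n, P (F n)) -> P f) ->
  forall f, measurable_fun setT f -> (forall x, 0 <= f x) -> P f.
Proof.
move=> Pi PD PZ PL f mf f0.
have Pn (h : {nnsfun T >-> R}) : P (fun x => (h x)%:E).
  rewrite (_ : (fun _ => _) = fun x => \sum_(r \in range h)
      (r%:E * (\1_(h @^-1` [set r]) x)%:E)); last first.
    by apply/funext => x; rewrite (fimfunE h) -fsumEFin.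
  have hr (r : R) : P (fun x => r%:E * (\1_(h @^-1` [set r]) x)%:E).
    have [r0|r0] := leP 0%R r; first by apply: PZ => //; [exact/measurable_EFinP|exact: Pi].
    rewrite (_ : h @^-1` _ = set0); last exact: preimage_nnfun0.
    rewrite (_ : (fun _ => _) = fun x => (\1_(set0 : set T) x)%:E); first exact: Pi.
    by apply/funext => x; rewrite indic0 mule0.
  have hr0 (r : R) x : 0 <= r%:E * (\1_(h @^-1` [set r]) x)%:E.
    exact: nnfun_muleindic_ge0.
  have hrm (r : R) : measurable_fun setT (fun x => r%:E * (\1_(h @^-1` [set r]) x)%:E).
    by apply: measurable_funeM; exact/measurable_EFinP.
  rewrite (_ : (fun _ => _) = fun x => \sum_(r <- finmap.enum_fset (fset_set (range h)))
      (r%:E * (\1_(h @^-1` [set r]) x)%:E)); last first.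
    by apply/funext => x; rewrite fsbig_finite.
  elim: (finmap.enum_fset _) => [|r s IH].
    rewrite (_ : (fun _ => _) = fun x => (\1_(set0 : set T) x)%:E); first exact: Pi.
    by apply/funext => x; rewrite big_nil indic0.
  rewrite (_ : (fun _ => _) = fun x => r%:E * (\1_(h @^-1` [set r]) x)%:E +
      \sum_(r <- s) (r%:E * (\1_(h @^-1` [set r]) x)%:E)); last first.
    by apply/funext => x; rewrite big_cons.
  apply: PD => //; first exact: emeasurable_sum.
  by move=> x; apply: sume_ge0.
apply: (PL (fun n x => (nnsfun_approx measurableT mf n x)%:E)) => //.
- by move=> n; exact/measurable_EFinP.
- by move=> n x; rewrite lee_fin; exact: fun_ge0.
- move=> x n m nm; rewrite lee_fin.
  by have /lefP := nd_nnsfun_approx measurableT mf nm; apply.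
- by move=> x; apply: cvg_nnsfun_approx.
Qed.

End nonnegative_functions.

Section density_measure.
Context {R : realType} d (T : measurableType d).
Variables (mu : {measure set T -> \bar R}) (h : T -> R).
Hypotheses (mh : measurable_fun setT h) (h0 : forall x, 0 <= h x).
Local Open Scope ereal_scope.

(** The proofs about [h] are arguments of the set function so that the measure structure declared
    below can be inferred from the term itself. *)
Definition density of measurable_fun setT h & (forall x, (0 <= h x)%R) :=
  fun A : set T => \int[mu]_(x in A) (h x)%:E.

Local Notation nu := (density mh h0).

Let density0 : nu set0 = 0. Proof. by rewrite /density integral_set0. Qed.

Let density_ge0 A : 0 <= nu A.
Proof. by apply: (@integral_ge0 _ _ _ mu) => x _; rewrite lee_fin. Qed.

Let density_sigma_additive : semi_sigma_additive nu.
Proof.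
move=> F mF tF mUF; rewrite /density ge0_integral_bigcup//.
- by apply: is_cvg_ereal_nneg_natsum_cond => n _ _; exact: density_ge0.
- exact/measurable_EFinP/measurable_funTS.
- by move=> x _; rewrite lee_fin.
Qed.

HB.instance Definition _ := isMeasure.Build _ _ _ nu
  density0 density_ge0 density_sigma_additive.

Lemma integral_density (f : T -> \bar R) : measurable_fun setT f ->
  (forall x, 0 <= f x) -> \int[nu]_x f x = \int[mu]_x ((h x)%:E * f x).
Proof.
have mh' : measurable_fun setT (fun x => (h x)%:E) by exact/measurable_EFinP.
have h0' x : 0 <= (h x)%:E by rewrite lee_fin.
move: f; apply: ge0_fun_ind.
- move=> A mA; rewrite integral_indic// setIT /= /density integral_mkcond.
  by apply: eq_integral => x _; rewrite patchE indicE; case: ifPn => _;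
    rewrite ?mule1 ?mule0.
- move=> f g mf mg f0 g0 IHf IHg; rewrite ge0_integralD// IHf IHg.
  rewrite -ge0_integralD//; try by move=> x _; exact: mule_ge0.
  + by apply: eq_integral => x _; rewrite ge0_muleDr.
  + exact: emeasurable_funM.
  + exact: emeasurable_funM.
- move=> c f c0 mf f0 IHf; rewrite ge0_integralZl//.
  rewrite IHf -ge0_integralZl//.
  + by apply: eq_integral => x _; rewrite muleCA.
  + exact: emeasurable_funM.
  + by move=> x _; exact: mule_ge0.
- move=> F f mF F0 nF Ff IHF.
  have c1 : \int[nu]_x F n x @[n --> \oo] --> \int[nu]_x f x.
    rewrite (_ : \int[nu]_x f x = \int[nu]_x limn (F^~ x)); last first.
      by apply: eq_integral => x _; rewrite (cvg_lim _ (Ff x)).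
    by apply: cvg_monotone_convergence.
  have c2 : \int[mu]_x ((h x)%:E * F n x) @[n --> \oo] -->
            \int[mu]_x ((h x)%:E * f x).
    rewrite (_ : \int[mu]_x ((h x)%:E * f x) =
      \int[mu]_x limn (fun n => (h x)%:E * F n x)); last first.
      apply: eq_integral => x _; apply/esym/cvg_lim => //.
      by apply: cvgeZl => //; exact: Ff.
    apply: cvg_monotone_convergence => //.
    + by move=> n; exact: emeasurable_funM.
    + by move=> n x _; exact: mule_ge0.
    + by move=> x _ n k nk; rewrite lee_wpmul2l//; exact: nF.
  rewrite (_ : (fun n => _) = fun n => \int[nu]_x F n x) in c2; last first.
    by apply/funext => n; rewrite IHF.
  by rewrite -(cvg_lim _ c1)// (cvg_lim _ c2).
Qed.

End density_measure.

Section density_existence.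
Context {R : realType} d (T : measurableType d).
Variables (mu : {measure set T -> \bar R}) (h : T -> R).
Hypotheses (mh : measurable_fun setT h) (h0 : forall x, 0 <= h x).
Local Open Scope ereal_scope.

Lemma density_finite_measure : \int[mu]_x (h x)%:E < +oo ->
  exists nu : {finite_measure set T -> \bar R},
    (forall A, nu A = \int[mu]_(x in A) (h x)%:E) /\
    forall f, measurable_fun setT f -> (forall x, 0 <= f x) ->
      \int[nu]_x f x = \int[mu]_x ((h x)%:E * f x).
Proof.
move=> hoo; pose nu0 : {measure set T -> \bar R} := density mu mh h0.
have fin : fin_num_fun nu0.
  move=> A mA; rewrite ge0_fin_numE//; apply: le_lt_trans hoo.
  rewrite -[leRHS]/(nu0 setT); apply: le_measure; rewrite ?inE//.
pose F := Measure_isFinite.Build _ _ _ nu0 fin.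
pose nu : {finite_measure set T -> \bar R} := HB.pack (Measure.sort nu0) F.
exists nu; split => // f mf f0; exact: (integral_density mu mh h0).
Qed.

Lemma density_probability : \int[mu]_x (h x)%:E = 1 ->
  exists nu : probability T R,
    (forall A, nu A = \int[mu]_(x in A) (h x)%:E) /\
    forall f, measurable_fun setT f -> (forall x, 0 <= f x) ->
      \int[nu]_x f x = \int[mu]_x ((h x)%:E * f x).
Proof.
move=> h1; pose nu0 : {measure set T -> \bar R} := density mu mh h0.
pose F := Measure_isProbability.Build _ _ _ nu0 h1.
pose nu : probability T R := HB.pack (Measure.sort nu0) F.
exists nu; split => // f mf f0; exact: (integral_density mu mh h0).
Qed.

End density_existence.

(** * Separable metric spaces and their Borel sets *)

Section metric_spaces.
Context {R : realType} (V : metricType R).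

Lemma metric_ball_open (x : V) e : open (ball x e).
Proof.
rewrite openE => y; rewrite ballEmdist/= => xy.
apply/nbhs_ballP; exists (e - mdist x y) => /=; first by rewrite subr_gt0.
move=> z; rewrite ballEmdist /= => yz.
by rewrite (le_lt_trans (metric_triangle x y z))// -ltrBrDl.
Qed.

Lemma metric_closed1 (x : V) : closed [set x].
Proof.
rewrite -openC openE => y /eqP yx.
apply/nbhs_ballP; exists (mdist y x) => /=; first by rewrite mdist_gt0.
by move=> z; rewrite ballEmdist /= => yz zx; rewrite zx ltxx in yz.
Qed.

Lemma dense_sequence : (exists2 D : set V, countable D & dense D) ->
  (exists x : V, True) -> exists s : nat -> V, forall (x : V) e, 0 < e ->
    exists n, ball x e (s n).
Proof.
move=> [D cD dD] [x0 _].
have /pfcard_geP[D0|[s]] := cD.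
  have [z []] : [set: V] `&` D !=set0 by apply: dD; [exists x0|exact: openT].
  by rewrite D0.
exists s => x e e0.
have [z [xz Dz]] : ball x e `&` D !=set0.
  by apply: dD; [exists x; exact: ballxx|exact: metric_ball_open].
have [n _ sn] := @surj _ _ _ _ s z Dz.
by exists n; rewrite sn.
Qed.

(** Dominated convergence speaks of sequences only; this lets it prove the continuity of the
    eigenfunctions. *)
Lemma seq_continuous_at (f : V -> R) (x : V) :
  (forall u : nat -> V, u n @[n --> \oo] --> x ->
     f (u n) @[n --> \oo] --> f x) -> f y @[y --> x] --> f x.
Proof.
move=> h; apply/cvgrPdist_lt => e e0; apply: contrapT => nh.
have /choice[u hu] : forall n : nat, exists y,
    ball x n.+1%:R^-1 y /\ e <= `|f x - f y|.
  move=> n; apply: contrapT => hn; apply: nh.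
  apply/nbhs_ballP; exists n.+1%:R^-1 => /=; first by rewrite invr_gt0.
  move=> y xy; rewrite ltNge; apply/negP => ey; apply: hn.
  by exists y.
have ux : u n @[n --> \oo] --> x.
  apply/cvg_ballP => d d0; near=> n.
  apply: le_ball (hu n).1; apply: ltW; near: n.
  exact: (cvgr_lt _ (@cvg_harmonic R)).
have /cvgrPdist_lt/(_ e e0) hN := h u ux.
near \oo => n.
have : `|f x - f (u n)| < e by near: n.
by rewrite ltNge (hu n).2.
Unshelve. all: by end_near. Qed.

End metric_spaces.

Section borel_metric.
Context {R : realType} d (E : borelMetricType d R).

Lemma borel_open (U : set E) : open U -> measurable U.
Proof. by move=> oU; rewrite borel_measurableE; exact: sub_sigma_algebra. Qed.

Lemma borel_closed (F : set E) : closed F -> measurable F.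
Proof.
by move=> cF; rewrite -[F]setCK; apply/measurableC/borel_open; rewrite openC.
Qed.

Lemma borel_set1 (x : E) : measurable [set x].
Proof. exact/borel_closed/metric_closed1. Qed.

(** The limit lies in an open [U] exactly when, for some [j], the terms eventually lie in [H U j],
    the points whose ball of radius [1 / (j + 1)] stays in [U]. That set is closed, hence Borel. *)
Lemma measurable_fun_lim dT (T : measurableType dT) (f : nat -> T -> E) (g : T -> E) :
  (forall n, measurable_fun setT (f n)) ->
  (forall x, f n x @[n --> \oo] --> g x) -> measurable_fun setT g.
Proof.
move=> mf fg; pose H (U : set E) (j : nat) := [set x : E | ball x j.+1%:R^-1 `<=` U].
have mH U j : measurable (H U j).
  apply: borel_closed; rewrite -openC (_ : ~` _ = \bigcup_(z in ~` U) ball z j.+1%:R^-1).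
    by apply: bigcup_open => z _; exact: metric_ball_open.
  apply/seteqP; split => x /=.
    by move=> /existsNP[z /not_implyP[xz Uz]]; exists z => //; exact: ball_sym.
  by move=> [z /= Uz zx] xU; apply: Uz; apply: xU; exact: ball_sym.
apply: (measurability _ (@borel_measurableE _ _ E)).
move=> _ [U oU <-]; rewrite setTI.
rewrite (_ : g @^-1` U = \bigcup_j \bigcup_N \bigcap_(n in [set n | (N <= n)%N])
    (f n @^-1` H U j)).
  apply: bigcupT_measurable => j; apply: bigcupT_measurable => N.
  apply: bigcap_measurable; first by exists N => /=.
  by move=> n _; rewrite -[X in measurable X]setTI; exact: mf.
apply/seteqP; split => x /=.
- move=> Ugx; have /nbhs_ballP[e /= e0 he] : nbhs (g x) U by exact: open_nbhs_nbhs.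
  have e20 : 0 < e / 2 by rewrite divr_gt0.
  have [j hj] : exists j : nat, j.+1%:R^-1 < e / 2 :> R.
    near \oo => j; exists j; near: j; exact: (cvgr_lt _ (@cvg_harmonic R)).
  exists j => //; have /cvg_ballP/(_ _ e20)[N _ hN] := fg x.
  exists N => // n /= Nn y fy; apply: he.
  rewrite (splitr e); apply: ball_triangle (hN n Nn) _.
  by apply: le_ball fy; exact: ltW.
- move=> [j _ [N _ hN]].
  have j0 : (0 : R) < j.+1%:R^-1 by rewrite invr_gt0.
  have /cvg_ballP/(_ _ j0)[M _ hM] := fg x.
  have := hN (maxn N M); rewrite /= leq_maxl => /(_ isT); apply.
  by apply: ball_sym; apply: hM; rewrite /= leq_maxr.
Unshelve. all: by end_near. Qed.

(** Open sets of the product topology have to belong to the product sigma-algebra: separability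
    writes them as countable unions of products of balls centred on a dense sequence. *)
Lemma measurable_fun_continuous2 (q : E -> E -> R) :
  (exists2 D : set E, countable D & dense D) ->
  continuous (fun z : E * E => q z.1 z.2) ->
  measurable_fun setT (fun z : E * E => q z.1 z.2).
Proof.
move=> sep /continuousP cq; apply: (measurability _ (RGenOpens.measurableE R)).
move=> A [B [a [b Bab]] AB].
have oA : open A by rewrite -AB setTI; apply: cq; rewrite Bab; exact: interval_open.
move: A {AB} oA => W oW.
have [s hs] := dense_sequence sep (ex_intro _ point I).
pose F (i : nat * nat * nat) : set (E * E) :=
  [set z | ball (s i.1.1) i.2.+1%:R^-1 z.1 /\ ball (s i.1.2) i.2.+1%:R^-1 z.2].
pose G i := if pselect (F i `<=` W) then F i else set0.
have mF i : measurable (F i).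
  rewrite (_ : F i = ball (s i.1.1) i.2.+1%:R^-1 `*` ball (s i.1.2) i.2.+1%:R^-1) //.
  by apply: measurableX; apply: borel_open; exact: metric_ball_open.
rewrite (_ : W = \bigcup_i G i).
  apply: countable_bigcupT_measurable => // i.
  by rewrite /G; case: pselect => ?; [exact: mF|exact: measurable0].
apply/seteqP; split => z.
- move=> Wz; have : nbhs z W by exact: open_nbhs_nbhs.
  move=> /nbhs_ballP[e /= e0 he].
  have e20 : 0 < e / 2 by rewrite divr_gt0.
  have [j hj] : exists j : nat, j.+1%:R^-1 < e / 2 :> R.
    near \oo => j; exists j; near: j; exact: (cvgr_lt _ (@cvg_harmonic R)).
  have j0 : (0 : R) < j.+1%:R^-1 by rewrite invr_gt0.
  have [n1 h1] := hs z.1 _ j0; have [n2 h2] := hs z.2 _ j0.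
  exists (n1, n2, j) => //; rewrite /G; case: pselect => [?|]; last first.
    case => y [/= y1 y2]; apply: he; split.
      rewrite (splitr e); apply: ball_triangle.
        by apply: le_ball h1; exact: ltW.
      by apply: le_ball y1; exact: ltW.
    rewrite (splitr e); apply: ball_triangle.
      by apply: le_ball h2; exact: ltW.
    by apply: le_ball y2; exact: ltW.
  by split; exact: ball_sym.
- by move=> [i _]; rewrite /G; case: pselect => h //; exact: h.
Unshelve. all: by end_near. Qed.

Variable m : {sigma_finite_measure set E -> \bar R}.

(** Every ball has positive measure, so it meets every conull set. This carries almost everywhere
    identities to all points, by continuity. *)
Lemma full_support_ae (P : E -> Prop) (x : E) : full_support m ->
  {ae m, forall y, P y} ->
  exists u : nat -> E, (forall n, P (u n)) /\ u n @[n --> \oo] --> x.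
Proof.
move=> ms [N [mN N0 PN]].
have /choice[u hu] : forall n : nat, exists y, ball x n.+1%:R^-1 y /\ P y.
  move=> n; apply: contrapT => hn.
  have : (0 < m (ball x n.+1%:R^-1))%E.
    apply: ms; first exact: metric_ball_open.
    by exists x; apply: ballxx; rewrite invr_gt0.
  rewrite ltNge => /negP; apply; rewrite -N0.
  apply: le_measure; rewrite ?inE//.
    exact/borel_open/metric_ball_open.
  by move=> y xy; apply: PN => Py; apply: hn; exists y.
exists u; split => [n|]; first by have [] := hu n.
apply/cvg_ballP => d0 d00; near=> n.
apply: le_ball (hu n).1; apply: ltW; near: n.
exact: (cvgr_lt _ (@cvg_harmonic R)).
Unshelve. all: by end_near. Qed.

End borel_metric.

(** * Positive kernels on a sigma-finite space *)

Section positive_kernels.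
Context {R : realType} d (E : measurableType d).
Variable m : {sigma_finite_measure set E -> \bar R}.
Local Open Scope ereal_scope.
Implicit Types (k : E -> E -> R) (f g : E -> \bar R).

(** Extended values let Tonelli apply to nonnegative functions on the possibly infinite [m]; the
    real-valued [kop] takes over after conjugation to a finite measure. *)
Definition act k f x : \bar R := \int[m]_y ((k x y)%:E * f y).

Definition mkernel k := measurable_fun setT (fun z : E * E => k z.1 z.2).

Lemma mkernelC k : mkernel k -> mkernel (fun x y => k y x).
Proof. by move=> mk; exact: (measurableT_comp mk (@measurable_swap _ _ E E)). Qed.

Lemma mkernel1 k x : mkernel k -> measurable_fun setT (k x).
Proof. by move=> mk; exact: (measurableT_comp mk (pair1_measurable x)). Qed.

Lemma mkernel2 k y : mkernel k -> measurable_fun setT (k^~ y).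
Proof. by move=> mk; exact: (measurableT_comp mk (pair2_measurable y)). Qed.

Lemma mact_term k f x : mkernel k -> measurable_fun setT f ->
  measurable_fun setT (fun y => (k x y)%:E * f y).
Proof.
move=> mk mf; apply: emeasurable_funM => //.
by apply/measurable_EFinP; exact: mkernel1.
Qed.

Lemma act_ge0 k f x : (forall x y, (0 <= k x y)%R) -> (forall y, 0 <= f y) ->
  0 <= act k f x.
Proof. by move=> k0 f0; apply: integral_ge0 => y _; rewrite mule_ge0 ?lee_fin. Qed.

Lemma measurable_act k f : mkernel k -> (forall x y, (0 <= k x y)%R) ->
  measurable_fun setT f -> (forall y, 0 <= f y) -> measurable_fun setT (act k f).
Proof.
move=> mk k0 mf f0.
apply: (@measurable_fun_fubini_tonelli_F _ _ _ _ _ m (fun z : E * E => (k z.1 z.2)%:E * f z.2)).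
  apply: emeasurable_funM; first exact/measurable_EFinP.
  exact: (measurableT_comp mf measurable_snd).
by move=> z; rewrite mule_ge0 ?lee_fin.
Qed.

Lemma act_adj k f g : mkernel k -> (forall x y, (0 <= k x y)%R) ->
  measurable_fun setT f -> (forall y, 0 <= f y) ->
  measurable_fun setT g -> (forall y, 0 <= g y) ->
  \int[m]_x (g x * act k f x) = \int[m]_y (act (fun x y => k y x) g y * f y).
Proof.
move=> mk k0 mf f0 mg g0.
transitivity (\int[m]_x \int[m]_y (g x * ((k x y)%:E * f y))).
  apply: eq_integral => x _; rewrite -ge0_integralZl//; first exact: mact_term.
  by move=> y _; rewrite mule_ge0 ?lee_fin.
rewrite (fubini_tonelli (fun z : E * E => g z.1 * ((k z.1 z.2)%:E * f z.2))); first last.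
- by move=> z; rewrite !mule_ge0 ?lee_fin.
- apply: emeasurable_funM; first exact: (measurableT_comp mg measurable_fst).
  apply: emeasurable_funM; first exact/measurable_EFinP.
  exact: (measurableT_comp mf measurable_snd).
apply: eq_integral => y _ /=; rewrite muleC -ge0_integralZl//.
- by apply: eq_integral => x _; rewrite muleA [f y * _]muleC [g x * _]muleC.
- exact: (mact_term y (mkernelC mk)).
- by move=> x _; rewrite mule_ge0 ?lee_fin.
Qed.

Lemma actZ k c f x : mkernel k -> (forall x y, (0 <= k x y)%R) ->
  measurable_fun setT f -> (forall y, 0 <= f y) -> 0 <= c ->
  act k (fun y => c * f y) x = c * act k f x.
Proof.
move=> mk k0 mf f0 c0; rewrite /act -ge0_integralZl//.
- by apply: eq_integral => y _; rewrite muleCA.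
- exact: mact_term.
- by move=> y _; rewrite mule_ge0 ?lee_fin.
Qed.

Lemma act_le k f g x : mkernel k -> (forall x y, (0 <= k x y)%R) ->
  measurable_fun setT f -> (forall y, 0 <= f y) -> measurable_fun setT g ->
  (forall y, f y <= g y) -> act k f x <= act k g x.
Proof.
move=> mk k0 mf f0 mg fg; apply: ge0_le_integral => //.
- by move=> y _; rewrite mule_ge0 ?lee_fin.
- exact: mact_term.
- exact: mact_term.
- by move=> y _; rewrite lee_wpmul2l ?lee_fin.
Qed.

Lemma actD k f g x : mkernel k -> (forall x y, (0 <= k x y)%R) ->
  measurable_fun setT f -> (forall y, 0 <= f y) ->
  measurable_fun setT g -> (forall y, 0 <= g y) ->
  act k (fun y => f y + g y) x = act k f x + act k g x.
Proof.
move=> mk k0 mf f0 mg g0; rewrite /act -ge0_integralD//.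
- by apply: eq_integral => y _; rewrite ge0_muleDr.
- by move=> y _; rewrite mule_ge0 ?lee_fin.
- exact: mact_term.
- by move=> y _; rewrite mule_ge0 ?lee_fin.
- exact: mact_term.
Qed.

Lemma measurable_funV (f : E -> R) : measurable_fun setT f ->
  (forall x, (0 < f x)%R) -> measurable_fun setT (fun x => (f x)^-1%R).
Proof.
move=> mf f0; rewrite (_ : (fun _ => _) = fun x => expR (- ln (f x))); last first.
  by apply/funext => x; rewrite expRN lnK// posrE.
apply: measurableT_comp => //; apply: measurableT_comp => //.
exact: measurableT_comp.
Qed.

Local Open Scope ring_scope.

(* With [mu := a b m], conjugating [k] by [b] gives the kernel [k / (b a)],
   bounded by 1 on a finite measure space. *)
Lemma kernel_perron (k : E -> E -> R) (a b : E -> R) (U : set E) (delta : R) :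
  mkernel k -> (forall x y, 0 < k x y) ->
  measurable_fun setT a -> measurable_fun setT b ->
  (forall x, 0 < a x) -> (forall x, 0 < b x) ->
  (\int[m]_x (a x * b x)%:E < +oo)%E ->
  (forall x y, k x y <= b x * a y) ->
  measurable U -> (0 < m U)%E -> 0 < delta ->
  (forall x y, U x -> U y -> delta * (b x * a y) <= k x y) ->
  exists (rho : R) (pi pihat : E -> R) (c gamma L : R),
  [/\ 0 < rho, 0 < c, 0 < gamma < 1 &
  [/\ measurable_fun setT pi, measurable_fun setT pihat,
      forall x, 0 < pi x <= L * b x & forall x, 0 < pihat x <= L * a x] /\
  [/\ forall x, act k (EFin \o pi) x = (rho * pi x)%:E,
      forall y, act (fun x y => k y x) (EFin \o pihat) y = (rho * pihat y)%:E &
      forall kk : nat -> E -> E -> R, kk 0 = k ->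
        (forall n x y, (kk n.+1 x y)%:E = act k (fun z => (kk n z y)%:E) x) ->
        forall n x y, `|(\int[m]_x (pi x * pihat x)) * kk n x y -
           rho ^+ n.+1 * pi x * pihat y| <= c * gamma ^+ n * rho ^+ n * (b x * a y)]].
Proof.
move=> mk k0 ma mb a0 b0 abfin kab mU U0 delta0 kU.
have k0' x y : 0 <= k x y by exact: ltW.
have a0' x : 0 <= a x by exact: ltW.
have b0' x : 0 <= b x by exact: ltW.
have mab : measurable_fun setT (fun x => a x * b x) by exact: measurable_funM.
have ab0 x : 0 <= a x * b x by rewrite mulr_ge0// ltW.
have [mu [muE muI]] := density_finite_measure mab ab0 abfin.
have mai := measurable_funV ma a0; have mbi := measurable_funV mb b0.
pose k' x y := k x y * ((b x)^-1 * (a y)^-1).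
have k'0 x y : 0 < k' x y by rewrite mulr_gt0// mulr_gt0 ?invr_gt0.
have k'0' x y : 0 <= k' x y by exact: ltW.
have k'1 x y : k' x y <= 1.
  by rewrite /k' -invfM ler_pdivrMr ?mul1r ?mulr_gt0.
have bk' : bounded_kernel k'.
  split; last by exists 1 => z; rewrite ger0_norm ?k'1// ltW.
  apply: measurable_funM => //; apply: measurable_funM.
    exact: (measurableT_comp mbi measurable_fst).
  exact: (measurableT_comp mai measurable_snd).
have kE x y : k x y = b x * a y * k' x y.
  by rewrite /k' mulrCA -invfM mulfV ?mulr1// mulf_neq0// gt_eqF.
clearbody k'.
have actE (f : E -> R) x : bounded_measurable f -> (forall x, 0 <= f x) ->
    act k (fun y => (b y * f y)%:E) x = (b x * kop mu k' f x)%:E.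
  move=> bf f0; have [mf _] := bf.
  rewrite EFinM -bmf_integralE; last exact: bmf_kop_term.
  rewrite muI; first last.
  - by move=> y; rewrite lee_fin mulr_ge0.
  - by apply/measurable_EFinP/measurable_funM => //; have [] := bounded_kernel1 x bk'.
  rewrite -ge0_integralZl//; first last.
  - by rewrite lee_fin ltW.
  - by move=> y _; rewrite -EFinM lee_fin !mulr_ge0.
  - apply: emeasurable_funM; apply/measurable_EFinP => //.
    by apply: measurable_funM => //; have [] := bounded_kernel1 x bk'.
  by apply: eq_integral => y _; rewrite -!EFinM kE; congr EFin; ring.
have actCE (f : E -> R) y : bounded_measurable f -> (forall x, 0 <= f x) ->
    act (fun x y => k y x) (fun x => (a x * f x)%:E) y =
    (a y * kop mu (fun x y => k' y x) f y)%:E.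
  move=> bf f0; have [mf _] := bf; have bk'C := bounded_kernelC bk'.
  rewrite EFinM -bmf_integralE; last exact: (bmf_kop_term y bk'C).
  rewrite muI; first last.
  - by move=> x; rewrite lee_fin mulr_ge0.
  - by apply/measurable_EFinP/measurable_funM => //; have [] := bounded_kernel2 y bk'.
  rewrite -ge0_integralZl//; first last.
  - by rewrite lee_fin ltW.
  - by move=> x _; rewrite -EFinM lee_fin !mulr_ge0.
  - apply: emeasurable_funM; apply/measurable_EFinP => //.
    by apply: measurable_funM => //; have [] := bounded_kernel2 y bk'.
  by apply: eq_integral => x _; rewrite -!EFinM kE; congr EFin; ring.
have muU : (0 < mu U)%E.
  rewrite muE lt0e integral_ge0 ?andbT; last by move=> x _; rewrite lee_fin.
  apply/eqP => h.
  have : (\int[m]_(x in U) `|(a x * b x)%:E|)%E = 0%E.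
    by rewrite -[RHS]h; apply: eq_integral => x _; rewrite gee0_abs// lee_fin.
  move/(ae_eq_integral_abs m mU _).1.
  have mabU : measurable_fun U (fun x => (a x * b x)%:E).
    by apply/measurable_EFinP/measurable_funTS.
  move=> /(_ mabU) [N [mN N0 sub]].
  move: U0; rewrite ltNge => /negP; apply; rewrite -N0.
  apply: le_measure; rewrite ?inE// => x Ux; apply: sub => /= /(_ Ux) [] /eqP.
  by rewrite gt_eqF// mulr_gt0.
have fU : mu U \is a fin_num by exact: fin_num_measure.
(* The lower bound of the kernel on [U] makes this indicator satisfy [c f0 <= K f0] with
   [c = delta * mu U], the input that keeps the growth rate positive. *)
pose f0 : E -> R := \1_U.
have bf0 : bounded_measurable f0.
  split; first exact: measurable_indic.
  by exists 1 => x; rewrite /f0 indicE; case: (_ \in _); rewrite ?normr1 ?normr0.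
have If0 : \int[mu]_x f0 x = fine (mu U).
  by rewrite /Rintegral integral_indic// setIT.
have If0' : 0 < \int[mu]_x f0 x.
  by rewrite If0 fine_gt0// muU/= ltey_eq fU.
have f01 x : 0 <= f0 x <= 1.
  by rewrite /f0 indicE; case: (_ \in _); rewrite ?lexx ?ler01.
have kf0 x : delta * (\int[mu]_x f0 x) * f0 x <= kop mu k' f0 x.
  have kop0 : 0 <= kop mu k' f0 x.
    by apply: kop_ge0 => // y; have /andP[] := f01 y.
  rewrite {2}/f0 indicE; have [xU|xU] := boolP (x \in U); last by rewrite mulr0.
  rewrite mulr1 -bmf_intZ//; apply: bmf_int_le.
  - exact: bmfZ.
  - exact: bmf_kop_term.
  - move=> y; rewrite /f0 indicE; have [yU|yU] := boolP (y \in U); last by rewrite !mulr0.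
    rewrite !mulr1 -(ler_pM2l (mulr_gt0 (b0 x) (a0 y))) -kE mulrC.
    by apply: kU; [rewrite inE in xU|rewrite inE in yU].
have c0 : 0 < delta * \int[mu]_x f0 x by rewrite mulr_gt0.
have [rho [u [v [rho0 bu bv [u0 v0 ku kv]]]]] :=
  perron_exists bk' k'0 k'1 c0 bf0 f01 If0' kf0.
have mu1 : 0 < \int[mu]_x (1 : R).
  by apply: lt_le_trans If0' _; apply: bmf_int_le => // [|x];
    [exact: bmf_cst|have /andP[] := f01 x].
have [c [gamma [c00 g01 hcon]]] := kop_contraction bk' k'0 k'1 rho0 bv v0 kv mu1.
have u0' x : 0 <= u x by exact: ltW.
have v0' x : 0 <= v x by exact: ltW.
have rho0' : 0 <= rho by exact: ltW.
have [mu_ [Lu uL]] := bu; have [mv_ [Lv vL]] := bv.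
pose L := `|Lu| + `|Lv|.
have uL' x : u x <= L.
  rewrite (le_trans (ler_norm _))// (le_trans (uL x))// (le_trans (ler_norm _))//.
  by rewrite lerDl.
have vL' x : v x <= L.
  rewrite (le_trans (ler_norm _))// (le_trans (vL x))// (le_trans (ler_norm _))//.
  by rewrite lerDr.
pose D := \int[mu]_x (u x * v x).
have D0 : 0 < D.
  apply: (int_pos_mul_gt0 bu u0 bv) => [x|]; first exact: ltW.
  have := int_pos_mul_gt0 bv v0 (bmf_cst E 1) (fun=> ler01) mu1.
  by under eq_Rintegral do rewrite mulr1.
pose pi x := b x * u x; pose pihat x := a x * v x.
have CE : \int[m]_x (pi x * pihat x) = D.
  rewrite /D /Rintegral muI.
  - congr fine; apply: eq_integral => x _; rewrite /pi /pihat -EFinM.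
    by congr EFin; ring.
  - by apply/measurable_EFinP/measurable_funM.
  - by move=> x; rewrite lee_fin mulr_ge0.
pose Z := 1 + rho * L * L / D.
have L0 : 0 <= L by rewrite addr_ge0.
have Z0 : 0 < Z by rewrite ltr_wpDr// divr_ge0 ?(ltW D0)// !mulr_ge0.
exists rho, pi, pihat, (c * Z * D), gamma, L; split => //.
  by rewrite !mulr_gt0.
split; first split.
- exact: measurable_funM.
- exact: measurable_funM.
- move=> x; rewrite mulr_gt0//= /pi mulrC; by rewrite ler_wpM2r// ltW.
- move=> x; rewrite mulr_gt0//= /pihat mulrC; by rewrite ler_wpM2r// ltW.
split.
- move=> x; rewrite -[EFin \o pi]/(fun y => (b y * u y)%:E) actE//.
  by rewrite ku /pi mulrCA.
- move=> x; rewrite -[EFin \o pihat]/(fun y => (a y * v y)%:E) actCE//.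
  by rewrite kv /pihat mulrCA.
(* [kk n] is the kernel of the power [n + 1]: its section at [y] is the n-th iterate of the operator
   applied to the section of [k']. Hence the exponents [n + 1] in the main term and [n] in the
   error. *)
move=> kk kk0 kkS n x y.
have bn j : bounded_measurable (iter j (kop mu k') (k'^~ y)).
  by elim: j => [|j IH]; [exact: bounded_kernel2|exact: bmf_kop].
have n0 j z : 0 <= iter j (kop mu k') (k'^~ y) z.
  by elim: j z => [|j IH] z /=; [exact: ltW|apply: kop_ge0 => // *; exact: ltW].
have kkE j z : kk j z y = b z * a y * iter j (kop mu k') (k'^~ y) z.
  elim: j z => [|j IH] z; first by rewrite kk0 kE.
  apply: EFin_inj; rewrite kkS.
  rewrite (_ : (fun z => _) = fun z => (b z * (a y * iter j (kop mu k') (k'^~ y) z))%:E); last first.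
    by apply/funext => z'; rewrite IH mulrA.
  rewrite actE; last 2 first.
  - exact: bmfZ.
  - by move=> z'; rewrite mulr_ge0// ltW.
  by rewrite kopZ// mulrA.
(* This coefficient makes [f] orthogonal to [v], as the section [k' (., y)] integrates against [v]
   to [rho * v y] and [D] is the integral of [u v]. *)
pose w := rho * v y / D.
pose f z := k' z y - w * u z.
have bf : bounded_measurable f by apply: bmfB; [exact: bounded_kernel2|exact: bmfZ].
have vf : \int[mu]_x (v x * f x) = 0.
  transitivity (\int[mu]_x (k' x y * v x) - w * \int[mu]_x (u x * v x)).
    rewrite -bmf_intZ; last exact: bmfM.
    rewrite -bmf_intB; [|exact: (bmfM (bounded_kernel2 y bk'))|by apply: bmfZ; exact: bmfM].
    by apply: eq_Rintegral => z _; rewrite /f; ring.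
  have -> : \int[mu]_x (k' x y * v x) = rho * v y by rewrite -kv.
  by rewrite -/D /w -mulrA mulVf ?gt_eqF// mulr1 subrr.
have fZ z : `|f z| <= Z.
  apply: le_trans (ler_normB _ _) _; rewrite /Z lerD//.
    by rewrite ger0_norm ?k'1// ltW.
  rewrite ger0_norm; last by rewrite /w !mulr_ge0 ?invr_ge0// (ltW D0).
  have -> : w * u z = rho * (v y * u z) / D by rewrite /w; ring.
  rewrite ler_wpM2r ?invr_ge0 ?(ltW D0)// -mulrA ler_wpM2l ?(ltW rho0)//.
  by rewrite ler_pM// ltW.
have itf : iter n (kop mu k') f x =
    iter n (kop mu k') (k'^~ y) x - w * rho ^+ n * u x.
  elim: n x {kkE} => [|n IH] x; first by rewrite expr0 mulr1.
  rewrite iterS (_ : iter n _ f = fun x => iter n (kop mu k') (k'^~ y) x - w * rho ^+ n * u x).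
    rewrite kopB//; last exact: bmfZ.
    by rewrite kopZ// ku exprSr iterS; ring.
  exact/funext.
have := hcon f Z bf vf fZ n x.
rewrite itf CE kkE => h.
have -> : D * (b x * a y * iter n (kop mu k') (k'^~ y) x) - rho ^+ n.+1 * pi x * pihat y
  = (D * (b x * a y)) * (iter n (kop mu k') (k'^~ y) x - w * rho ^+ n * u x).
  by rewrite /w /pi /pihat exprS; field; rewrite gt_eqF.
have ba0 : 0 <= b x * a y by rewrite mulr_ge0// ltW.
rewrite normrM (ger0_norm (mulr_ge0 (ltW D0) ba0)).
apply: (@le_trans _ _ (D * (b x * a y) * (c * gamma ^+ n * rho ^+ n * Z))).
  by rewrite ler_wpM2l// mulr_ge0// ltW.
by rewrite le_eqVlt; apply/orP; left; apply/eqP; ring.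
Qed.

End positive_kernels.

(** * Uniqueness of the positive eigenfunction *)

Section eigenfunction_uniqueness.
Context {R : realType} d (E : measurableType d).
Variable m : {sigma_finite_measure set E -> \bar R}.
Local Open Scope ereal_scope.

Lemma adde_cancel (x y z : \bar R) : x \is a fin_num -> x + y = x + z -> y = z.
Proof.
move=> xf h; have e : y + x = z + x by rewrite addeC h addeC.
by rewrite -[LHS](addeK _ xf) e addeK.
Qed.

Lemma ge0_integral_eq0P (f : E -> \bar R) : measurable_fun setT f ->
  (forall x, 0 <= f x) -> \int[m]_x f x = 0 <-> {ae m, forall x, f x = 0}.
Proof.
move=> mf f0; have e : \int[m]_x f x = \int[m]_x `|f x|.
  by apply: eq_integral => x _; rewrite gee0_abs.
rewrite e; split => [/(ae_eq_integral_abs m measurableT mf)|h].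
  by apply: filterS => x /(_ I).
by apply/(ae_eq_integral_abs m measurableT mf); apply: filterS h => x h _.
Qed.

Lemma ge0_le_integral_eq (f g : E -> \bar R) : measurable_fun setT f ->
  measurable_fun setT g -> (forall x, 0 <= f x) -> (forall x, f x \is a fin_num) ->
  (forall x, f x <= g x) -> \int[m]_x f x < +oo ->
  \int[m]_x g x = \int[m]_x f x -> {ae m, forall x, g x = f x}.
Proof.
move=> mf mg f0 ffin fg foo gf.
pose h x := g x - f x.
have mh : measurable_fun setT h by exact: emeasurable_funB.
have h0 x : 0 <= h x by rewrite /h sube_ge0 ?ffin.
have gE : \int[m]_x g x = \int[m]_x f x + \int[m]_x h x.
  rewrite -ge0_integralD//; apply: eq_integral => x _.
  by rewrite /h addeC subeK.
have f0' : 0 <= \int[m]_x f x by exact: integral_ge0.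
have Ih : \int[m]_x h x = 0.
  have ff : \int[m]_x f x \is a fin_num by rewrite ge0_fin_numE.
  by apply: (adde_cancel ff); rewrite -gE gf adde0.
have /(ge0_integral_eq0P mh h0) := Ih.
by apply: filterS => x hx; rewrite -[LHS](subeK _ (ffin x)) -/(h x) hx add0e.
Qed.

Local Open Scope ring_scope.

(** Pairing with [v] identifies the eigenvalues. With [a] such that [g - a u] pairs to 0 with [v],
    the positive part satisfies [ka Fp <= K Fp], with equality almost everywhere by pairing. If [Fp]
    were not null, [K Fp] would be positive everywhere, so [Fp] would be positive and the negative
    part null almost everywhere, against the equality of their pairings. *)
Lemma eigen_unique (k : E -> E -> R) (u v g : E -> R) (ka ka' : R) :
  mkernel k -> (forall x y, 0 < k x y) ->
  measurable_fun setT u -> (forall x, 0 < u x) ->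
  measurable_fun setT v -> (forall x, 0 < v x) ->
  measurable_fun setT g -> (forall x, 0 <= g x) -> 0 < ka ->
  (forall x, act m k (EFin \o u) x = (ka * u x)%:E) ->
  (forall y, act m (fun x y => k y x) (EFin \o v) y = (ka * v y)%:E) ->
  (forall x, act m k (EFin \o g) x = (ka' * g x)%:E) ->
  (\int[m]_x (v x * u x)%:E < +oo)%E -> (\int[m]_x (v x * g x)%:E < +oo)%E ->
  (0 < \int[m]_x (v x * g x)%:E)%E ->
  ka' = ka /\ exists a, forall x, g x = a * u x.
Proof.
move=> mk k0 mu_ u0 mv v0 mg g0 ka0 ku kv kg uvoo vgoo vg0.
have k0' x y : 0 <= k x y by exact: ltW.
have u0' x : 0 <= u x by exact: ltW.
have v0' x : 0 <= v x by exact: ltW.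
have mE (f : E -> R) : measurable_fun setT f -> measurable_fun setT (EFin \o f).
  by move=> mf; exact/measurable_EFinP.
have E0 (f : E -> R) : (forall x, 0 <= f x) -> forall x, (0 <= (EFin \o f) x)%E.
  by move=> f0 x; rewrite lee_fin.
have pair (f : E -> R) : measurable_fun setT f -> (forall x, 0 <= f x) ->
    (\int[m]_x ((EFin \o v) x * act m k (EFin \o f) x) =
     ka%:E * \int[m]_x (v x * f x)%:E)%E.
  move=> mf f0; rewrite act_adj//; try exact: mE; try exact: E0.
  rewrite -ge0_integralZl//; first last.
  - by rewrite lee_fin ltW.
  - by move=> x _; rewrite lee_fin mulr_ge0.
  - exact/measurable_EFinP/measurable_funM.
  by apply: eq_integral => x _; rewrite kv -!EFinM mulrA.
have vgfin : (\int[m]_x (v x * g x)%:E \is a fin_num)%E.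
  by rewrite ge0_fin_numE// ltW.
have kk' : ka' = ka.
  have := pair g mg g0; under eq_integral do rewrite kg /= -EFinM.
  have ka'0 : 0 <= ka'.
    rewrite leNgt; apply/negP => kn.
    have g00 x : g x = 0.
      have : (0 <= act m k (EFin \o g) x)%E by apply: act_ge0 => //; exact: E0.
      rewrite kg lee_fin => h; apply/eqP; rewrite eq_le g0 andbT.
      by rewrite leNgt; apply/negP => gx; move: h; rewrite leNgt nmulr_rlt0 ?gx.
    move: vg0; rewrite (_ : (\int[m]_x _)%E = 0%E) ?ltxx//.
    by apply: integral0_eq => x _; rewrite g00 mulr0.
  under eq_integral do rewrite mulrCA EFinM.
  rewrite ge0_integralZl//; first last.
  - by move=> x _; rewrite lee_fin mulr_ge0.
  - exact/measurable_EFinP/measurable_funM.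
  rewrite -(fineK vgfin) -!EFinM => -[] /mulIf; apply.
  by rewrite gt_eqF// fine_gt0// vg0 ltey_eq vgfin.
split => //; rewrite {ka'}kk' in kg.
have uvfin : (\int[m]_x (v x * u x)%:E \is a fin_num)%E.
  by rewrite ge0_fin_numE// integral_ge0// => x _; rewrite lee_fin mulr_ge0.
pose Iu := fine (\int[m]_x (v x * u x)%:E)%E.
pose Ig := fine (\int[m]_x (v x * g x)%:E)%E.
have Iu0 : 0 < Iu.
  rewrite fine_gt0// [X in _ && X]ltey_eq uvfin andbT lt0e integral_ge0 ?andbT; last first.
    by move=> x _; rewrite lee_fin mulr_ge0.
  apply/eqP => h; move: vg0; rewrite lt0e => /andP[/eqP + _]; apply.
  have mvu : measurable_fun setT (fun x => (v x * u x)%:E).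
    exact/measurable_EFinP/measurable_funM.
  have mvg : measurable_fun setT (fun x => (v x * g x)%:E).
    exact/measurable_EFinP/measurable_funM.
  apply/ge0_integral_eq0P => //; first by move=> x; rewrite lee_fin mulr_ge0.
  have /ge0_integral_eq0P : (\int[m]_x (v x * u x)%:E)%E = 0%E by [].
  move=> /(_ mvu) h2.
  have {}h2 : {ae m, forall x, (v x * u x)%:E = 0%E}.
    by apply: h2 => x; rewrite lee_fin mulr_ge0.
  by apply: filterS h2 => x [] /eqP; rewrite mulf_eq0 !gt_eqF.
pose a := Ig / Iu.
have a0 : 0 <= a.
  by rewrite divr_ge0 ?(ltW Iu0)// fine_ge0// ltW.
pose Fp x := Num.max (g x - a * u x) 0.
pose Fm x := Num.max (a * u x - g x) 0.
have mau : measurable_fun setT (fun x => a * u x) by exact: measurable_funM.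
have mFp : measurable_fun setT Fp.
  by apply: measurable_funrpos; exact: measurable_funB.
have mFm : measurable_fun setT Fm.
  by apply: measurable_funrpos; exact: measurable_funB.
have Fp0 x : 0 <= Fp x by rewrite le_max lexx orbT.
have Fm0 x : 0 <= Fm x by rewrite le_max lexx orbT.
have FE x : g x + Fm x = a * u x + Fp x.
  by rewrite /Fp /Fm !maxEle; case: ifPn => ?; case: ifPn => ?; lra.
have Fpg x : Fp x <= g x.
  by rewrite ge_max g0 andbT gerBl mulr_ge0.
have au0 x : 0 <= a * u x by rewrite mulr_ge0.
have mvf (f : E -> R) : measurable_fun setT f ->
    measurable_fun setT (fun x => (v x * f x)%:E).
  by move=> mf; exact/measurable_EFinP/measurable_funM.
have vf0 (f : E -> R) : (forall x, 0 <= f x) -> forall x, (0 <= (v x * f x)%:E)%E.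
  by move=> f0 x; rewrite lee_fin mulr_ge0.
have Fpoo : (\int[m]_x (v x * Fp x)%:E < +oo)%E.
  apply: le_lt_trans vgoo; apply: ge0_le_integral => //.
  - by move=> x _; exact: vf0.
  - exact: mvf.
  - exact: mvf.
  - by move=> x _; rewrite lee_fin ler_wpM2l.
have intD (f h : E -> R) : measurable_fun setT f -> measurable_fun setT h ->
    (forall x, 0 <= f x) -> (forall x, 0 <= h x) ->
    (\int[m]_x (v x * (f x + h x))%:E =
     \int[m]_x (v x * f x)%:E + \int[m]_x (v x * h x)%:E)%E.
  move=> mf mh f0 h0; rewrite -ge0_integralD//.
  - by apply: eq_integral => x _; rewrite mulrDr EFinD.
  - by move=> x _; exact: vf0.
  - exact: mvf.
  - by move=> x _; exact: vf0.
  - exact: mvf.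
have vau : (\int[m]_x (v x * (a * u x))%:E = \int[m]_x (v x * g x)%:E)%E.
  under eq_integral do rewrite mulrCA EFinM.
  rewrite ge0_integralZl//; [|exact: mvf|by move=> x _; exact: vf0].
  by rewrite -(fineK uvfin) -(fineK vgfin) -EFinM /a mulfVK// gt_eqF.
have FpFm : (\int[m]_x (v x * Fm x)%:E = \int[m]_x (v x * Fp x)%:E)%E.
  have : (\int[m]_x (v x * (g x + Fm x))%:E = \int[m]_x (v x * (a * u x + Fp x))%:E)%E.
    by apply: eq_integral => x _; rewrite FE.
  by rewrite !intD// vau => /(adde_cancel vgfin).
have kFp x : ((ka * Fp x)%:E <= act m k (EFin \o Fp) x)%E.
  have h1 : (act m k (EFin \o g) x <= act m k (fun y => (a * u y)%:E + (Fp y)%:E) x)%E.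
    apply: act_le => //; try exact: mE; try exact: E0.
      by apply: emeasurable_funD; exact: mE.
    by move=> y /=; rewrite -EFinD lee_fin -FE lerDl; exact: Fm0.
  move: h1; rewrite (@actD _ _ _ m k (fun y => (a * u y)%:E) (fun y => (Fp y)%:E))//; first last.
  - exact: mE.
  - exact: mE.
  rewrite (_ : (fun y => (a * u y)%:E) = fun y => (a%:E * (EFin \o u) y)%E)//.
  rewrite actZ//; try exact: mE; try exact: E0.
  rewrite kg ku -EFinM /Fp maxEle => h; case: ifPn => hx.
    by rewrite mulr0; apply: act_ge0 => //; exact: E0.
  rewrite mulrBr EFinB leeBlDl//; apply: le_trans h _.
  by rewrite mulrCA.
have mG : measurable_fun setT (act m k (EFin \o Fp)).
  by apply: measurable_act => //; exact: mE.
have G0 x : (0 <= act m k (EFin \o Fp) x)%E by apply: act_ge0 => //; exact: E0.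
have aeG : {ae m, forall x, ((v x)%:E * act m k (EFin \o Fp) x)%E = (v x * (ka * Fp x))%:E}.
  have e1 : (\int[m]_x (v x * (ka * Fp x))%:E = ka%:E * \int[m]_x (v x * Fp x)%:E)%E.
    under eq_integral do rewrite mulrCA EFinM.
    by rewrite ge0_integralZl//; [exact: mvf|move=> x _; exact: vf0|rewrite lee_fin ltW].
  have kF0 x : 0 <= ka * Fp x by rewrite mulr_ge0// ltW.
  apply: ge0_le_integral_eq => //.
  - by apply: mvf; exact: measurable_funM.
  - by apply: emeasurable_funM => //; exact: mE.
  - exact: vf0.
  - by move=> x; rewrite EFinM lee_wpmul2l// lee_fin.
  - rewrite e1; apply: lte_mul_pinfty => //; rewrite lee_fin; exact: ltW.
  - by rewrite e1 -pair.
have Fp_zero : (\int[m]_x (v x * Fp x)%:E = 0)%E.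
  apply: contrapT => nz.
  have Gpos x : (0 < act m k (EFin \o Fp) x)%E.
    rewrite lt0e G0 andbT; apply/eqP => Gx0; apply: nz.
    apply/ge0_integral_eq0P; [exact: mvf|exact: vf0|].
    have /(ge0_integral_eq0P (mact_term x mk (mE _ mFp))) := Gx0.
    have h0 : forall y, (0 <= (k x y)%:E * (EFin \o Fp) y)%E.
      by move=> y; rewrite mule_ge0 ?lee_fin.
    move=> /(_ h0); apply: filterS => y [] /eqP.
    by rewrite mulf_eq0 gt_eqF//= => /eqP ->; rewrite mulr0.
  apply: nz; rewrite -FpFm; apply/ge0_integral_eq0P; [exact: mvf|exact: vf0|].
  apply: filterS aeG => x hx.
  have Fpx : 0 < Fp x.
    rewrite lt0r Fp0 andbT; apply/eqP => Fx; move: hx; rewrite Fx !mulr0.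
    move/eqP; rewrite mule_eq0 eqe gt_eqF//= => /eqP h.
    by move: (Gpos x); rewrite h ltxx.
  have -> : Fm x = 0.
    move: Fpx; rewrite /Fp /Fm !maxEle; case: ifPn => [_|]; first by rewrite ltxx.
    by rewrite -ltNge => h1 _; rewrite ifT//; lra.
  by rewrite mulr0.
have aeF (F : E -> R) : measurable_fun setT F -> (forall x, 0 <= F x) ->
    (\int[m]_x (v x * F x)%:E = 0)%E -> {ae m, forall x, F x = 0}.
  move=> mF F0 hF; have := (ge0_integral_eq0P (mvf _ mF) (vf0 _ F0)).1 hF.
  apply: filterS => x [] /eqP; rewrite mulf_eq0 gt_eqF//= => /eqP. exact.
have aeFp := aeF _ mFp Fp0 Fp_zero.
have aeFm : {ae m, forall x, Fm x = 0} by apply: aeF => //; rewrite FpFm.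
(* So far [g = a u] almost everywhere; applying the operator, which ignores null sets, gives it at
   every point. *)
exists a => x.
have : act m k (EFin \o g) x = act m k (fun y => (a%:E * (EFin \o u) y)%E) x.
  apply: ge0_ae_eq_integral => //.
  - by apply: mact_term => //; exact: mE.
  - by apply: mact_term => //; exact: (mE _ mau).
  - by move=> y _; rewrite mule_ge0 ?lee_fin.
  - by move=> y _; rewrite mule_ge0 ?lee_fin// -EFinM lee_fin.
  - apply: filterS2 aeFp aeFm => y hp hm _; congr (_ * _)%E; rewrite -EFinM /=.
    by have := FE y; rewrite hp hm !addr0 => ->.
rewrite actZ//; try exact: mE; try exact: E0.
by rewrite kg ku -EFinM mulrCA => -[] /mulfI; apply; rewrite gt_eqF.
Qed.

End eigenfunction_uniqueness.

(** * Spectral theory of the density semigroup *)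

Section submarkov.
Context {R : realType} d (E : measurableType d).
Variable m : {sigma_finite_measure set E -> \bar R}.
Implicit Types p : R -> E -> E -> R.
Local Open Scope ereal_scope.

Definition flip p := fun t x y => p t y x.

(** The interface between the processes and the spectral theory. It is required of [p] and of
    [flip p], and the dual process enters through the latter. *)
Definition submarkov_semigroup p :=
  [/\ forall t, (0 < t)%R -> mkernel (p t),
      forall t x y, (0 < t)%R -> (0 < p t x y)%R,
      forall t s f x, (0 < t)%R -> (0 < s)%R -> measurable_fun setT f ->
        (forall y, 0 <= f y) -> act m (p (t + s)%R) f x = act m (p t) (act m (p s) f) x &
      forall t x, (0 < t)%R -> act m (p t) (fun=> 1) x <= 1].

(** Both sides are densities of the same finite measure, the value of the semigroup at [x] on
    indicators, so they agree for almost every [y]. *)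
Lemma kernel_comp_ae p t s x : submarkov_semigroup p -> (0 < t)%R -> (0 < s)%R ->
  {ae m, forall y, (p (t + s)%R x y)%:E = act m (p t) (fun z => (p s z y)%:E) x}.
Proof.
move=> [mp p0 sg sub] t0 s0; have ts0 : (0 < t + s)%R by exact: addr_gt0.
have p0' r z y : (0 < r)%R -> (0 <= p r z y)%R by move=> r0; exact/ltW/p0.
have mpx : measurable_fun setT (fun y => (p (t + s)%R x y)%:E).
  by apply/measurable_EFinP; apply: mkernel1; exact: mp.
have mptx : measurable_fun setT (fun y => (p t x y)%:E).
  by apply/measurable_EFinP; apply: mkernel1; exact: mp.
have gE y : act m (p t) (fun z => (p s z y)%:E) x =
    act m (fun y z => p s z y) (fun z => (p t x z)%:E) y.
  by apply: eq_integral => z _; rewrite muleC.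
have mg : measurable_fun setT (fun y => act m (p t) (fun z => (p s z y)%:E) x).
  under eq_fun do rewrite gE; apply: measurable_act => //.
  - exact: (mkernelC (mp s s0)).
  - by move=> y z; apply: p0'.
  - by move=> z; rewrite lee_fin p0'.
have int1 : m.-integrable setT (fun y => (p (t + s)%R x y)%:E).
  apply/integrableP; split => //.
  apply: (@le_lt_trans _ _ 1); last exact: ltry.
  apply: le_trans (sub _ x ts0); rewrite le_eqVlt; apply/orP; left; apply/eqP.
  by apply: eq_integral => y _; rewrite gee0_abs ?mule1// lee_fin p0'.
have := @integral_ae_eq _ _ _ m setT measurableT _ _ int1 mg.
move=> h; have {}h : ae_eq m setT (fun y => (p (t + s)%R x y)%:E)
   (fun y => act m (p t) (fun z => (p s z y)%:E) x).
  apply: h => A _ mA.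
  have mI : measurable_fun setT (fun y => (\1_A y)%:E : \bar R).
    by apply/measurable_EFinP; exact: measurable_indic.
  have I0 y : 0 <= (\1_A y)%:E :> \bar R by rewrite lee_fin indicE.
  have restrictE (h : E -> \bar R) : \int[m]_(y in A) h y = \int[m]_y (h y * (\1_A y)%:E).
    rewrite integral_mkcond; apply: eq_integral => y _.
    by rewrite patchE indicE; case: ifPn => _; rewrite ?mule1 ?mule0.
  rewrite !restrictE; have := sg t s _ x t0 s0 mI I0; rewrite {1}/act => ->.
  transitivity (\int[m]_z ((p t x z)%:E * act m (p s) (fun y => (\1_A y)%:E) z)) => //.
  rewrite (@act_adj _ _ _ m (p s) (fun y => (\1_A y)%:E) (fun z => (p t x z)%:E)).
  - by apply: eq_integral => y _; rewrite gE.
  - exact: mp.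
  - by move=> y z; apply: p0'.
  - exact: mI.
  - exact: I0.
  - exact: mptx.
  - by move=> y; rewrite lee_fin p0'.
by apply: filterS h => y /(_ I).
Qed.

Lemma act_gt0 (k : E -> E -> R) (f : E -> \bar R) x : mkernel k ->
  (forall x y, (0 < k x y)%R) -> measurable_fun setT f -> (forall y, 0 < f y) ->
  0 < m setT -> 0 < act m k f x.
Proof.
move=> mk k0 mf f0 m0.
have h0 y : 0 <= (k x y)%:E * f y by rewrite mule_ge0// ?lee_fin ltW.
rewrite lt0e act_ge0 ?andbT; last 2 first.
- by move=> *; exact: ltW.
- by move=> *; exact: ltW.
apply/eqP => /(ge0_integral_eq0P m (mact_term x mk mf) h0) [N [mN N0 sub]].
move: m0; rewrite ltNge => /negP; apply; rewrite -N0; apply: le_measure; rewrite ?inE//.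
by move=> y _; apply: sub => /= /eqP; rewrite mule_eq0 eqe !gt_eqF.
Qed.

Lemma integral_gt0 (f : E -> \bar R) : measurable_fun setT f ->
  (forall y, 0 < f y) -> 0 < m setT -> 0 < \int[m]_x f x.
Proof.
move=> mf f0 m0.
have h0 y : 0 <= f y by exact: ltW.
rewrite lt0e integral_ge0 ?andbT//.
apply/eqP => /(ge0_integral_eq0P m mf h0) [N [mN N0 sub]].
move: m0; rewrite ltNge => /negP; apply; rewrite -N0; apply: le_measure; rewrite ?inE//.
by move=> y _; apply: sub => /= /eqP; rewrite gt_eqF.
Qed.

Local Open Scope ring_scope.

(* AM-GM: [2 f g <= c f^2 + g^2 / c] with [c := B / A]. *)
Lemma cauchy_schwarz (f g : E -> R) (A B : R) : measurable_fun setT f ->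
  measurable_fun setT g -> (forall x, 0 <= f x) -> (forall x, 0 <= g x) ->
  0 < A -> 0 < B -> (\int[m]_x (f x ^+ 2)%:E <= (A ^+ 2)%:E)%E ->
  (\int[m]_x (g x ^+ 2)%:E <= (B ^+ 2)%:E)%E ->
  (\int[m]_x (f x * g x)%:E <= (A * B)%:E)%E.
Proof.
move=> mf mg f0 g0 A0 B0 fA gB; pose c := B / A.
have c0 : 0 < c by rewrite divr_gt0.
have mf2 : measurable_fun setT (fun x => f x ^+ 2) by exact: measurable_funM.
have mg2 : measurable_fun setT (fun x => g x ^+ 2) by exact: measurable_funM.
have c1 : (0 <= (c / 2)%:E)%E by rewrite lee_fin divr_ge0// ltW.
have c2 : (0 <= (c^-1 / 2)%:E)%E by rewrite lee_fin divr_ge0 ?invr_ge0// ltW.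
have m1 : measurable_fun setT (fun x => ((c / 2)%:E * (f x ^+ 2)%:E)%E).
  by apply: measurable_funeM; exact/measurable_EFinP.
have m2 : measurable_fun setT (fun x => ((c^-1 / 2)%:E * (g x ^+ 2)%:E)%E).
  by apply: measurable_funeM; exact/measurable_EFinP.
apply: (@le_trans _ _ (\int[m]_x ((c / 2)%:E * (f x ^+ 2)%:E + (c^-1 / 2)%:E * (g x ^+ 2)%:E))%E).
  apply: ge0_le_integral => //.
  - by move=> x _; rewrite lee_fin mulr_ge0.
  - by apply/measurable_EFinP; exact: measurable_funM.
  - exact: emeasurable_funD.
  - move=> x _; rewrite -!EFinM -EFinD lee_fin.
    rewrite -subr_ge0 (_ : _ - _ = (c * f x - g x) ^+ 2 * (c^-1 / 2)); last first.
      by field; rewrite gt_eqF.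
    by rewrite mulr_ge0 ?sqr_ge0// divr_ge0 ?invr_ge0// ltW.
rewrite ge0_integralD//; last 2 first.
- by move=> x _; rewrite mule_ge0 ?lee_fin ?sqr_ge0.
- by move=> x _; rewrite mule_ge0 ?lee_fin ?sqr_ge0.
rewrite !ge0_integralZl//; first last.
- by move=> x _; rewrite lee_fin sqr_ge0.
- exact/measurable_EFinP.
- by move=> x _; rewrite lee_fin sqr_ge0.
- exact/measurable_EFinP.
have -> : (A * B)%:E = ((c / 2)%:E * (A ^+ 2)%:E + (c^-1 / 2)%:E * (B ^+ 2)%:E)%E.
  by rewrite -!EFinM -EFinD /c; congr EFin; field; rewrite !gt_eqF.
by apply: leeD; apply: lee_wpmul2l.
Qed.

Lemma l2_pairing_fin (f g : E -> R) : measurable_fun setT f ->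
  measurable_fun setT g -> (forall x, 0 <= f x) -> (forall x, 0 <= g x) ->
  (\int[m]_x (f x ^+ 2)%:E < +oo)%E -> (\int[m]_x (g x ^+ 2)%:E < +oo)%E ->
  (\int[m]_x (f x * g x)%:E < +oo)%E.
Proof.
move=> mf mg f0 g0 foo goo.
have sq (h : E -> R) : (\int[m]_x (h x ^+ 2)%:E < +oo)%E -> exists2 A, 0 < A &
    (\int[m]_x (h x ^+ 2)%:E <= (A ^+ 2)%:E)%E.
  move=> hoo; have h0 : (0 <= \int[m]_x (h x ^+ 2)%:E)%E.
    by apply: integral_ge0 => x _; rewrite lee_fin sqr_ge0.
  have hfin : (\int[m]_x (h x ^+ 2)%:E \is a fin_num)%E by rewrite ge0_fin_numE.
  exists (1 + fine (\int[m]_x (h x ^+ 2)%:E)%E).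
    by rewrite ltr_pwDl// fine_ge0.
  rewrite -[leLHS]fineK// lee_fin; set z := fine _.
  have z0 : 0 <= z by exact: fine_ge0.
  by rewrite sqrrD expr1n; have := sqr_ge0 z; lra.
have [A A0 fA] := sq _ foo; have [B B0 gB] := sq _ goo.
by apply: le_lt_trans (cauchy_schwarz mf mg f0 g0 A0 B0 fA gB) _; rewrite ltry.
Qed.

(** From [g f <= f^2 + g^2] under the kernel, [g P_t f <= P_t f^2 + g^2]; the integral of [P_t f^2]
    is at most that of [f^2] because the transpose is sub-Markovian. *)
Lemma submarkov_pairing_fin p t (f g : E -> R) : submarkov_semigroup p ->
  submarkov_semigroup (flip p) -> 0 < t -> measurable_fun setT f ->
  measurable_fun setT g -> (forall x, 0 <= f x) -> (forall x, 0 <= g x) ->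
  (\int[m]_x (f x ^+ 2)%:E < +oo)%E -> (\int[m]_x (g x ^+ 2)%:E < +oo)%E ->
  (\int[m]_x ((g x)%:E * act m (p t) (EFin \o f) x) < +oo)%E.
Proof.
move=> [mp p0 _ sub] [_ _ _ subC] t0 mf mg f0 g0 foo goo.
have mpt := mp t t0.
have p0' x y : 0 <= p t x y by exact/ltW/p0.
have mf2 : measurable_fun setT (fun x => (f x ^+ 2)%:E).
  by apply/measurable_EFinP; exact: measurable_funM.
have mg2 : measurable_fun setT (fun x => (g x ^+ 2)%:E).
  by apply/measurable_EFinP; exact: measurable_funM.
have f20 x : (0 <= (f x ^+ 2)%:E)%E by rewrite lee_fin sqr_ge0.
have g20 x : (0 <= (g x ^+ 2)%:E)%E by rewrite lee_fin sqr_ge0.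
have mA : measurable_fun setT (act m (p t) (fun y => (f y ^+ 2)%:E)).
  exact: measurable_act.
have A0 x : (0 <= act m (p t) (fun y => (f y ^+ 2)%:E) x)%E by exact: act_ge0.
have mF : measurable_fun setT (EFin \o f) by exact/measurable_EFinP.
have mAf : measurable_fun setT (act m (p t) (EFin \o f)).
  by apply: measurable_act => // y; rewrite lee_fin.
have ptw x : ((g x)%:E * act m (p t) (EFin \o f) x <=
    act m (p t) (fun y => (f y ^+ 2)%:E) x + (g x ^+ 2)%:E)%E.
  apply: (@le_trans _ _ (act m (p t) (fun y => ((f y ^+ 2)%:E + (g x ^+ 2)%:E * 1)%E) x)).
    rewrite -actZ//; last by rewrite lee_fin.
    apply: act_le => //.
    - by apply: measurable_funeM.
    - by move=> y; rewrite -EFinM lee_fin mulr_ge0.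
    - by apply: emeasurable_funD.
    - move=> y; rewrite mule1 -EFinM -EFinD lee_fin.
      have := sqr_ge0 (f y - g x); have := sqr_ge0 (f y); have := sqr_ge0 (g x).
      rewrite sqrrB -mulr_natl; set a := f y ^+ 2; set b := g x ^+ 2.
      by rewrite [f y * _]mulrC; set e := g x * _; lra.
  rewrite (@actD _ _ _ m (p t) (fun y => (f y ^+ 2)%:E) (fun=> ((g x ^+ 2)%:E * 1)%E))//; last first.
    by move=> y; rewrite mule1.
  rewrite (@actZ _ _ _ m (p t) ((g x ^+ 2)%:E) (fun=> 1%E))// leeD2l//; apply: le_trans (lee_wpmul2l _ (sub t x t0)) _ => //.
  by rewrite mule1.
apply: (@le_lt_trans _ _ (\int[m]_x (act m (p t) (fun y => (f y ^+ 2)%:E) x + (g x ^+ 2)%:E))%E).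
  apply: ge0_le_integral => //.
  - by move=> x _; rewrite mule_ge0 ?lee_fin// act_ge0// => y; rewrite lee_fin.
  - by apply: emeasurable_funM => //; exact/measurable_EFinP.
  - exact: emeasurable_funD.
rewrite ge0_integralD//; apply: lte_add_pinfty => //.
apply: le_lt_trans foo.
have -> : (\int[m]_x act m (p t) (fun y => (f y ^+ 2)%:E) x =
    \int[m]_x (1 * act m (p t) (fun y => (f y ^+ 2)%:E) x))%E.
  by apply: eq_integral => x _; rewrite mul1e.
rewrite (@act_adj _ _ _ m (p t) _ (fun=> 1%E))//.
apply: ge0_le_integral => //.
- by move=> x _; rewrite mule_ge0// act_ge0.
- apply: emeasurable_funM => //; apply: measurable_act => //; exact: mkernelC.
- move=> x _; rewrite -[leRHS]mul1e lee_wpmul2r//; exact: (subC t x t0).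
Qed.

End submarkov.

(** * Chapman-Kolmogorov at every pair of points *)

Section chapman_kolmogorov.
Context {R : realType} (dE : measure_display) (E : borelMetricType dE R).
Variable m : {sigma_finite_measure set E -> \bar R}.
Hypothesis m_supp : full_support m.
Implicit Types p : R -> E -> E -> R.

Definition continuous_kernels p :=
  forall t, 0 < t -> continuous (fun z : E * E => p t z.1 z.2).

Lemma continuous_kernels_flip p : continuous_kernels p -> continuous_kernels (flip p).
Proof.
move=> pc t t0 [x y].
have h : (fun z : E * E => (z.2, z.1)) @ (x, y) --> (y, x).
  by apply: cvg_pair; [exact: cvg_snd|exact: cvg_fst].
exact: (cvg_comp _ _ h (pc t t0 (y, x))).
Qed.

Lemma kernel_cvg1 p t x y (u : nat -> E) : continuous_kernels p -> 0 < t ->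
  u n @[n --> \oo] --> x -> p t (u n) y @[n --> \oo] --> p t x y.
Proof.
move=> pc t0 ux.
have h : (fun n => (u n, y)) n @[n --> \oo] --> (x, y).
  by apply: cvg_pair => //; exact: cvg_cst.
exact: (cvg_comp _ _ h (pc t t0 (x, y))).
Qed.

(** The almost everywhere identity of the transpose, at fixed [y], holds along a sequence tending to
    [x]. Cauchy-Schwarz bounds the kernel there, and continuity carries the bound, though not yet
    the identity, to [x]. *)
Lemma kernel_bounded p t K : submarkov_semigroup m p ->
  submarkov_semigroup m (flip p) -> continuous_kernels p -> 0 < t -> 0 < K ->
  (forall x, (\int[m]_y (p t x y ^+ 2)%:E <= (K ^+ 2)%:E)%E) ->
  (forall y, (\int[m]_x (p t x y ^+ 2)%:E <= (K ^+ 2)%:E)%E) ->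
  forall x y, p (t + t) x y <= K * K.
Proof.
move=> hp hpC pc t0 K0 hx hy x y.
have t20 : 0 < t + t by exact: addr_gt0.
have [mp p0 _ _] := hp.
have h := kernel_comp_ae y hpC t0 t0.
have [u [hu ux]] := full_support_ae x m_supp h.
have cv := @kernel_cvg1 p (t + t) x y u pc t20 ux.
rewrite -(cvg_lim _ cv)//; apply: limr_le; first exact: cvgP cv.
near=> n; rewrite -lee_fin; have := hu n; rewrite /flip => ->.
rewrite /act; under eq_integral do rewrite -EFinM.
apply: cauchy_schwarz => //; try exact: mkernel1 (mp t t0).
- exact: mkernel2 (mp t t0).
- by move=> z; exact/ltW/p0.
- by move=> z; exact/ltW/p0.
Unshelve. all: by end_near. Qed.

(** With [p t] bounded, the integrands along the approximating sequence are dominated by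
    [M * p s z y], which is integrable in [z] by sub-Markovianity of the transpose; now the identity
    itself passes to the limit. *)
Lemma chapman_kolmogorov_l p t s M : submarkov_semigroup m p ->
  submarkov_semigroup m (flip p) -> continuous_kernels p -> 0 < t -> 0 < s ->
  (forall x y, p t x y <= M) ->
  forall x y, (p (t + s) x y)%:E = act m (p t) (fun z => (p s z y)%:E) x.
Proof.
move=> hp hpC pc t0 s0 pM x y.
have ts0 : 0 < t + s by exact: addr_gt0.
have [mp p0 _ _] := hp; have [_ _ _ subC] := hpC.
have h := kernel_comp_ae y hpC s0 t0.
have [u [hu ux]] := full_support_ae x m_supp h.
have cv := @kernel_cvg1 p (t + s) x y u pc ts0 ux.
have cvE : (p (t + s) (u n) y)%:E @[n --> \oo] --> (p (t + s) x y)%:E.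
  by apply/fine_cvgP; split; [exact: nearW|exact: cv].
have mps : measurable_fun setT (fun z => (p s z y)%:E).
  by apply/measurable_EFinP; exact: mkernel2 (mp s s0).
have cvR : act m (p t) (fun z => (p s z y)%:E) (u n) @[n --> \oo] -->
           act m (p t) (fun z => (p s z y)%:E) x.
  apply: (@dominated_cvg _ _ _ m setT _ _ _ (fun z => (M * p s z y)%:E)) => //.
  - by move=> n; apply: mact_term => //; exact: mp.
  - move=> z _; rewrite -EFinM; under eq_fun do rewrite -EFinM.
    apply/fine_cvgP; split; first exact: nearW.
    by apply: cvgM; [exact: kernel_cvg1|exact: cvg_cst].
  - apply/integrableP; split.
      by apply/measurable_EFinP/measurable_funM => //; exact: mkernel2 (mp s s0).
    have M0 : 0 <= M by apply: le_trans (pM x x); exact/ltW/p0.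
    have p0' z : 0 <= p s z y by exact/ltW/p0.
    rewrite [X in (X < _)%E](_ : _ = (\int[m]_z (M%:E * (p s z y)%:E))%E); last first.
      by apply: eq_integral => z _; rewrite gee0_abs// lee_fin mulr_ge0.
    rewrite ge0_integralZl//; last by move=> z _; rewrite lee_fin.
    apply: lte_mul_pinfty => //; apply: (@le_lt_trans _ _ 1%E); last exact: ltry.
    apply: le_trans (subC s y s0); rewrite le_eqVlt; apply/orP; left; apply/eqP.
    by apply: eq_integral => z _; rewrite mule1.
  - move=> n z _; rewrite -EFinM /= lee_fin ger0_norm.
      by rewrite ler_wpM2r//; exact/ltW/p0.
    by rewrite mulr_ge0//; apply/ltW/p0.
have e : (fun n => (p (t + s) (u n) y)%:E) =
    (fun n => act m (p t) (fun z => (p s z y)%:E) (u n)).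
  apply/funext => n; have := hu n; rewrite /flip addrC => ->.
  by apply: eq_integral => z _; rewrite muleC.
by rewrite e in cvE; rewrite -(cvg_lim _ cvE)// (cvg_lim _ cvR).
Qed.

Lemma chapman_kolmogorov_r p t s M : submarkov_semigroup m p ->
  submarkov_semigroup m (flip p) -> continuous_kernels p -> 0 < t -> 0 < s ->
  (forall x y, p s x y <= M) ->
  forall x y, (p (t + s) x y)%:E = act m (p t) (fun z => (p s z y)%:E) x.
Proof.
move=> hp hpC pc t0 s0 pM x y.
have := @chapman_kolmogorov_l (flip p) s t M hpC hp (continuous_kernels_flip pc) s0 t0.
move=> /(_ (fun x y => pM y x) y x); rewrite /flip addrC => ->.
by apply: eq_integral => z _; rewrite muleC.
Qed.

End chapman_kolmogorov.

(** * Spectral data of the kernel at one fixed time *)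

Section spectral_data.
Context {R : realType} (dE : measure_display) (E : borelMetricType dE R).
Variable m : {sigma_finite_measure set E -> \bar R}.
Hypothesis m_supp : full_support m.
Variables (p : R -> E -> E -> R) (T : R).
Hypotheses (hp : submarkov_semigroup m p) (hpC : submarkov_semigroup m (flip p))
  (pc : continuous_kernels p)
  (A2 : forall t, 0 < t -> (\int[m]_y \int[m]_x (p t x y ^+ 2)%:E < +oo)%E)
  (T_gt0 : 0 < T)
  (A3 : forall t, T <= t ->
      (ereal_sup [set \int[m]_y (p t x y ^+ 2)%:E | x in [set: E]] < +oo)%E /\
      (ereal_sup [set \int[m]_y (p t y x ^+ 2)%:E | x in [set: E]] < +oo)%E).

Lemma reference_gt0 : (0 < m setT)%E.
Proof. by apply: m_supp; [exact: openT|exists point]. Qed.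

Lemma l2_kernel_bound t : T <= t -> exists2 K, 0 < K &
  (forall x, (\int[m]_y (p t x y ^+ 2)%:E <= (K ^+ 2)%:E)%E) /\
  (forall y, (\int[m]_x (p t x y ^+ 2)%:E <= (K ^+ 2)%:E)%E).
Proof.
move=> Tt; have [h1 h2] := A3 Tt.
have sup_bound (F : E -> \bar R) : (forall x, 0 <= F x)%E ->
    (ereal_sup [set F x | x in [set: E]] < +oo)%E ->
    exists2 K, 0 <= K & forall x, (F x <= K%:E)%E.
  move=> F0 Foo; set s := ereal_sup _ in Foo.
  have Fs x : (F x <= s)%E by apply: ereal_sup_ubound; exists x.
  have s0 : (0 <= s)%E by exact: le_trans (F0 point) (Fs point).
  have sfin : s \is a fin_num by rewrite ge0_fin_numE.
  by exists (fine s); [exact: fine_ge0|move=> x; rewrite fineK].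
have [|K1 K10 hK1] := sup_bound _ _ h1.
  by move=> x; apply: integral_ge0 => y _; rewrite lee_fin sqr_ge0.
have [|K2 K20 hK2] := sup_bound _ _ h2.
  by move=> x; apply: integral_ge0 => y _; rewrite lee_fin sqr_ge0.
have KK : K1 <= (1 + K1 + K2) ^+ 2 /\ K2 <= (1 + K1 + K2) ^+ 2.
  have h : 1 + K1 + K2 <= (1 + K1 + K2) ^+ 2.
    by rewrite expr2; apply: ler_peMr; lra.
  by move: h; set z := _ ^+ 2 => h; split; lra.
exists (1 + K1 + K2); first by lra.
split => x; [apply: le_trans (hK1 x) _|apply: le_trans (hK2 x) _]; rewrite lee_fin; exact: KK.1 || exact: KK.2.
Qed.

Lemma kernel_bounded_2T t : 2 * T <= t -> exists M, forall x y, p t x y <= M.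
Proof.
move=> Tt; have Tt2 : T <= t / 2 by lra.
have [K K0 [h1 h2]] := l2_kernel_bound Tt2.
exists (K * K) => x y.
have -> : t = t / 2 + t / 2 by lra.
by apply: (kernel_bounded m_supp hp hpC pc) => //; exact: lt_le_trans T_gt0 Tt2.
Qed.

Lemma chapman_kolmogorov t s x y : 0 < t -> 0 < s -> 2 * T <= t \/ 2 * T <= s ->
  (p (t + s) x y)%:E = act m (p t) (fun z => (p s z y)%:E) x.
Proof.
move=> t0 s0 [/kernel_bounded_2T[M pM]|/kernel_bounded_2T[M pM]].
  exact: (chapman_kolmogorov_l m_supp hp hpC pc t0 s0 pM).
exact: (chapman_kolmogorov_r m_supp hp hpC pc t0 s0 pM).
Qed.

(** [b x] and [a y] are the L^2 norms of the two sections of [p (2 * T)]. Their product bounds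
    [p (4 * T)] by Cauchy-Schwarz; (A2) makes them square integrable and (A3) bounds them by [N]. *)
Lemma spectral_data : exists (rho : R) (pi pihat a b : E -> R) (c gamma L N : R),
  [/\ 0 < rho, 0 < c, 0 < gamma < 1 &
  [/\ measurable_fun setT pi, measurable_fun setT pihat,
      forall x, 0 < pi x <= L * b x & forall x, 0 < pihat x <= L * a x] /\
  [/\ forall x, act m (p (4 * T)) (EFin \o pi) x = (rho * pi x)%:E,
      forall y, act m (flip p (4 * T)) (EFin \o pihat) y = (rho * pihat y)%:E &
      forall n x y, `|(\int[m]_x (pi x * pihat x)) * p (n.+1%:R * (4 * T)) x y -
           rho ^+ n.+1 * pi x * pihat y| <= c * gamma ^+ n * rho ^+ n * (b x * a y)]] /\
  [/\ measurable_fun setT a /\ measurable_fun setT b,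
      (forall x, 0 < a x <= N) /\ (forall x, 0 < b x <= N),
      (\int[m]_x (a x ^+ 2)%:E < +oo)%E, (\int[m]_x (b x ^+ 2)%:E < +oo)%E &
      forall x y, p (4 * T) x y <= b x * a y].
Proof.
have [mp p0 _ _] := hp.
pose S := 2 * T; have S0 : 0 < S by rewrite mulr_gt0.
have mpS := mp S S0.
have mpS2 : mkernel (fun x y => p S x y ^+ 2) by exact: measurable_funM.
have TS : T <= S by have := T_gt0; rewrite /S; lra.
have [N N0 [hN1 hN2]] := l2_kernel_bound TS.
have sq (F : E -> \bar R) : measurable_fun setT F -> (forall x, 0 < F x)%E ->
    (forall x, F x <= (N ^+ 2)%:E)%E -> exists f : E -> R,
    [/\ measurable_fun setT f, forall x, 0 < f x <= N & forall x, F x = (f x ^+ 2)%:E].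
  move=> mF F0 FN.
  have Ffin x : F x \is a fin_num.
    by rewrite ge0_fin_numE ?(ltW (F0 x))// (le_lt_trans (FN x))// ltry.
  have f0 x : 0 < fine (F x) by rewrite fine_gt0// F0 /= ltey_eq Ffin.
  exists (fun x => Num.sqrt (fine (F x))); split.
  - apply: (measurableT_comp (continuous_measurable_fun (@sqrt_continuous R))).
    exact: measurableT_comp.
  - move=> x; rewrite sqrtr_gt0 f0/= -(ger0_norm (ltW N0)) -sqrtr_sqr.
    by rewrite ler_wsqrtr// -lee_fin fineK.
  - by move=> x; rewrite sqr_sqrtr ?(ltW (f0 x))// fineK.
have actE (q : E -> E -> R) x : act m q (fun=> 1%E) x = (\int[m]_y (q x y)%:E)%E.
  by apply: eq_integral => y _; rewrite mule1.
have sq0 x y : 0 < p S x y ^+ 2 by rewrite exprn_gt0// p0.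
have sq0' x y : 0 <= p S x y ^+ 2 by exact: ltW.
have one0 : (0 < 1 :> \bar R)%E by rewrite lte_fin.
have one0' : (0 <= 1 :> \bar R)%E by rewrite lee_fin.
have [||| b [mb b0N bE]] := sq (fun x => \int[m]_y (p S x y ^+ 2)%:E)%E.
- rewrite (_ : (fun x => _) = act m (fun x y => p S x y ^+ 2) (fun=> 1%E)).
    exact: measurable_act.
  by apply/funext => x; rewrite actE.
- move=> x /=; rewrite -(actE (fun x y => p S x y ^+ 2)).
  by apply: act_gt0 => //; exact: reference_gt0.
- exact: hN1.
have [||| a [ma a0N aE]] := sq (fun y => \int[m]_x (p S x y ^+ 2)%:E)%E.
- rewrite (_ : (fun x => _) = act m (fun y x => p S x y ^+ 2) (fun=> 1%E)).
    by apply: measurable_act => //; exact: (mkernelC mpS2).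
  by apply/funext => x; rewrite actE.
- move=> x /=; rewrite -(actE (fun y x => p S x y ^+ 2)); apply: act_gt0 => //.
    exact: (mkernelC mpS2).
  exact: reference_gt0.
- exact: hN2.
have a0 x : 0 < a x by have /andP[] := a0N x.
have b0 x : 0 < b x by have /andP[] := b0N x.
have a2 : (\int[m]_x (a x ^+ 2)%:E < +oo)%E.
  by under eq_integral do rewrite -aE; exact: A2.
have b2 : (\int[m]_x (b x ^+ 2)%:E < +oo)%E.
  under eq_integral do rewrite -bE.
  rewrite (fubini_tonelli (fun z : E * E => (p S z.1 z.2 ^+ 2)%:E)); first exact: A2.
    exact/measurable_EFinP.
  by move=> z; rewrite lee_fin.
have abfin : (\int[m]_x (a x * b x)%:E < +oo)%E.
  by apply: l2_pairing_fin => // x; exact: ltW.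
have T40 : 0 < 4 * T by rewrite mulr_gt0.
have SS : 4 * T = S + S by rewrite /S; ring.
have kab x y : p (4 * T) x y <= b x * a y.
  rewrite -lee_fin SS chapman_kolmogorov//; last by left.
  rewrite /act; under eq_integral do rewrite -EFinM.
  apply: cauchy_schwarz => //; try exact: mkernel1 mpS.
  - exact: mkernel2 mpS.
  - by move=> z; exact/ltW/p0.
  - by move=> z; exact/ltW/p0.
  - by rewrite bE.
  - by rewrite aE.
(* By continuity the kernel exceeds half its value at [(x0, x0)] on a product of neighbourhoods;
   together with [a, b <= N] this gives [delta]. *)
pose x0 : E := point; pose kap := p (4 * T) x0 x0.
have kap0 : 0 < kap by exact: p0.
pose delta := kap / (2 * (N * N)).
have NN0 : 0 < N * N by rewrite mulr_gt0.
have delta0 : 0 < delta by rewrite divr_gt0// mulr_gt0.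
have : \forall z \near (x0, x0), kap / 2 < p (4 * T) z.1 z.2.
  have h := @pc (4 * T) T40 (x0, x0); apply: (cvgr_gt _ h).
  by rewrite /= -/kap; lra.
move=> [[V1 V2] /= [hV1 hV2] hV].
pose U := (V1 `&` V2)°.
have oU : open U by exact: open_interior.
have Ux0 : U x0 by apply: filterI.
have mU : measurable U by exact: borel_open.
have U0 : (0 < m U)%E by apply: m_supp => //; exists x0.
have kU x y : U x -> U y -> delta * (b x * a y) <= p (4 * T) x y.
  move=> /interior_subset[Vx _] /interior_subset[_ Vy].
  apply: (@le_trans _ _ (kap / 2)); last first.
    by apply: ltW; apply: (hV (x, y)).
  have /andP[_ aN] := a0N y; have /andP[_ bN] := b0N x.
  have -> : kap / 2 = delta * (N * N).
    by rewrite /delta; field; rewrite gt_eqF.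
  by rewrite ler_wpM2l ?(ltW delta0)//; apply: ler_pM => //; exact: ltW.
have [rho [pi [pihat [c [gamma [L [rho0 c0 g01 [[h1 h2 h3 h4] [h5 h6 h7]]]]]]]]] :=
  kernel_perron (mp _ T40) (fun x y => p0 _ x y T40) ma mb a0 b0 abfin kab mU U0 delta0 kU.
exists rho, pi, pihat, a, b, c, gamma, L, N; do ![split => //].
apply: (h7 (fun n => p (n.+1%:R * (4 * T)))); first by rewrite mul1r.
move=> n x y; have nT : 0 < n.+1%:R * (4 * T) by rewrite mulr_gt0.
have -> : n.+2%:R * (4 * T) = 4 * T + n.+1%:R * (4 * T).
  by rewrite -[n.+2]add1n natrD mulrDl mul1r.
by apply: chapman_kolmogorov => //; left; have := T_gt0; lra.
Qed.

End spectral_data.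

(** [l = - ln c] is additive and nonnegative, hence monotone. Squeezing [(n + 1) t] between
    consecutive integers bounds [(n + 1) |l t - l 1 * t|] by [l 1] for every [n]; monotonicity plays
    the part of continuity in time. *)
Lemma multiplicative_exp {R : realType} (c : R -> R) :
  (forall t, 0 < t -> 0 < c t <= 1) ->
  (forall t s, 0 < t -> 0 < s -> c (t + s) = c t * c s) ->
  exists2 lam, 0 <= lam & forall t, 0 < t -> c t = expR (- (lam * t)).
Proof.
move=> c01 cM; pose l t := - ln (c t).
have c0 t : 0 < t -> 0 < c t by move=> /c01/andP[].
have l0 t : 0 < t -> 0 <= l t.
  by move=> t0; have /andP[h1 h2] := c01 t t0; rewrite /l oppr_ge0 ln_le0.
have lD t s : 0 < t -> 0 < s -> l (t + s) = l t + l s.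
  by move=> t0 s0; rewrite /l cM// lnM ?posrE ?c0// opprD.
have ln_mul n t : 0 < t -> l (n.+1%:R * t) = n.+1%:R * l t.
  move=> t0; elim: n => [|n IH]; first by rewrite !mul1r.
  by rewrite -[n.+2]addn1 natrD !mulrDl !mul1r lD// ?IH// mulr_gt0.
have l_mono t s : 0 < t -> t <= s -> l t <= l s.
  move=> t0; rewrite le_eqVlt => /orP[/eqP ->//|ts].
  have -> : s = t + (s - t) by ring.
  by rewrite lD ?subr_gt0// lerDl l0// subr_gt0.
exists (l 1); first exact: l0.
move=> t t0; suff lt : l t = l 1 * t by rewrite -lt /l opprK lnK// posrE c0.
have key n : `|n.+1%:R * (l t - l 1 * t)| <= l 1.
  have nt0 : 0 < n.+1%:R * t by rewrite mulr_gt0.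
  have /andP[h1 h2] := truncn_itv (ltW nt0); set j := Num.truncn _ in h1 h2.
  have up : n.+1%:R * l t <= j.+1%:R * l 1.
    rewrite -ln_mul// -ln_mul// mulr1; apply: l_mono => //; exact: ltW.
  have lo : j%:R * l 1 <= n.+1%:R * l t.
    case: (j) h1 => [_|j' h1]; first by rewrite mul0r mulr_ge0// l0.
    by rewrite -ln_mul// -ln_mul// mulr1; exact: l_mono.
  have l10 : 0 <= l 1 by exact: l0.
  have up' : n.+1%:R * t * l 1 <= j.+1%:R * l 1 by rewrite ler_wpM2r// ltW.
  have lo' : j%:R * l 1 <= n.+1%:R * t * l 1 by rewrite ler_wpM2r.
  rewrite mulrBr [l 1 * t]mulrC mulrA ler_norml.
  move: up lo up' lo'; rewrite -[j.+1]addn1 natrD mulrDl mul1r.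
  set a := n.+1%:R * l t; set b := n.+1%:R * t * l 1; set e := j%:R * l 1.
  by move=> *; apply/andP; split; lra.
apply/eqP; rewrite -subr_eq0 -normr_le0 leNgt; apply/negP => h.
pose n := Num.truncn (l 1 / `|l t - l 1 * t|).
have /andP[_ hn] := truncn_itv (divr_ge0 (l0 _ (@ltr01 R)) (normr_ge0 (l t - l 1 * t))).
have := key n; rewrite normrM ger0_norm// leNgt => /negP; apply.
by rewrite -ltr_pdivrMr.
Qed.

(** * From one time to the whole semigroup *)

Section spectral_theorem.
Context {R : realType} (dE : measure_display) (E : borelMetricType dE R).
Variable m : {sigma_finite_measure set E -> \bar R}.
Hypothesis m_supp : full_support m.

(** Up to the factor [rho], [pi] is its own image, so it inherits continuity from the kernel; [h]
    dominates the integrands uniformly in the first variable. *)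
Lemma eigenfunction_continuous (p : R -> E -> E -> R) t (rho : R) (pi h : E -> R) :
  continuous_kernels p -> 0 < t -> 0 < rho ->
  mkernel (p t) -> (forall x y, 0 <= p t x y) ->
  measurable_fun setT pi -> (forall x, 0 <= pi x) ->
  (forall x, act m (p t) (EFin \o pi) x = (rho * pi x)%:E) ->
  measurable_fun setT h -> (\int[m]_y (h y)%:E < +oo)%E ->
  (forall x y, p t x y * pi y <= h y) -> continuous pi.
Proof.
move=> pc t0 rho0 mp p0 mpi pi0 piE mh hoo ph x.
have h0 y : 0 <= h y by apply: le_trans (ph point y); rewrite mulr_ge0.
apply: seq_continuous_at => u ux.
have mE : measurable_fun setT (EFin \o pi) by exact/measurable_EFinP.
have cv : act m (p t) (EFin \o pi) (u n) @[n --> \oo] --> act m (p t) (EFin \o pi) x.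
  apply: (@dominated_cvg _ _ _ m setT _ _ _ (EFin \o h)) => //.
  - by move=> n; apply: mact_term.
  - move=> z _; rewrite -EFinM; under eq_fun do rewrite -EFinM.
    apply/fine_cvgP; split; first exact: nearW.
    by apply: cvgM; [exact: kernel_cvg1|exact: cvg_cst].
  - apply/integrableP; split; first exact/measurable_EFinP.
    rewrite (_ : (\int[m]_z _)%E = (\int[m]_y (h y)%:E)%E)//.
    by apply: eq_integral => y _; rewrite gee0_abs// lee_fin.
  - by move=> n z _; rewrite -EFinM /= lee_fin ger0_norm ?mulr_ge0.
rewrite piE in cv.
have e : (fun n => act m (p t) (EFin \o pi) (u n)) = (fun n => (rho * pi (u n))%:E).
  by apply/funext => n; rewrite piE.
rewrite e in cv; have [_ {}cv] := (fine_cvgP _ _).1 cv.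
have : rho^-1 * (rho * pi (u n)) @[n --> \oo] --> rho^-1 * (rho * pi x).
  by apply: cvgM; [exact: cvg_cst|exact: cv].
rewrite mulKf ?gt_eqF//.
by under eq_fun do rewrite mulKf ?gt_eqF//.
Qed.

(** The operators at times [t] and [t0] commute, so [P_t pi] is a positive eigenfunction at time
    [t0], and uniqueness makes it a multiple of [pi]. *)
Lemma semigroup_eigen (p : R -> E -> E -> R) t0 (rho N : R) (pi pihat : E -> R) :
  submarkov_semigroup m p -> submarkov_semigroup m (flip p) -> 0 < t0 -> 0 < rho ->
  measurable_fun setT pi -> (forall x, 0 < pi x <= N) ->
  measurable_fun setT pihat -> (forall x, 0 < pihat x) ->
  (\int[m]_x (pi x ^+ 2)%:E < +oo)%E -> (\int[m]_x (pihat x ^+ 2)%:E < +oo)%E ->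
  (forall x, act m (p t0) (EFin \o pi) x = (rho * pi x)%:E) ->
  (forall x, act m (flip p t0) (EFin \o pihat) x = (rho * pihat x)%:E) ->
  exists c : R -> R,
  [/\ forall t, 0 < t -> 0 < c t <= 1,
      forall t s, 0 < t -> 0 < s -> c (t + s) = c t * c s &
      forall t x, 0 < t -> act m (p t) (EFin \o pi) x = (c t * pi x)%:E].
Proof.
move=> hp hpC t00 rho0 mpi piN mpih pih0 pi2 pih2 piE pihE.
have [mp p0 sg sub] := hp.
have pi0 x : 0 < pi x by have /andP[] := piN x.
have pi0' x : 0 <= pi x by exact: ltW.
have pih0' x : 0 <= pihat x by exact: ltW.
have N0 : 0 <= N by have /andP[a b] := piN point; exact: le_trans (ltW a) b.
have p0' t x y : 0 < t -> 0 <= p t x y by move=> ?; exact/ltW/p0.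
have mE : measurable_fun setT (EFin \o pi) by exact/measurable_EFinP.
have E0 x : (0 <= (EFin \o pi) x)%E by rewrite lee_fin.
have mT : (0 < m setT)%E by exact: reference_gt0.
have actN t x M : 0 < t -> (forall x, pi x <= M) -> (act m (p t) (EFin \o pi) x <= M%:E)%E.
  move=> t_gt0 piM; have M0 : 0 <= M by exact: le_trans (piM x).
  have mpt := mp t t_gt0; have pt0 x' y := p0' t x' y t_gt0.
  apply: (@le_trans _ _ (act m (p t) (fun y => (M%:E * 1)%E) x)).
    apply: act_le => //.
    by move=> y; rewrite mule1 lee_fin.
  rewrite (@actZ _ _ _ m (p t) M%:E (fun=> 1%E))//.
  by rewrite -[leRHS]mule1 lee_wpmul2l ?lee_fin//; exact: sub.
have key t : 0 < t -> exists2 c, 0 < c <= 1 &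
    forall x, act m (p t) (EFin \o pi) x = (c * pi x)%:E.
  move=> t_gt0; have mpt := mp t t_gt0; have pt0 x' y := p0' t x' y t_gt0.
  have pt0' x' y := p0 t x' y t_gt0.
  pose g x := fine (act m (p t) (EFin \o pi) x).
  have A0 x : (0 < act m (p t) (EFin \o pi) x)%E.
    by apply: act_gt0 => // y; rewrite lte_fin.
  have Afin x : act m (p t) (EFin \o pi) x \is a fin_num.
    rewrite ge0_fin_numE ?(ltW (A0 x))//; apply: le_lt_trans (actN t x N t_gt0 _) _.
      by move=> y; have /andP[] := piN y.
    exact: ltry.
  have gE x : (g x)%:E = act m (p t) (EFin \o pi) x by rewrite fineK.
  have g0 x : 0 < g x by rewrite -lte_fin gE.
  have mA : measurable_fun setT (act m (p t) (EFin \o pi)).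
    exact: measurable_act.
  have mg : measurable_fun setT g by exact: measurableT_comp.
  have [_ [a ga]] : rho = rho /\ exists a, forall x, g x = a * pi x.
    apply: (eigen_unique (mp _ t00) (fun x y => p0 _ x y t00) mpi pi0 mpih pih0 mg) => //.
    - by move=> x; exact: ltW.
    - move=> x; rewrite (_ : EFin \o g = act m (p t) (EFin \o pi)); last first.
        by apply/funext => y; exact: gE.
      rewrite -sg// addrC sg//.
      rewrite (_ : act m (p t0) (EFin \o pi) = fun y => (rho%:E * (EFin \o pi) y)%E); last first.
        by apply/funext => y; rewrite piE.
      rewrite actZ//; last by rewrite lee_fin ltW.
      by rewrite -gE.
    - exact: l2_pairing_fin.
    - have := submarkov_pairing_fin hp hpC t_gt0 mpi mpih pi0' pih0' pi2 pih2.
      by under eq_integral do rewrite -gE -EFinM.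
    - apply: integral_gt0 => //.
        by apply/measurable_EFinP; exact: measurable_funM.
      by move=> x; rewrite lte_fin mulr_gt0.
  have a0 : 0 < a by have := g0 point; rewrite ga pmulr_lgt0.
  exists a; last by move=> x; rewrite -gE ga.
  (* A sub-Markovian kernel does not raise the supremum [s] of [pi], so [a * pi <= s] everywhere and
     [a <= 1]. *)
  rewrite a0/=; pose s := sup (range pi).
  have ubr : has_ubound (range pi) by exists N => _ [x _ <-]; have /andP[] := piN x.
  have pis x : pi x <= s by apply: ub_le_sup => //; exists x.
  have s0 : 0 < s by exact: lt_le_trans (pi0 point) (pis point).
  have : s <= s / a.
    apply: ge_sup; first by exists (pi point), point.
    move=> _ [x _ <-]; rewrite ler_pdivlMr// mulrC -ga -lee_fin gE.
    exact: actN.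
  by rewrite ler_pdivlMr// -[leRHS]mulr1 ler_pM2l.
pose c t := fine (act m (p t) (EFin \o pi) point) / pi point.
have cE t x : 0 < t -> act m (p t) (EFin \o pi) x = (c t * pi x)%:E.
  by move=> /key[a _ aE]; rewrite /c !aE /= mulfK// gt_eqF.
exists c; split => //.
  by move=> t /key[a a01 aE]; rewrite /c !aE /= mulfK// gt_eqF.
move=> t s t_gt0 s_gt0.
have := sg t s (EFin \o pi) point t_gt0 s_gt0 mE E0.
rewrite (_ : act m (p s) (EFin \o pi) = fun y => ((c s)%:E * (EFin \o pi) y)%E); last first.
  by apply/funext => y; rewrite cE.
have mpt := mp t t_gt0; have pt0 x' y := p0' t x' y t_gt0.
rewrite actZ//.
  rewrite !cE ?addr_gt0// -EFinM => -[]; rewrite mulrCA mulrA => /mulIf; apply.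
  by rewrite gt_eqF.
rewrite lee_fin; have [a /andP[a0 _] aE] := key s s_gt0.
by rewrite /c !aE /= mulfK ?gt_eqF// ltW.
Qed.

End spectral_theorem.

Section square_integrable.
Context {R : realType} d (E : measurableType d).
Variable m : {measure set E -> \bar R}.
Implicit Type f : E -> R.
Local Open Scope ereal_scope.

Lemma int_sqr_Lnorm f : 'N[m]_2%:E[EFin \o f] `^ 2 = \int[m]_x (f x ^+ 2)%:E.
Proof.
rewrite powR_Lnorm//; apply: eq_integral => x _ /=.
by rewrite powR_mulrn// real_normK// num_real.
Qed.

Lemma Lfun2P f : f \in Lfun m 2%:E <->
  measurable_fun setT f /\ \int[m]_x (f x ^+ 2)%:E < +oo.
Proof.
split => [|[mf foo]].
  rewrite inE => /andP[/[!inE]/= mf lpf]; split => //.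
  by rewrite -int_sqr_Lnorm; exact: poweR_lty.
rewrite inE; apply/andP; split; rewrite inE//=.
by apply: (@lty_poweRy _ _ 2) => //; rewrite int_sqr_Lnorm.
Qed.

End square_integrable.

Lemma ler_distP {R : realDomainType} (x y e : R) :
  `|x - y| <= e <-> x <= y + e /\ y <= x + e.
Proof. by rewrite ler_distl lerBlDr; split => [/andP[]|[-> ->]]. Qed.

Section kernel_spectral.
Context {R : realType} (dE : measure_display) (E : borelMetricType dE R).
Variable m : {sigma_finite_measure set E -> \bar R}.
Hypothesis m_supp : full_support m.
Variables (p : R -> E -> E -> R) (T : R).
Hypotheses (hp : submarkov_semigroup m p) (hpC : submarkov_semigroup m (flip p))
  (pc : continuous_kernels p)
  (A2 : forall t, 0 < t -> (\int[m]_y \int[m]_x (p t x y ^+ 2)%:E < +oo)%E)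
  (T_gt0 : 0 < T)
  (A3 : forall t, T <= t ->
      (ereal_sup [set \int[m]_y (p t x y ^+ 2)%:E | x in [set: E]] < +oo)%E /\
      (ereal_sup [set \int[m]_y (p t y x ^+ 2)%:E | x in [set: E]] < +oo)%E).

Lemma unique_eigenfunction_of (q : E -> E -> R) (u v : E -> R) (ka : R) :
  mkernel q -> (forall x y, 0 < q x y) -> 0 < ka ->
  admissible_eigenfunction m u -> admissible_eigenfunction m v ->
  (forall x, act m q (EFin \o u) x = (ka * u x)%:E) ->
  (forall x, act m (fun x y => q y x) (EFin \o v) x = (ka * v x)%:E) ->
  unique_eigenfunction m q u.
Proof.
move=> mq q0 ka0 [u0 _ _ /Lfun2P[mu_ u2]] [v0 _ _ /Lfun2P[mv v2]] uE vE g ka'.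
move=> [g0 _ _ /Lfun2P[mg g2]] gE.
have u0' x : 0 <= u x by exact: ltW.
have v0' x : 0 <= v x by exact: ltW.
have g0' x : 0 <= g x by exact: ltW.
have vu : (\int[m]_x (v x * u x)%:E < +oo)%E by exact: l2_pairing_fin.
have vg : (\int[m]_x (v x * g x)%:E < +oo)%E by exact: l2_pairing_fin.
have vg0 : (0 < \int[m]_x (v x * g x)%:E)%E.
  apply: integral_gt0; last exact: (reference_gt0 m_supp).
    by apply/measurable_EFinP; exact: measurable_funM.
  by move=> x; rewrite lte_fin mulr_gt0.
exact: (eigen_unique mq q0 mu_ u0 mv v0 mg g0' ka0 uE vE gE vu vg vg0).2.
Qed.

Lemma kernel_spectral : exists (lam : R) (pi pihat : E -> R) (c alpha T' : R),
  let C : R := \int[m]_x (pi x * pihat x) in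
  [/\ 0 <= lam, admissible_eigenfunction m pi,
      admissible_eigenfunction m pihat,
      (forall t x, 0 < t -> act m (p t) (EFin \o pi) x = (expR (- (lam * t)) * pi x)%:E) &
      (forall t x, 0 < t -> act m (flip p t) (EFin \o pihat) x = (expR (- (lam * t)) * pihat x)%:E)] /\
  [/\ 0 < C, (\int[m]_x (pi x * pihat x)%:E = C%:E)%E,
      (forall t, 0 < t -> unique_eigenfunction m (p t) pi) &
      (forall t, 0 < t -> unique_eigenfunction m (fun x y => p t y x) pihat)] /\
  [/\ 0 < c, 0 < alpha, 0 < T' &
      forall t x y, T' <= t ->
        `|C * expR (lam * t) * p t x y - pi x * pihat y|
          <= c * expR (- (alpha * t))].
Proof.
have [rho [pi [pihat [a [b [c [gamma [L [N [[rho0 c0 g01 [[mpi mpih piL pihL] [piE pihE hn]]]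
  [[ma mb] [a0N b0N] a2 b2 kab]]]]]]]]]]] := spectral_data m_supp hp hpC pc A2 T_gt0 A3.
have [mp p0 sg sub] := hp.
pose t0 := 4 * T; have t00 : 0 < t0 by rewrite mulr_gt0.
have p0' t x y : 0 < t -> 0 <= p t x y by move=> ?; exact/ltW/p0.
have pi0 x : 0 < pi x by have /andP[] := piL x.
have pih0 x : 0 < pihat x by have /andP[] := pihL x.
have pi0' x : 0 <= pi x by exact: ltW.
have pih0' x : 0 <= pihat x by exact: ltW.
have a0 x : 0 < a x by have /andP[] := a0N x.
have b0 x : 0 < b x by have /andP[] := b0N x.
have aN x : a x <= N by have /andP[] := a0N x.
have bN x : b x <= N by have /andP[] := b0N x.
have N0 : 0 < N by exact: lt_le_trans (a0 point) (aN point).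
have L0 : 0 < L.
  by have /andP[h1 h2] := piL point; have := lt_le_trans h1 h2; rewrite pmulr_lgt0.
have piLN x : pi x <= L * N.
  by have /andP[_ h] := piL x; apply: le_trans h _; rewrite ler_wpM2l// ltW.
have pihLN x : pihat x <= L * N.
  by have /andP[_ h] := pihL x; apply: le_trans h _; rewrite ler_wpM2l// ltW.
have l2le (f h : E -> R) : measurable_fun setT f -> measurable_fun setT h ->
    (forall x, 0 < f x <= L * h x) -> (forall x, 0 < h x) ->
    (\int[m]_x (h x ^+ 2)%:E < +oo)%E -> (\int[m]_x (f x ^+ 2)%:E < +oo)%E.
  move=> mf mh fh h0 hoo.
  have mh2 : measurable_fun setT (fun x => (h x ^+ 2)%:E).
    by apply/measurable_EFinP; exact: measurable_funM.
  apply: (@le_lt_trans _ _ (\int[m]_x ((L ^+ 2)%:E * (h x ^+ 2)%:E))%E).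
    apply: ge0_le_integral => //.
    - by move=> x _; rewrite lee_fin sqr_ge0.
    - by apply/measurable_EFinP; exact: measurable_funM.
    - exact: measurable_funeM.
    - move=> x _; rewrite -EFinM lee_fin -exprMn.
      have /andP[f0 fL] := fh x.
      by rewrite lerXn2r ?nnegrE// ?(ltW f0)// mulr_ge0// ltW.
  rewrite ge0_integralZl//; last 2 first.
  - by move=> x _; rewrite lee_fin sqr_ge0.
  - by rewrite lee_fin sqr_ge0.
  by apply: lte_mul_pinfty => //; rewrite lee_fin sqr_ge0.
have pi2 := l2le pi b mpi mb piL b0 b2.
have pih2 := l2le pihat a mpih ma pihL a0 a2.
have piN x : 0 < pi x <= L * N by rewrite pi0 piLN.
have pihN x : 0 < pihat x <= L * N by rewrite pih0 pihLN.
have pipoo : (\int[m]_x (pi x * pihat x)%:E < +oo)%E by exact: l2_pairing_fin.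
have mpp : measurable_fun setT (fun x => (pi x * pihat x)%:E).
  by apply/measurable_EFinP; exact: measurable_funM.
have pip0 : (0 < \int[m]_x (pi x * pihat x)%:E)%E.
  apply: integral_gt0 => //; last exact: (reference_gt0 m_supp).
  by move=> x; rewrite lte_fin mulr_gt0.
have ppfin : (\int[m]_x (pi x * pihat x)%:E \is a fin_num)%E.
  by rewrite ge0_fin_numE// ltW.
set C : R := \int[m]_x (pi x * pihat x) in hn *.
have CE : (\int[m]_x (pi x * pihat x)%:E = C%:E)%E by rewrite fineK.
have C0 : 0 < C by rewrite -lte_fin -CE.
have [cc [cc01 ccM ccE]] := semigroup_eigen m_supp hp hpC t00 rho0 mpi piN mpih pih0 pi2 pih2 piE pihE.
have [dd [dd01 ddM ddE]] := semigroup_eigen m_supp hpC hp t00 rho0 mpih pihN mpi pi0 pih2 pi2 pihE piE.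
have [lam lam0 lamE] := multiplicative_exp cc01 ccM.
have mE (f : E -> R) : measurable_fun setT f -> measurable_fun setT (EFin \o f).
  by move=> mf; exact/measurable_EFinP.
have E0 (f : E -> R) : (forall x, 0 <= f x) -> forall x, (0 <= (EFin \o f) x)%E.
  by move=> f0 x; rewrite lee_fin.
(* Both factors are read off the pairing of [P_t pi] with [pihat], where the operator can be moved
   to either side. *)
have ddcc t : 0 < t -> dd t = cc t.
  move=> t_gt0; have mpt := mp t t_gt0; have pt0 x' y := p0' t x' y t_gt0.
  have := @act_adj _ _ _ m (p t) (EFin \o pi) (EFin \o pihat) mpt pt0 (mE _ mpi) (E0 _ pi0') (mE _ mpih) (E0 _ pih0').
  under eq_integral do rewrite ccE// -EFinM mulrCA [pihat _ * _]mulrC EFinM.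
  under [RHS]eq_integral do rewrite ddE// -EFinM -mulrA [pihat _ * _]mulrC EFinM.
  have pp0 x : (0 <= (pi x * pihat x)%:E)%E by rewrite lee_fin mulr_ge0.
  have /andP[/ltW cct _] := cc01 t t_gt0; have /andP[/ltW ddt _] := dd01 t t_gt0.
  rewrite !ge0_integralZl// ?lee_fin// CE -!EFinM => -[] /mulIf h.
  by rewrite h// gt_eqF.
have piE' t x : 0 < t -> act m (p t) (EFin \o pi) x = (expR (- (lam * t)) * pi x)%:E.
  by move=> t_gt0; rewrite ccE// lamE.
have pihE' t x : 0 < t -> act m (flip p t) (EFin \o pihat) x = (expR (- (lam * t)) * pihat x)%:E.
  by move=> t_gt0; rewrite ddE// ddcc// lamE.
have rhoE : rho = expR (- (lam * t0)).
  have := piE' t0 point t00; rewrite piE => -[] /mulIf; apply.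
  by rewrite gt_eqF.
have mab : measurable_fun setT (fun x => L * N * (a x * b x)).
  by apply: measurable_funM => //; exact: measurable_funM.
have abfin : (\int[m]_x (L * N * (a x * b x))%:E < +oo)%E.
  have ab0 x : (0 <= (a x * b x)%:E)%E by rewrite lee_fin mulr_ge0// ltW.
  under eq_integral do rewrite EFinM.
  rewrite ge0_integralZl//; last 2 first.
  - by apply/measurable_EFinP; exact: measurable_funM.
  - by rewrite lee_fin mulr_ge0// ltW.
  apply: lte_mul_pinfty => //; first by rewrite lee_fin mulr_ge0// ltW.
  by apply: l2_pairing_fin => // x; exact: ltW.
have pi_cont : continuous pi.
  apply: (@eigenfunction_continuous _ _ _ m p t0 rho pi (fun x => L * N * (a x * b x))) => //.
  - exact: mp.
  - by move=> x y; exact: p0'.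
  - move=> x y; have /andP[_ h] := piL y.
    apply: (@le_trans _ _ ((N * a y) * (L * b y))).
      apply: ler_pM => //; first exact: p0'.
      by apply: le_trans (kab x y) _; rewrite ler_wpM2r// ltW.
    by rewrite le_eqVlt; apply/orP; left; apply/eqP; ring.
have pih_cont : continuous pihat.
  apply: (@eigenfunction_continuous _ _ _ m (flip p) t0 rho pihat (fun x => L * N * (a x * b x))) => //.
  - exact: continuous_kernels_flip.
  - by have [mpC _ _ _] := hpC; exact: mpC.
  - by move=> x y; exact: p0'.
  - move=> y x; have /andP[_ h] := pihL x.
    apply: (@le_trans _ _ ((b x * N) * (L * a x))).
      apply: ler_pM => //; first exact: p0'.
      by apply: le_trans (kab x y) _; rewrite ler_wpM2l// ltW.
    by rewrite le_eqVlt; apply/orP; left; apply/eqP; ring.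
have pi_adm : admissible_eigenfunction m pi.
  split => //; last exact/Lfun2P.
  by exists (L * N) => x; rewrite ger0_norm.
have pih_adm : admissible_eigenfunction m pihat.
  split => //; last exact/Lfun2P.
  by exists (L * N) => x; rewrite ger0_norm.
have /andP[g0 g1] := g01.
pose al := - ln gamma; have al0 : 0 < al by rewrite oppr_gt0 ln_lt0// g0.
(* The error decays in [n], and below [t < (n + 3) * t0]; the two factors with a 3 pay for writing
   it in terms of [t]. *)
pose cst := c * N * N * expR (lam * (3 * t0)) * expR (3 * al).
exists lam, pi, pihat, cst, (al / t0), (2 * t0).
rewrite -/C; split; first by split.
split.
  split => // t t_gt0.
  - apply: (unique_eigenfunction_of (mp t t_gt0) (fun x y => p0 t x y t_gt0)
      (expR_gt0 (- (lam * t))) pi_adm pih_adm) => x; [exact: piE'|exact: pihE'].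
  - apply: (unique_eigenfunction_of (mkernelC (mp t t_gt0)) (fun x y => p0 t y x t_gt0)
      (expR_gt0 (- (lam * t))) pih_adm pi_adm) => x; [exact: pihE'|exact: piE'].
split; [by rewrite !mulr_gt0 ?expR_gt0|by rewrite divr_gt0|by rewrite mulr_gt0|].
move=> t x y tT'.
have t_gt0 : 0 < t by rewrite (lt_le_trans _ tT')// mulr_gt0.
have /andP[h1 h2] := truncn_itv (divr_ge0 (ltW t_gt0) (ltW t00)).
set j := Num.truncn _ in h1 h2.
have j2 : (2 <= j)%N.
  rewrite -ltnS -(ltr_nat R); apply: le_lt_trans h2.
  by rewrite ler_pdivlMr.
(* The remainder [s = t - (n + 1) * t0] then lies in [[t0, 2 * t0)]: positive, and beyond [2 * T],
   where the pointwise Chapman-Kolmogorov identity is available. *)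
pose n := (j - 2)%N.
have jE : j%:R = n%:R + 2 :> R by rewrite -natrD subnK.
pose s := t - n.+1%:R * t0.
have nE : n.+1%:R = n%:R + 1 :> R by rewrite -natr1.
have h1' : j%:R * t0 <= t by rewrite -ler_pdivlMr.
have h2' : t < (j%:R + 1) * t0 by rewrite -ltr_pdivrMr// natr1.
have s_t0 : t0 <= s by rewrite /s nE; move: h1'; rewrite jE !mulrDl mul1r; lra.
have s0 : 0 < s by exact: lt_le_trans t00 s_t0.
have nt0 : 0 < n.+1%:R * t0 by rewrite mulr_gt0.
have tE : t = n.+1%:R * t0 + s by rewrite /s addrC subrK.
have ts2 : 2 * T <= s by move: s_t0 T_gt0; rewrite /t0; lra.
have CK : (p t x y)%:E = act m (flip p s) (fun z => (p (n.+1%:R * t0) x z)%:E) y.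
  rewrite tE (chapman_kolmogorov m_supp hp hpC pc T_gt0 A3)//; last by right.
  by apply: eq_integral => z _; rewrite muleC.
have [mpC p0C _ subC] := hpC; have mps := mpC s s0.
have ps0 x' y' : 0 <= flip p s x' y' by exact: p0'.
pose eps := c * gamma ^+ n * rho ^+ n.
have eps0 : 0 <= eps by rewrite !mulr_ge0// ?exprn_ge0// ltW.
pose F z := C * p (n.+1%:R * t0) x z.
pose G z := rho ^+ n.+1 * pi x * pihat z.
pose H z := eps * b x * a z.
have mF : measurable_fun setT F.
  by apply: measurable_funM => //; exact: (mkernel1 x (mp _ nt0)).
have mG : measurable_fun setT G by exact: measurable_funM.
have mH : measurable_fun setT H by exact: measurable_funM.
have F0 z : 0 <= F z by rewrite mulr_ge0 ?(ltW C0)//; exact: p0'.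
have G0 z : 0 <= G z by rewrite !mulr_ge0// exprn_ge0// ltW.
have N0' : 0 <= N by exact: ltW.
have a0' z : 0 <= a z by exact: ltW.
have b0' z : 0 <= b z by exact: ltW.
have H0 z : 0 <= H z by apply: mulr_ge0 => //; apply: mulr_ge0.
have FGH z : F z <= G z + H z /\ G z <= F z + H z.
  have := hn n x z; rewrite -/t0 -/(F z) -/(G z) -/eps mulrA -/(H z).
  by move=> /ler_distP.
have aF : act m (flip p s) (EFin \o F) y = (C * p t x y)%:E.
  rewrite (_ : EFin \o F = fun z => (C%:E * (p (n.+1%:R * t0) x z)%:E)%E)//.
  rewrite actZ//; first by rewrite -CK.
  - exact: mE (mkernel1 x (mp _ nt0)).
  - by move=> z; rewrite lee_fin p0'.
  - by rewrite lee_fin ltW.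
have aG : act m (flip p s) (EFin \o G) y = (expR (- (lam * t)) * (pi x * pihat y))%:E.
  rewrite (_ : EFin \o G = fun z => ((rho ^+ n.+1 * pi x)%:E * (EFin \o pihat) z)%E)//.
  rewrite actZ//; try exact: mE; try exact: E0; first last.
    by rewrite lee_fin mulr_ge0// exprn_ge0// ltW.
  rewrite pihE'// -EFinM; congr EFin.
  have -> : expR (- (lam * t)) = rho ^+ n.+1 * expR (- (lam * s)).
    by rewrite rhoE -expRM_natl -expRD; congr expR; rewrite [in LHS]tE; ring.
  by ring.
have aH : (act m (flip p s) (EFin \o H) y <= (eps * N * N)%:E)%E.
  apply: (@le_trans _ _ (act m (flip p s) (fun z => ((eps * N * N)%:E * 1)%E) y)).
    apply: act_le => //; try exact: mE; try exact: E0.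
    move=> z; rewrite mule1 lee_fin /H; apply: ler_pM => //; first exact: mulr_ge0.
    by rewrite ler_wpM2l.
  have eN : (0 <= (eps * N * N)%:E)%E.
    by rewrite lee_fin; apply: mulr_ge0 => //; apply: mulr_ge0.
  rewrite (@actZ _ _ _ m (flip p s) (eps * N * N)%:E (fun=> 1%E))//.
  by rewrite -[leRHS]mule1 lee_wpmul2l//; exact: subC.
have actFGH (F1 F2 : E -> R) : measurable_fun setT F1 -> measurable_fun setT F2 ->
   (forall z, 0 <= F1 z) -> (forall z, 0 <= F2 z) ->
   (forall z, F1 z <= F2 z + H z) ->
   (act m (flip p s) (EFin \o F1) y <= act m (flip p s) (EFin \o F2) y + (eps * N * N)%:E)%E.
  move=> mF1 mF2 F10 F20 F12.
  apply: (@le_trans _ _ (act m (flip p s) (fun z => ((EFin \o F2) z + (EFin \o H) z)%E) y)).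
    apply: act_le => //; try exact: mE; try exact: E0.
    by apply: emeasurable_funD; exact: mE.
  rewrite actD//; try exact: mE; try exact: E0.
  exact: leeD2l.
have b1 := actFGH F G mF mG F0 G0 (fun z => (FGH z).1).
have b2' := actFGH G F mG mF G0 F0 (fun z => (FGH z).2).
rewrite aF aG -EFinD lee_fin in b1; rewrite aF aG -EFinD lee_fin in b2'.
have main : `|C * p t x y - expR (- (lam * t)) * (pi x * pihat y)| <= eps * N * N.
  by apply/ler_distP; split; [exact: b1|exact: b2'].
have -> : C * expR (lam * t) * p t x y - pi x * pihat y =
   expR (lam * t) * (C * p t x y - expR (- (lam * t)) * (pi x * pihat y)).
  rewrite mulrBr [X in _ = _ - X]mulrA -expRD subrr expR0 mul1r; ring.
rewrite normrM ger0_norm ?expR_ge0//.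
apply: (@le_trans _ _ (expR (lam * t) * (eps * N * N))).
  by rewrite ler_wpM2l ?expR_ge0.
have e1 : gamma ^+ n <= expR (3 * al) * expR (- (al / t0 * t)).
  have -> : gamma = expR (- al) by rewrite /al opprK lnK.
  rewrite -expRM_natl -expRD ler_expR.
  have h3 : t / t0 <= n%:R + 3.
    rewrite ler_pdivrMr// (_ : n%:R + 3 = j%:R + 1); first exact: ltW.
    by rewrite jE; ring.
  have -> : al / t0 * t = al * (t / t0) by rewrite mulrAC mulrA.
  have : al * (t / t0) <= al * (n%:R + 3) by rewrite ler_wpM2l// ltW.
  by rewrite mulrDr; move: (al * (t / t0)) => q; rewrite mulrN [n%:R * al]mulrC; lra.
have e2 : rho ^+ n * expR (lam * t) <= expR (lam * (3 * t0)).
  rewrite rhoE -expRM_natl -expRD ler_expR.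
  have h3 : t <= (n%:R + 3) * t0.
    rewrite (_ : n%:R + 3 = j%:R + 1); first exact: ltW.
    by rewrite jE; ring.
  have : lam * t <= lam * ((n%:R + 3) * t0) by rewrite ler_wpM2l.
  have -> : lam * ((n%:R + 3) * t0) = n%:R * (lam * t0) + lam * (3 * t0) by ring.
  by rewrite mulrN; lra.
rewrite /eps /cst.
have -> : expR (lam * t) * (c * gamma ^+ n * rho ^+ n * N * N) =
  c * N * N * (rho ^+ n * expR (lam * t)) * gamma ^+ n by ring.
have -> : c * N * N * expR (lam * (3 * t0)) * expR (3 * al) * expR (- (al / t0 * t)) =
  c * N * N * expR (lam * (3 * t0)) * (expR (3 * al) * expR (- (al / t0 * t))) by ring.
have cNN : 0 <= c * N * N by rewrite !mulr_ge0// ltW.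
apply: ler_pM => //.
- by rewrite !mulr_ge0 ?expR_ge0// ?exprn_ge0// ltW.
- by rewrite exprn_ge0// ltW.
- by rewrite ler_wpM2l.
Qed.

End kernel_spectral.

(** * The Markov property for path functionals *)

Section joint_measurability.
Context {R : realType} (dE d : measure_display) (E : borelMetricType dE R) (Omega : measurableType d).

(** Times are rounded to the grid point [g n u] of mesh [1 / (n + 1)] strictly to the right of [u];
    strictness matters because the right-hand filter excludes [u]. Each rounded process is
    measurable as a countable union of rectangles. *)
Lemma right_continuous_jointly_measurable (Y : R -> Omega -> E) :
  (forall u, measurable_fun setT (Y u)) ->
  (forall w u, Y s w @[s --> u^'+] --> Y u w) ->
  measurable_fun setT (fun z : measurableTypeR R * Omega => Y z.1 z.2).
Proof.
move=> mY rcY.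
pose g (n : nat) (u : R) : R := ((Num.floor (u * n.+1%:R))%:~R + 1) / n.+1%:R.
have g_gt n u : u < g n u.
  by rewrite ltr_pdivlMr//; have := floorD1_gt (u * n.+1%:R); rewrite intrD.
have g_le n u : g n u <= u + n.+1%:R^-1.
  rewrite ler_pdivrMr// mulrDl mulVf ?gt_eqF// lerD2r; exact: floor_le.
apply: (@measurable_fun_lim _ _ _ _ _ (fun n (z : measurableTypeR R * Omega) => Y (g n z.1) z.2)).
- move=> n _ B mB; rewrite setTI.
  rewrite (_ : _ @^-1` B = \bigcup_(j : int)
     ([set u : measurableTypeR R | j%:~R <= u * n.+1%:R < (j + 1)%:~R] `*`
      (Y ((j%:~R + 1) / n.+1%:R) @^-1` B))).
    apply: countable_bigcupT_measurable => // j; apply: measurableX; last first.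
      by rewrite -[X in measurable X]setTI; exact: mY.
    rewrite (_ : [set _ | _] = `[j%:~R / n.+1%:R, (j + 1)%:~R / n.+1%:R[%classic)//.
    apply/seteqP; split => u /=; rewrite in_itv/=.
      by rewrite ler_pdivrMr// ltr_pdivlMr.
    by rewrite ler_pdivrMr// ltr_pdivlMr.
  apply/seteqP; split => [[u w]|[u w] [j _]] /=.
    move=> h; exists (Num.floor (u * n.+1%:R)) => //; split => //=.
    by rewrite floor_le floorD1_gt.
  by move=> [/= h hB]; rewrite /g (floor_def h).
- move=> [u w] /=; apply: (cvg_comp (g^~ u) (Y^~ w)); last exact: rcY.
  move=> P [e /= e0 he].
  have [N _ hN] : \forall n \near \oo, n.+1%:R^-1 < e :> R.
    exact: (cvgr_lt _ (@cvg_harmonic R)).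
  exists N => // n /= Nn; apply: he => /=; last exact: g_gt.
  rewrite ltr0_norm ?subr_lt0 ?g_gt// opprB ltrBlDl.
  by apply: le_lt_trans (g_le n u) _; rewrite ltrD2l; exact: hN.
Qed.

End joint_measurability.

Section nonnegative_integration.
Context {R : realType} d (T : measurableType d).
Variable mu : {measure set T -> \bar R}.
Local Open Scope ereal_scope.

Lemma ge0_cvg_integral (F : nat -> T -> \bar R) (f : T -> \bar R) :
  (forall n, measurable_fun setT (F n)) -> (forall n x, 0 <= F n x) ->
  (forall x, {homo F^~ x : n k / (n <= k)%N >-> n <= k}) ->
  (forall x, F n x @[n --> \oo] --> f x) ->
  \int[mu]_x F n x @[n --> \oo] --> \int[mu]_x f x.
Proof.
move=> mF F0 nF Ff.
rewrite (_ : \int[mu]_x f x = \int[mu]_x limn (F^~ x)); last first.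
  by apply: eq_integral => x _; rewrite (cvg_lim _ (Ff x)).
by apply: cvg_monotone_convergence.
Qed.

Lemma integral_indicE (A : set T) (f : T -> \bar R) :
  \int[mu]_(x in A) f x = \int[mu]_x ((\1_A x)%:E * f x).
Proof.
rewrite integral_mkcond; apply: eq_integral => x _.
by rewrite patchE indicE; case: ifPn => _; rewrite ?mul1e ?mul0e.
Qed.

End nonnegative_integration.

Section simple_markov.
Context (R : realType) (d dS : measure_display).
Context (Omega : measurableType d) (S : measurableType dS).
Variables (Y : R -> Omega -> S) (P : S -> probability Omega R).
Local Open Scope ereal_scope.

Hypothesis YP : strong_markov_process Y P.
Hypothesis S1 : forall x : S, measurable [set x].

Lemma markov_coordinate t : (0 <= t)%R -> measurable_fun setT (Y t).
Proof. by move=> t0; have [h _ _ _ _] := YP; exact: h. Qed.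

Lemma natural_filtration_measurable t A : natural_filtration Y t A -> measurable A.
Proof.
move: A; apply: smallest_sub; first exact: sigma_algebra_measurable.
move=> _ [s [B [/andP[s0 _] mB ->]]].
by rewrite -[X in measurable X]setTI; exact: markov_coordinate.
Qed.

Lemma natural_filtration_coordinate t s B : (0 <= s <= t)%R -> measurable B ->
  natural_filtration Y t (Y s @^-1` B).
Proof. by move=> st mB; apply: sub_sigma_algebra; exists s, B. Qed.

Lemma natural_filtration_mono s t A : (s <= t)%R ->
  natural_filtration Y s A -> natural_filtration Y t A.
Proof.
move=> st; move: A; apply: sub_smallest2r; first exact: smallest_sigma_algebra.
move=> _ [u [B [/andP[u0 us] mB ->]]]; exists u, B; split => //.
by rewrite u0 (le_trans us).
Qed.

Lemma natural_filtrationI t A B : natural_filtration Y t A ->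
  natural_filtration Y t B -> natural_filtration Y t (A `&` B).
Proof.
move=> hA hB.
have := @measurableI _ (g_sigma_algebraType [set A | exists s B,
        [/\ (0 <= s <= t)%R, measurable B & A = Y s @^-1` B]]) A B.
exact.
Qed.

Lemma natural_filtrationT t : natural_filtration Y t setT.
Proof.
exact: (@measurableT _ (g_sigma_algebraType [set A | exists s B,
        [/\ (0 <= s <= t)%R, measurable B & A = Y s @^-1` B]])).
Qed.

Lemma augmented_sub G A : G A -> augmented Y P G A.
Proof.
move=> GA mu; exists A => //; exists set0; split.
- exact: sigma_algebra0.
- by apply: integral0_eq => x _; rewrite measure0.
- by rewrite setDv setU0.
Qed.

Lemma natural_filtration_sub t A : natural_filtration Y t A ->
  natural_sigma_algebra Y A.
Proof.
move: A; apply: sub_smallest2r; first exact: smallest_sigma_algebra.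
by move=> _ [u [B [/andP[u0 us] mB ->]]]; exists u, B.
Qed.

Lemma stopping_time_cst t : (0 <= t)%R -> stopping_time Y P (fun=> t%:E).
Proof.
move=> t0; split => [w|u u0]; first by rewrite lee_fin.
apply: augmented_sub; have [tu|tu] := boolP (t%:E <= u%:E).
  by rewrite (_ : [set _ | _] = setT); [exact: natural_filtrationT|exact/seteqP].
rewrite (_ : [set _ | _] = set0); first exact: sigma_algebra0.
by rewrite predeqE => w; split => //= h; move: tu; rewrite h.
Qed.

Lemma stopped_cst t A : natural_filtration Y t A ->
  stopped_sigma_algebra Y P (fun=> t%:E) A.
Proof.
move=> hA; split; first exact: (augmented_sub (natural_filtration_sub hA)).
move=> u u0; apply: augmented_sub; have [tu|tu] := boolP (t%:E <= u%:E).
  rewrite (_ : [set _ | _] = setT); last exact/seteqP.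
  by rewrite setIT; apply: natural_filtration_mono hA; rewrite -lee_fin.
rewrite (_ : [set _ | _] = set0); first by rewrite setI0; exact: sigma_algebra0.
by rewrite predeqE => w; split => //= h; move: tu; rewrite h.
Qed.

(** The strong Markov property at a constant time and with initial law [dirac x];
    [integral_dirac_nonmeas] evaluates the outer integrals. *)
Lemma simple_markov x t s A B : (0 <= t)%R -> (0 <= s)%R ->
  natural_filtration Y t A -> measurable B ->
  P x (A `&` Y (t + s) @^-1` B) =
  \int[P x]_w ((\1_A w)%:E * P (Y t w) (Y s @^-1` B)).
Proof.
move=> t0 s0 hA mB; have [_ _ _ _ M] := YP.
have mA := natural_filtration_measurable hA.
have mYB : measurable (Y (t + s) @^-1` B).
  by rewrite -[X in measurable X]setTI; apply: markov_coordinate => //; exact: addr_ge0.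
have := M (dirac x) (fun=> t%:E) s A B (stopping_time_cst t0) s0 (stopped_cst hA) mB.
have -> : finite_event (fun _ : Omega => t%:E) = setT.
  by rewrite predeqE => w; split => // _; exact: ltry.
rewrite setIT /expectation_from !integral_dirac_nonmeas//.
- move=> h; rewrite -[RHS]h integral_indic//; last exact: measurableI.
  by rewrite setIT.
- by move=> y; apply: integral_ge0 => w _; rewrite mule_ge0// lee_fin indicE.
- by move=> y; apply: integral_ge0 => w _; rewrite lee_fin indicE.
Qed.

Lemma measurable_transition s f : (0 <= s)%R -> measurable_fun setT f ->
  (forall y, 0 <= f y) -> measurable_fun setT (fun x => \int[P x]_w f (Y s w)).
Proof.
move=> s0; have mY := markov_coordinate s0; move: f; apply: ge0_fun_ind.
- move=> B mB; have [_ m2 _ _ _] := YP.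
  rewrite (_ : (fun x => _) = fun x => P x (Y s @^-1` B)); first exact: m2.
  apply/funext => x; rewrite -[in RHS](setIT (Y s @^-1` B)) -integral_indic//.
  by rewrite -[X in measurable X]setTI; exact: mY.
- move=> f g mf mg f0 g0 IHf IHg.
  rewrite (_ : (fun x => _) = fun x =>
    \int[P x]_w f (Y s w) + \int[P x]_w g (Y s w)); first exact: emeasurable_funD.
  by apply/funext => x; rewrite ge0_integralD//; exact: measurableT_comp.
- move=> c f c0 mf f0 IHf.
  rewrite (_ : (fun x => _) = fun x => c%:E * \int[P x]_w f (Y s w)).
    exact: measurable_funeM.
  by apply/funext => x; rewrite ge0_integralZl//; exact: measurableT_comp.
- move=> F f mF F0 nF Ff IHF.
  apply: (@emeasurable_fun_cvg _ _ _ _ (fun n x => \int[P x]_w F n (Y s w))) => //.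
  move=> x _; apply: ge0_cvg_integral => //.
  by move=> n; exact: measurableT_comp.
Qed.

Lemma simple_markov_fun x t s A f : (0 <= t)%R -> (0 <= s)%R ->
  natural_filtration Y t A -> measurable_fun setT f -> (forall y, 0 <= f y) ->
  \int[P x]_w ((\1_A w)%:E * f (Y (t + s) w)) =
  \int[P x]_w ((\1_A w)%:E * \int[P (Y t w)]_w' f (Y s w')).
Proof.
move=> t0 s0 hA; move: f; have mY := markov_coordinate s0.
have mYt := markov_coordinate t0.
have mYts := markov_coordinate (addr_ge0 t0 s0).
have mA := natural_filtration_measurable hA.
have mI : measurable_fun setT (fun w => (\1_A w)%:E : \bar R).
  by apply/measurable_EFinP; exact: measurable_indic.
have I0 w : 0 <= (\1_A w)%:E :> \bar R by rewrite lee_fin indicE.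
have mR f : measurable_fun setT f -> (forall y, 0 <= f y) ->
    measurable_fun setT (fun w => (\1_A w)%:E * \int[P (Y t w)]_w' f (Y s w')).
  move=> mf f0; apply: emeasurable_funM => //.
  exact: (measurableT_comp (measurable_transition s0 mf f0)).
have R0 f w : (forall y, 0 <= f y) -> 0 <= (\1_A w)%:E * \int[P (Y t w)]_w' f (Y s w').
  by move=> f0; rewrite mule_ge0// integral_ge0.
have mL f : measurable_fun setT f ->
    measurable_fun setT (fun w => (\1_A w)%:E * f (Y (t + s) w)).
  by move=> mf; apply: emeasurable_funM => //; exact: measurableT_comp.
apply: ge0_fun_ind.
- move=> B mB; have := simple_markov x t0 s0 hA mB.
  have mYB : measurable (Y (t + s) @^-1` B).
    by rewrite -[X in measurable X]setTI; exact: mYts.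
  rewrite -[in LHS](setIT (A `&` _)) -integral_indic//; last exact: measurableI.
  move=> h; transitivity (\int[P x]_w (\1_(A `&` Y (t + s)%R @^-1` B) w)%:E).
    by apply: eq_integral => w _; rewrite indicI -EFinM.
  rewrite h; apply: eq_integral => w _; congr (_ * _).
  rewrite -[in LHS](setIT (Y s @^-1` B)) -integral_indic//.
  by rewrite -[X in measurable X]setTI; exact: mY.
- move=> f g mf mg f0 g0 IHf IHg.
  transitivity (\int[P x]_w ((\1_A w)%:E * f (Y (t + s) w)) +
                \int[P x]_w ((\1_A w)%:E * g (Y (t + s) w))).
    rewrite -ge0_integralD//; try exact: mL; try by move=> w _; rewrite mule_ge0.
    by apply: eq_integral => w _; rewrite ge0_muleDr.
  rewrite IHf IHg -ge0_integralD//; try exact: mR; try by move=> w _; exact: R0.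
  apply: eq_integral => w _; rewrite -ge0_muleDr ?integral_ge0//.
  by rewrite ge0_integralD//; exact: measurableT_comp.
- move=> c f c0 mf f0 IHf.
  transitivity (c%:E * \int[P x]_w ((\1_A w)%:E * f (Y (t + s) w))).
    rewrite -ge0_integralZl//; try exact: mL; try by move=> w _; rewrite mule_ge0.
    by apply: eq_integral => w _; rewrite muleCA.
  rewrite IHf -ge0_integralZl//; try exact: mR; try by move=> w _; exact: R0.
  apply: eq_integral => w _; rewrite muleCA; congr (_ * _).
  by rewrite ge0_integralZl//; exact: measurableT_comp.
- move=> F f mF F0 nF Ff IHF.
  have c1 : \int[P x]_w ((\1_A w)%:E * F n (Y (t + s) w)) @[n --> \oo] -->
            \int[P x]_w ((\1_A w)%:E * f (Y (t + s) w)).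
    apply: ge0_cvg_integral => //.
    + by move=> n; exact: mL.
    + by move=> n w; rewrite mule_ge0.
    + by move=> w n k nk; rewrite lee_wpmul2l//; exact: nF.
    + by move=> w; apply: cvgeZl => //; exact: Ff.
  have c2 : \int[P x]_w ((\1_A w)%:E * \int[P (Y t w)]_w' F n (Y s w')) @[n --> \oo] -->
            \int[P x]_w ((\1_A w)%:E * \int[P (Y t w)]_w' f (Y s w')).
    apply: ge0_cvg_integral => //.
    + by move=> n; exact: mR.
    + by move=> n w; exact: R0.
    + move=> w n k nk; rewrite lee_wpmul2l//; apply: ge0_le_integral => //.
      * exact: measurableT_comp.
      * exact: measurableT_comp.
      * by move=> w' _; exact: nF.
    + move=> w; apply: cvgeZl => //; apply: ge0_cvg_integral => //.
      by move=> n; exact: measurableT_comp.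
  rewrite (_ : (fun n => _) = fun n => \int[P x]_w ((\1_A w)%:E * F n (Y (t + s) w))) in c2; last first.
    by apply/funext => n; rewrite IHF.
  by rewrite -(cvg_lim _ c1)// (cvg_lim _ c2).
Qed.

Lemma transition0 x f : measurable_fun setT f -> (forall y, 0 <= f y) ->
  \int[P x]_w f (Y 0 w) = f x.
Proof.
move=> mf f0; have [_ _ h0 _ _] := YP.
transitivity (\int[P x]_w (cst (f x) w)).
  apply: ge0_ae_eq_integral => //.
  - by apply: measurableT_comp => //; exact: markov_coordinate.
  - by move=> w _; exact: f0.
  - by apply: filterS (h0 x) => w + _; move=> ->.
by rewrite integral_cst// -[RHS]mule1; congr (_ * _); exact: probability_setT.
Qed.

End simple_markov.

(** * Measurable space of right-continuous paths *)

Section path_space.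
Context {R : realType} (dE : measure_display) (E : borelMetricType dE R).

(* Values at negative times are irrelevant and left unconstrained. *)
Record rc_path := RcPath {
  rc_path_fun :> R -> E;
  rc_path_right_continuous : forall u, 0 <= u ->
    rc_path_fun s @[s --> u^'+] --> rc_path_fun u }.

Lemma rc_path_cst_subproof (u : R) : 0 <= u ->
  (fun=> point : E) s @[s --> u^'+] --> (point : E).
Proof. by move=> _; exact: cvg_cst. Qed.

HB.instance Definition _ := gen_eqMixin rc_path.
HB.instance Definition _ := gen_choiceMixin rc_path.
HB.instance Definition _ := isPointed.Build rc_path (RcPath rc_path_cst_subproof).

(** One family of sets indexed by time: order and repetitions in [s] are immaterial, so lists of
    times can be concatenated and sorted freely. *)
Definition cylinder (s : seq R) (B : R -> set E) : set rc_path :=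
  [set w | forall t, t \in s -> B t (w t)].

Definition cylinders : set (set rc_path) :=
  [set C | exists s B, [/\ all (fun t => 0 <= t) s,
     (forall t, measurable (B t)) & C = cylinder s B]].

Definition mpath := g_sigma_algebraType cylinders.

Lemma cylindersI : setI_closed cylinders.
Proof.
move=> _ _ [s1 [B1 [p1 m1 ->]]] [s2 [B2 [p2 m2 ->]]].
exists (s1 ++ s2), (fun t => (if t \in s1 then B1 t else setT) `&`
  (if t \in s2 then B2 t else setT)); split.
- by rewrite all_cat p1 p2.
- by move=> t; apply: measurableI; case: ifP.
- apply/seteqP; split => w /=.
    move=> [h1 h2] t; rewrite mem_cat => _; split.
      by case: ifP => // /h1.
    by case: ifP => // /h2.
  by move=> h; split => t ts; move: (h t); rewrite mem_cat ts ?orbT => /(_ isT) [].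
Qed.

Lemma measurable_eval (t : R) : 0 <= t ->
  measurable_fun setT (fun w : mpath => (w : rc_path) t).
Proof.
move=> t0 _ B mB; rewrite setTI; apply: sub_sigma_algebra.
exists [:: t], (fun=> B); split => //=; first by rewrite t0.
apply/seteqP; split => w /=; first by move=> ? ?; rewrite inE => /eqP ->.
by apply; rewrite inE.
Qed.

Lemma measurable_fun_path dT (T : measurableType dT) (f : T -> mpath) :
  (forall t, 0 <= t -> measurable_fun setT (fun x => (f x : rc_path) t)) ->
  measurable_fun setT f.
Proof.
move=> mf; apply: (@measurability _ _ T mpath setT f cylinders) => //.
move=> _ [_ [s [B [p mB ->]]] <-]; rewrite setTI.
elim: s p => [_|t s IH /= /andP[t0 p]].
  rewrite (_ : _ @^-1` _ = setT); first exact: measurableT.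
  by apply/seteqP; split.
rewrite (_ : _ @^-1` _ = (fun x => (f x : rc_path) t) @^-1` B t `&` f @^-1` cylinder s B).
  apply: measurableI; last exact: IH.
  by rewrite -[X in measurable X]setTI; exact: mf.
apply/seteqP; split => x /=.
  move=> h; split; first by apply: h; rewrite mem_head.
  by move=> u us; apply: h; rewrite inE us orbT.
by move=> [h1 h2] u; rewrite inE => /orP[/eqP ->//|/h2].
Qed.

End path_space.

Section path_markov.
Context (R : realType) (d dE : measure_display).
Context (Omega : measurableType d) (E : borelMetricType dE R).
Variables (X : R -> Omega -> E) (Q : E -> probability Omega R).
Hypothesis XQ : strong_markov_process X Q.
Hypothesis Xrc : forall w t, 0 <= t -> X s w @[s --> t^'+] --> X t w.

Let E1 (x : E) : measurable [set x] := borel_set1 x.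

Lemma shifted_path_subproof (a : R) (w : Omega) : 0 <= a -> forall u, 0 <= u ->
  (fun u => X (a + u) w) s @[s --> u^'+] --> X (a + u) w.
Proof.
move=> a0 u u0; apply: (cvg_comp (fun s => a + s) (X^~ w)); last first.
  by apply: Xrc; exact: addr_ge0.
move=> P [e /= e0 he]; exists e => // s /= us uls; apply: he => /=.
  by rewrite opprD addrACA subrr add0r.
by rewrite ltrD2l.
Qed.

Definition shifted_path (a : R) (a0 : 0 <= a) (w : Omega) : mpath E :=
  RcPath (@shifted_path_subproof a w a0).

Lemma measurable_shifted_path a (a0 : 0 <= a) :
  measurable_fun setT (shifted_path a0).
Proof.
by apply: measurable_fun_path => t t0; apply: (markov_coordinate XQ); exact: addr_ge0.
Qed.

Local Open Scope ereal_scope.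

(** Finite-dimensional distributions as nested integrals over increasing times, [t0] being the time
    at which the process is at [x]. *)
Fixpoint cylinder_law (B : R -> set E) (t0 : R) (s : seq R) (x : E) : \bar R :=
  if s is t :: s' then
    \int[Q x]_w ((\1_(B t) (X (t - t0)%R w))%:E * cylinder_law B t s' (X (t - t0)%R w))
  else 1.

Lemma cylinder_law_ge0 B t0 s x : 0 <= cylinder_law B t0 s x.
Proof.
case: s t0 x => [|t s] t0 x //=; apply: integral_ge0 => w _.
elim: s t (X _ w) => [|u s IH] t y; rewrite mule_ge0 ?lee_fin//.
by apply: integral_ge0 => w' _; exact: IH.
Qed.

Lemma measurable_cylinder_law B t0 s : (forall t, measurable (B t)) ->
  path <=%R t0 s -> measurable_fun setT (cylinder_law B t0 s).
Proof.
move=> mB; elim: s t0 => [|t s IH] t0 /=; first by [].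
move=> /andP[t0t ts].
apply: (@measurable_transition _ _ _ _ _ X Q XQ (t - t0)%R
  (fun y => (\1_(B t) y)%:E * cylinder_law B t s y)).
- by rewrite subr_ge0.
- apply: emeasurable_funM; last exact: IH.
  by apply/measurable_EFinP; exact: measurable_indic.
- by move=> y; rewrite mule_ge0 ?lee_fin// cylinder_law_ge0.
Qed.

(** The event at the earliest time [t] joins the past [A] and the induction goes on from [t]; the
    simple Markov property over [t - t0] then brings the integrand back to time [a + t0]. *)
Lemma markov_cylinder B a t0 s A x : (forall t, measurable (B t)) ->
  (0 <= a)%R -> (0 <= t0)%R -> path <=%R t0 s -> natural_filtration X (a + t0) A ->
  Q x (A `&` [set w | forall t, t \in s -> B t (X (a + t)%R w)]) =
  \int[Q x]_w ((\1_A w)%:E * cylinder_law B t0 s (X (a + t0)%R w)).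
Proof.
move=> mB a0; elim: s t0 A => [|t s IH] t0 A t00 /=.
  move=> _ hA; have mA := natural_filtration_measurable XQ hA.
  rewrite (_ : [set w | _] = setT) ?setIT; last exact/seteqP.
  under eq_integral do rewrite mule1.
  by rewrite integral_indic// setIT.
move=> /andP[t0t ts] hA; have t_ge0 : (0 <= t)%R by exact: le_trans t0t.
have at0 : (0 <= a + t0)%R by exact: addr_ge0.
have att0 : (a + t0 <= a + t)%R by rewrite lerD2l.
rewrite (_ : A `&` _ = (A `&` X (a + t)%R @^-1` B t) `&`
    [set w | forall u, u \in s -> B u (X (a + u)%R w)]); last first.
  apply/seteqP; split => w /=.
    move=> [Aw h]; split; first by split => //; apply: h; rewrite mem_head.
    by move=> u us; apply: h; rewrite inE us orbT.
  by move=> [[Aw h1] h2]; split => // u; rewrite inE => /orP[/eqP ->//|/h2].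
rewrite (IH t)//; last first.
  apply: natural_filtrationI; first exact: natural_filtration_mono hA.
  by apply: natural_filtration_coordinate => //; rewrite lexx andbT addr_ge0.
transitivity (\int[Q x]_w ((\1_A w)%:E *
   ((\1_(B t) (X (a + t)%R w))%:E * cylinder_law B t s (X (a + t)%R w)))).
  by apply: eq_integral => w _; rewrite indicI EFinM muleA.
have -> : (a + t = (a + t0) + (t - t0))%R by ring.
apply: (@simple_markov_fun _ _ _ _ _ X Q XQ E1 x (a + t0)%R (t - t0)%R A
  (fun y => (\1_(B t) y)%:E * cylinder_law B t s y)) => //.
- by rewrite subr_ge0.
- apply: emeasurable_funM; last exact: measurable_cylinder_law.
  by apply/measurable_EFinP; exact: measurable_indic.
- by move=> y; rewrite mule_ge0 ?lee_fin// cylinder_law_ge0.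
Qed.

Definition path_law (G : set (mpath E)) (x : E) : \bar R :=
  Q x (shifted_path (lexx 0%R) @^-1` G).

(** Dynkin's argument over the cylinders, whose times are sorted first; complements use subtraction
    of finite values. Measurability of [path_law G] is carried along because the identity integrates
    it. *)
Lemma markov_path_set (G : set (mpath E)) : measurable G ->
  measurable_fun setT (path_law G) /\
  forall a (a0 : (0 <= a)%R) x A, natural_filtration X a A ->
    Q x (A `&` shifted_path a0 @^-1` G) =
    \int[Q x]_w ((\1_A w)%:E * path_law G (X a w)).
Proof.
have mXi a (a0 : (0 <= a)%R) H : measurable H -> measurable (shifted_path a0 @^-1` H).
  by move=> mH; rewrite -[X in measurable X]setTI; exact: measurable_shifted_path.
have mI A : measurable A -> measurable_fun setT (fun w : Omega => (\1_A w)%:E : \bar R).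
  by move=> mA; apply/measurable_EFinP; exact: measurable_indic.
move=> mG; move: (mG : <<s @cylinders R dE E >> G).
apply: (@dynkin_induction _ (mpath E) (@cylinders R dE E)
  [set G | measurable_fun setT (path_law G) /\
  forall a (a0 : (0 <= a)%R) x A, natural_filtration X a A ->
    Q x (A `&` shifted_path a0 @^-1` G) =
    \int[Q x]_w ((\1_A w)%:E * path_law G (X a w))]) => //.
- exact: cylindersI.
- split => [|a a0 x A hA].
    rewrite (_ : path_law _ = fun=> 1); first exact: measurable_cst.
    by apply/funext => x; exact: probability_setT.
  have mA := natural_filtration_measurable XQ hA.
  transitivity (\int[Q x]_w (\1_A w)%:E).
    by rewrite integral_indic// setIT.
  apply: eq_integral => w _; rewrite -[LHS]mule1; congr (_ * _).
  by rewrite /path_law preimage_setT; symmetry; exact: probability_setT.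
- move=> _ [s0 [B [p0 mB ->]]].
  pose s := sort <=%R s0.
  have ss : path <=%R 0%R s.
    have : sorted <=%R s by exact: sort_le_sorted.
    have : all (fun t => 0 <= t)%R s by rewrite all_sort.
    by case: s => //= t s /andP[-> _] ->.
  have cE a (a0 : (0 <= a)%R) : shifted_path a0 @^-1` cylinder s0 B =
      [set w | forall t, t \in s -> B t (X (a + t)%R w)].
    by apply/seteqP; split => w /= h t ts; apply: h; rewrite ?mem_sort// mem_sort in ts *.
  have law x : path_law (cylinder s0 B) x = cylinder_law B 0%R s x.
    rewrite /path_law cE -[X in Q x X]setTI (@markov_cylinder B 0%R 0%R)//; last exact: natural_filtrationT.
    under eq_integral do rewrite indicT mul1e addr0.
    apply: (transition0 XQ); first exact: measurable_cylinder_law.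
    by move=> y; exact: cylinder_law_ge0.
  split => [|a a0 x A hA].
    by rewrite (funext law); exact: measurable_cylinder_law.
  rewrite cE (@markov_cylinder B a 0%R)// ?addr0//.
  by apply: eq_integral => w _; rewrite law.
- move=> G' mG' [m1 h1].
  have lawC x : path_law (~` G') x = 1 - path_law G' x.
    by rewrite /path_law preimage_setC probability_setC//; exact: mXi.
  have fin x : path_law G' x \is a fin_num by apply: fin_num_measure; exact: mXi.
  split => [|a a0 x A hA].
    by rewrite (funext lawC); exact: emeasurable_funB.
  have mA := natural_filtration_measurable XQ hA.
  have finA : Q x (A `&` shifted_path a0 @^-1` G') \is a fin_num.
    by apply: fin_num_measure; apply: measurableI => //; exact: mXi.
  apply: (@adde_cancel _ (Q x (A `&` shifted_path a0 @^-1` G'))) => //.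
  transitivity (Q x A).
    rewrite -measureU//; first by rewrite -setIUr preimage_setC setUv setIT.
    + by apply: measurableI => //; exact: mXi.
    + by apply: measurableI => //; apply: mXi; exact: measurableC.
    + by apply/seteqP; split => w // [[_ h3] [_ h4]]; exact: h4.
  rewrite h1// -ge0_integralD//.
  + transitivity (\int[Q x]_w (\1_A w)%:E); first by rewrite integral_indic// setIT.
    apply: eq_integral => w _; rewrite -ge0_muleDr ?measure_ge0//.
    by rewrite lawC addeC subeK// mule1.
  + by move=> w _; rewrite mule_ge0// lee_fin.
  + apply: emeasurable_funM; first exact: mI.
    by apply: measurableT_comp => //; exact: (markov_coordinate XQ).
  + by move=> w _; rewrite mule_ge0// lee_fin.
  + apply: emeasurable_funM; first exact: mI.
    apply: (measurableT_comp (f := path_law (~` G'))); last exact: (markov_coordinate XQ).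
    by rewrite (funext lawC); exact: emeasurable_funB.
- move=> F mF tF hF.
  have trivIset_pre a (a0 : (0 <= a)%R) :
      trivIset setT (fun k => shifted_path a0 @^-1` F k).
    apply/trivIsetP => i j _ _ ij; rewrite -preimage_setI.
    by move/trivIsetP : tF => ->//; rewrite preimage_set0.
  have lawU x : path_law (\bigcup_k F k) x = \sum_(k <oo) path_law (F k) x.
    rewrite /path_law preimage_bigcup measure_bigcup//.
    + by apply: eq_eseriesl => k; rewrite in_setT.
    + by move=> k _; exact: mXi.
  split => [|a a0 x A hA].
    rewrite (funext lawU); apply: ge0_emeasurable_sum => //.
    by move=> k _; exact: (hF k).1.
  have mA := natural_filtration_measurable XQ hA.
  rewrite preimage_bigcup setI_bigcupr measure_bigcup//.
  + transitivity (\sum_(k <oo) \int[Q x]_w ((\1_A w)%:E * path_law (F k) (X a w))).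
      rewrite (@eq_eseriesl _ _ xpredT); last by move=> k; rewrite in_setT.
      by apply: eq_eseriesr => k _; apply: (hF k).2.
    rewrite -integral_nneseries//.
    * apply: eq_integral => w _; rewrite lawU nneseriesZl// => k _.
    * move=> k; apply: emeasurable_funM; first exact: mI.
      by apply: (measurableT_comp (hF k).1); exact: (markov_coordinate XQ).
    * by move=> k w _; rewrite mule_ge0// lee_fin.
  + by move=> k _; apply: measurableI => //; exact: mXi.
  + by apply: trivIset_setIl; exact: trivIset_pre.
Qed.

End path_markov.

(** * Exponentials and time integrals along paths *)

Section expeR_lemmas.
Context {R : realType}.
Local Open Scope ereal_scope.

Lemma measurable_expeR : measurable_fun setT (@expeR R).
Proof.
apply: (measurability (@ErealGenOInfty.G R)); first exact: ErealGenOInfty.measurableE.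
move=> _ [_ [c -> <-]]; rewrite setTI.
have [c0|c0] := ltP c 0%R.
  rewrite (_ : _ @^-1` _ = setT)//.
  apply/seteqP; split => // x _ /=; rewrite in_itv/= andbT.
  by apply: lt_le_trans (expeR_ge0 x); rewrite lte_fin.
rewrite (_ : _ @^-1` _ = `]lne c%:E, +oo[%classic).
  exact: emeasurable_itv.
have cK : expeR (lne c%:E) = c%:E by rewrite lneK// in_itv/= lee_fin c0 leey.
have h x : (c%:E < expeR x) = (lne c%:E < x) by rewrite -{1}cK lte_expeR.
by apply/seteqP; split => x /=; rewrite !in_itv/= !andbT h.
Qed.

Lemma expeR_oppD (a b : \bar R) : 0 <= a -> 0 <= b ->
  expeR (- (a + b)) = expeR (- a) * expeR (- b).
Proof. by move=> a0 b0; rewrite -expeRD oppeD// ge0_adde_def// inE. Qed.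

End expeR_lemmas.

Section lebesgue_shift.
Context {R : realType}.
Local Open Scope ereal_scope.

(** The image measure under translation agrees with Lebesgue measure on half-open intervals, which
    determine it. *)
Lemma lebesgue_measure_shift (a : R) (A : set (measurableTypeR R)) : measurable A ->
  lebesgue_measure ((fun u : measurableTypeR R => (a + u)%R : measurableTypeR R) @^-1` A) =
  lebesgue_measure A.
Proof.
move=> mA; symmetry.
have mphi : measurable_fun setT (fun u : measurableTypeR R => (a + u)%R : measurableTypeR R).
  exact: measurable_funD.
apply: (@lebesgue_measure_unique R
  (measure_function_pushforward__canonical__measure_function_Measure lebesgue_measure mphi)) => //.
move=> _ [[u v]] _ <- /=; rewrite /pushforward.
rewrite (_ : _ @^-1` _ = `]u - a, v - a]%classic)%R.
  rewrite !lebesgue_measure_itv/= !lte_fin ltrD2r; case: ifP => // _.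
  by rewrite -!EFinB; congr EFin; ring.
by apply/seteqP; split => y /=; rewrite !in_itv/= ltrBlDl lerBrDl.
Qed.

Lemma integral_shift (a : R) (D : set R) (f : R -> \bar R) :
  measurable (D : set (measurableTypeR R)) ->
  measurable_fun (D : set (measurableTypeR R)) f -> (forall u, D u -> 0 <= f u) ->
  \int[lebesgue_measure]_(u in D) f u =
  \int[lebesgue_measure]_(u in [set u | D (a + u)%R]) f (a + u)%R.
Proof.
move=> mD mf f0.
have mphi : measurable_fun setT (fun u : measurableTypeR R => (a + u)%R : measurableTypeR R).
  exact: measurable_funD.
have := @ge0_integral_pushforward _ _ (measurableTypeR R) (measurableTypeR R) R
  _ mphi lebesgue_measure D f mD mf.
rewrite /= => <-; last by move=> y; rewrite inE; exact: f0.
apply: eq_measure_integral => A mA AD; rewrite /pushforward/=.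
by rewrite -(lebesgue_measure_shift a mA).
Qed.

End lebesgue_shift.

Section time_integral.
Context {R : realType} (dE d : measure_display) (E : borelMetricType dE R) (Om : measurableType d).
Variables (Y : R -> Om -> E).
Hypothesis mY : forall u, 0 <= u -> measurable_fun setT (Y u).
Hypothesis rcY : forall w u, 0 <= u -> Y s w @[s --> u^'+] --> Y u w.
Local Open Scope ereal_scope.

(** Freezing the process at its value at 0 for negative times gives a right-continuous process on
    the whole line. *)
Lemma jointly_measurable_nonneg_times :
  measurable_fun setT (fun z : measurableTypeR R * Om => Y (Num.max 0%R z.1) z.2).
Proof.
apply: (@right_continuous_jointly_measurable R dE d E Om (fun u => Y (Num.max 0%R u))).
  by move=> u; apply: mY; rewrite le_max lexx.
move=> w u; have [u0|u0] := leP 0%R u.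
  have := @rcY w u u0; apply: cvg_trans; apply: near_eq_cvg.
  near=> s; rewrite max_r//; apply: le_trans u0 _; apply: ltW.
  by near: s; exact: nbhs_right_gt.
have : (fun=> Y 0%R w) s @[s --> u^'+] --> Y 0%R w by exact: cvg_cst.
apply: cvg_trans; apply: near_eq_cvg; near=> s; rewrite max_l//; apply: ltW.
by near: s; exact: nbhs_right_lt.
Unshelve. all: end_near. Qed.


Section weighted.
Variables (k : R -> \bar R) (f : E -> \bar R) (D : set R).
Hypotheses (mk : measurable_fun setT (k : measurableTypeR R -> \bar R)) (k0 : forall u, 0 <= k u).
Hypotheses (mf : measurable_fun setT f) (f0 : forall x, 0 <= f x).
Hypotheses (mD : measurable (D : set (measurableTypeR R))) (D0 : forall u, D u -> (0 <= u)%R).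

Let F (z : measurableTypeR R * Om) : \bar R :=
  (\1_D z.1)%:E * (k z.1 * f (Y (Num.max 0%R z.1) z.2)).

Let mF : measurable_fun setT F.
Proof.
have mI : measurable_fun setT (\1_D : measurableTypeR R -> R) by exact: measurable_indic.
apply: emeasurable_funM.
  by apply/measurable_EFinP; exact: (measurableT_comp mI measurable_fst).
apply: emeasurable_funM; first exact: (measurableT_comp mk).
exact: (measurableT_comp mf jointly_measurable_nonneg_times).
Qed.

Let F0 z : 0 <= F z.
Proof. by rewrite /F mule_ge0 ?lee_fin// mule_ge0. Qed.

Let FE w : \int[lebesgue_measure]_(s in D) (k s * f (Y s w)) =
  \int[lebesgue_measure]_s F (s, w).
Proof.
rewrite integral_indicE; apply: eq_integral => s _; rewrite /F/= indicE.
by case: (boolP (s \in D)) => [|_]; rewrite ?mul0e// inE => /D0 s0; rewrite max_r.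
Qed.

Lemma measurable_time_integral :
  measurable_fun setT (fun w => \int[lebesgue_measure]_(s in D) (k s * f (Y s w))).
Proof.
rewrite (funext FE).
exact: (@measurable_fun_fubini_tonelli_G _ _ _ Om _ lebesgue_measure F mF F0).
Qed.

Lemma time_integral_tonelli (P : probability Om R) :
  \int[P]_w \int[lebesgue_measure]_(s in D) (k s * f (Y s w)) =
  \int[lebesgue_measure]_(s in D) (k s * \int[P]_w f (Y s w)).
Proof.
under eq_integral do rewrite FE.
rewrite -(@fubini_tonelli _ _ _ Om _ lebesgue_measure P F mF F0) [RHS]integral_indicE.
apply: eq_integral => s _.
have m1 : measurable_fun setT (fun w => f (Y (Num.max 0%R s) w)).
  by apply: measurableT_comp => //; apply: mY; rewrite le_max lexx.
rewrite /F /= ge0_integralZl//.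
- rewrite ge0_integralZl//= indicE.
  by case: (boolP (s \in D)) => [|_]; rewrite ?mul0e// inE => /D0 s0; rewrite max_r.
- exact: emeasurable_funM.
- by move=> w _; rewrite mule_ge0.
Qed.

End weighted.
End time_integral.

Section monotone_products.
Context {R : realType}.
Local Open Scope ereal_scope.

(** Multiplication by [+oo] is discontinuous at 0. Monotonicity leaves two cases: some term is
    positive and all later products are infinite, or every term is 0. *)
Lemma ge0_nondecreasing_cvgeMr (u : nat -> \bar R) (l c : \bar R) :
  (forall n, 0 <= u n) -> {homo u : n k / (n <= k)%N >-> n <= k} ->
  0 <= c -> u n @[n --> \oo] --> l -> u n * c @[n --> \oo] --> l * c.
Proof.
move=> u0 nu c0 ul.
have le_l n : u n <= l.
  rewrite -(cvg_lim _ ul)//; apply: lime_ge; first by apply/cvg_ex; exists l.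
  by exists n => // k /= nk; exact: nu.
case: c c0 => [c| |]//; first by move=> _; exact: cvgeZr.
move=> _; have [[N uN]|h] := pselect (exists N, 0 < u N).
  have l0 : 0 < l by exact: lt_le_trans (le_l N).
  rewrite gt0_muley//; apply: cvg_near_cst.
  by exists N => // k /= Nk; rewrite gt0_muley// (lt_le_trans uN)// nu.
have uE n : u n = 0.
  by apply/eqP; rewrite eq_le u0 andbT leNgt; apply/negP => un; apply: h; exists n.
have -> : l = 0.
  by rewrite -(cvg_lim _ ul)// (funext uE) lim_cst.
rewrite (_ : (fun n => _) = fun=> 0) ?mul0e; first exact: cvg_cst.
by apply/funext => n; rewrite uE mul0e.
Qed.

End monotone_products.

Section path_functionals.
Context (R : realType) (d dE : measure_display).
Context (Omega : measurableType d) (E : borelMetricType dE R).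
Variables (X : R -> Omega -> E) (Q : E -> probability Omega R).
Hypothesis XQ : strong_markov_process X Q.
Hypothesis Xrc : forall w t, 0 <= t -> X s w @[s --> t^'+] --> X t w.
Local Open Scope ereal_scope.

Notation shift := (@shifted_path R d dE Omega E X Xrc).

(** The sample space with the past as its sigma-algebra: adaptedness becomes plain measurability,
    and [ge0_fun_ind] applies to adapted variables. *)
Definition past_type (t : R) : measurableType _ := g_sigma_algebraType
  [set A : set Omega | exists s B, [/\ (0 <= s <= t)%R, measurable B & A = X s @^-1` B]].

Lemma measurable_past t dT (T : measurableType dT) (Z : Omega -> T) :
  measurable_fun setT (Z : past_type t -> T) -> measurable_fun setT Z.
Proof.
move=> mZ _ B mB; rewrite setTI; apply: (natural_filtration_measurable XQ (t := t)).
by have := mZ measurableT B mB; rewrite setTI.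
Qed.

Lemma measurable_path_fun (Phi : mpath E -> \bar R) a (a0 : (0 <= a)%R) :
  measurable_fun setT Phi -> measurable_fun setT (fun w => Phi (shift a0 w)).
Proof. by move=> mPhi; exact: (measurableT_comp mPhi (measurable_shifted_path XQ Xrc a0)). Qed.

Definition path_expectation (Phi : mpath E -> \bar R) (x : E) : \bar R :=
  \int[Q x]_w Phi (shift (lexx 0%R) w).

Lemma path_expectation_ge0 Phi x : (forall g, 0 <= Phi g) -> 0 <= path_expectation Phi x.
Proof. by move=> P0; exact: integral_ge0. Qed.

Lemma markov_path_event (Phi : mpath E -> \bar R) :
  measurable_fun setT Phi -> (forall g, 0 <= Phi g) ->
  measurable_fun setT (path_expectation Phi) /\
  forall a (a0 : (0 <= a)%R) x A, natural_filtration X a A ->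
    \int[Q x]_w ((\1_A w)%:E * Phi (shift a0 w)) =
    \int[Q x]_w ((\1_A w)%:E * path_expectation Phi (X a w)).
Proof.
have mI (A : set Omega) : measurable A -> measurable_fun setT (fun w : Omega => (\1_A w)%:E : \bar R).
  by move=> mA; apply/measurable_EFinP; exact: measurable_indic.
have I0 (A : set Omega) w : 0 <= (\1_A w)%:E :> \bar R by rewrite lee_fin.
have mA t A : natural_filtration X t A -> measurable A.
  by move=> h; exact: (natural_filtration_measurable XQ h).
have mX a : (0 <= a)%R -> measurable_fun setT (X a).
  by move=> a0; exact: (markov_coordinate XQ a0).
have mL (f : mpath E -> \bar R) a (a0 : (0 <= a)%R) A : measurable A -> measurable_fun setT f ->
    measurable_fun setT (fun w => (\1_A w)%:E * f (shift a0 w)).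
  move=> hA mf; apply: emeasurable_funM; first exact: (mI A hA).
  exact: (measurable_path_fun a0 mf).
have mR (f : mpath E -> \bar R) a A : (0 <= a)%R -> measurable A -> measurable_fun setT (path_expectation f) ->
    measurable_fun setT (fun w => (\1_A w)%:E * path_expectation f (X a w)).
  move=> a0 hA mf; apply: emeasurable_funM; first exact: (mI A hA).
  by apply: measurableT_comp => //; exact: mX.
have mS a (a0 : (0 <= a)%R) (G : set (mpath E)) : measurable G -> measurable (shift a0 @^-1` G).
  by move=> mG; rewrite -[X in measurable X]setTI; exact: (measurable_shifted_path XQ).
move: Phi; apply: ge0_fun_ind.
- move=> G mG; have [m1 h1] := markov_path_set XQ Xrc mG.
  have pE x : path_expectation (fun g => (\1_G g)%:E) x = path_law Q Xrc G x.
    rewrite /path_expectation /path_law.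
    rewrite (_ : (fun w => _) = fun w => (\1_(shift (lexx 0%R) @^-1` G) w)%:E)//.
    rewrite integral_indic//; first (rewrite setIT; reflexivity).
    exact: mS.
  split=> [|a a0 x A hA]; first by rewrite (funext pE).
  under [RHS]eq_integral do rewrite pE.
  rewrite -(h1 _ a0)// -[X in Q x X]setIT -integral_indic//.
    by apply: eq_integral => w _; rewrite indicI EFinM.
  by apply: measurableI; [exact: mA hA|exact: mS].
- move=> f g mf mg f0 g0 [mf1 hf] [mg1 hg].
  have pE x : path_expectation (fun u => f u + g u) x =
      path_expectation f x + path_expectation g x.
    by rewrite /path_expectation ge0_integralD//; exact: measurable_path_fun.
  split=> [|a a0 x A hA]; first by rewrite (funext pE); exact: emeasurable_funD.
  have hA' := mA _ _ hA.
  transitivity (\int[Q x]_w ((\1_A w)%:E * f (shift a0 w)) +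
                \int[Q x]_w ((\1_A w)%:E * g (shift a0 w))).
    rewrite -ge0_integralD//; try exact: mL; try by move=> w _; rewrite mule_ge0.
    by apply: eq_integral => w _; rewrite ge0_muleDr.
  rewrite hf// hg// -ge0_integralD//; try exact: mR;
    try by move=> w _; rewrite mule_ge0// path_expectation_ge0.
  by apply: eq_integral => w _; rewrite pE; symmetry; apply: ge0_muleDr; exact: path_expectation_ge0.
- move=> c f c0 mf f0 [mf1 hf].
  have pE x : path_expectation (fun u => c%:E * f u) x = c%:E * path_expectation f x.
    by rewrite /path_expectation ge0_integralZl//; exact: measurable_path_fun.
  split=> [|a a0 x A hA]; first by rewrite (funext pE); exact: emeasurable_funM.
  have hA' := mA _ _ hA.
  transitivity (c%:E * \int[Q x]_w ((\1_A w)%:E * f (shift a0 w))).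
    rewrite -ge0_integralZl//; try exact: mL; try by move=> w _; rewrite mule_ge0.
    by apply: eq_integral => w _; rewrite muleCA.
  rewrite hf// -ge0_integralZl//; try exact: mR;
    try by move=> w _; rewrite mule_ge0// path_expectation_ge0.
  by apply: eq_integral => w _; rewrite pE muleCA.
- move=> F f mF F0 nF Ff IH.
  have f0 g : 0 <= f g.
    rewrite -(cvg_lim _ (Ff g))//; apply: lime_ge; last exact: nearW.
    by apply/cvg_ex; exists (f g).
  have mf : measurable_fun setT f by apply: emeasurable_fun_cvg mF _ => g _; exact: Ff.
  have pE x : path_expectation (F n) x @[n --> \oo] --> path_expectation f x.
    apply: ge0_cvg_integral => //.
    by move=> n; exact: measurable_path_fun.
  split=> [|a a0 x A hA].
    by apply: (emeasurable_fun_cvg (fun n => path_expectation (F n))) => // n; exact: (IH n).1.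
  have hA' := mA _ _ hA.
  have c1 : \int[Q x]_w ((\1_A w)%:E * F n (shift a0 w)) @[n --> \oo] -->
      \int[Q x]_w ((\1_A w)%:E * f (shift a0 w)).
    apply: ge0_cvg_integral => //; first by move=> n; exact: mL.
    - by move=> n w; rewrite mule_ge0.
    - by move=> w i j ij; rewrite lee_wpmul2l// nF.
    - by move=> w; apply: cvgeZl.
  have c2 : \int[Q x]_w ((\1_A w)%:E * F n (shift a0 w)) @[n --> \oo] -->
      \int[Q x]_w ((\1_A w)%:E * path_expectation f (X a w)).
    rewrite (_ : (fun n => _) =
        fun n => \int[Q x]_w ((\1_A w)%:E * path_expectation (F n) (X a w))); last first.
      by apply/funext => n; exact: (IH n).2.
    apply: ge0_cvg_integral => //; first by move=> n; apply: mR => //; exact: (IH n).1.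
    - by move=> n w; rewrite mule_ge0// path_expectation_ge0.
    - move=> w i j ij; rewrite lee_wpmul2l//; apply: ge0_le_integral => //;
        try exact: measurable_path_fun.
      by move=> w' _; exact: nF.
    - by move=> w; apply: cvgeZl.
  by rewrite -(cvg_lim _ c1)// (cvg_lim _ c2).
Qed.

(** A second induction, now over the past: [Z] and [Phi] live on different sigma-algebras and are
    built up one after the other. *)
Lemma markov_path_fun (Phi : mpath E -> \bar R) a (a0 : (0 <= a)%R) x
    (Z : Omega -> \bar R) :
  measurable_fun setT Phi -> (forall g, 0 <= Phi g) ->
  measurable_fun setT (Z : past_type a -> \bar R) -> (forall w, 0 <= Z w) ->
  \int[Q x]_w (Z w * Phi (shift a0 w)) =
  \int[Q x]_w (Z w * path_expectation Phi (X a w)).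
Proof.
move=> mPhi P0; have [mE hE] := markov_path_event mPhi P0.
have mX := markov_coordinate XQ a0.
have m1 := measurable_path_fun a0 mPhi.
have m2 : measurable_fun setT (fun w => path_expectation Phi (X a w)).
  exact: measurableT_comp.
have mP : forall Z : past_type a -> \bar R, measurable_fun setT Z ->
  measurable_fun setT (Z : Omega -> \bar R) by move=> ?; exact: measurable_past.
have e0 w : 0 <= path_expectation Phi (X a w) by exact: path_expectation_ge0.
move: Z; apply: (@ge0_fun_ind R _ (past_type a)).
- by move=> A mA; exact: hE.
- move=> f g mf mg f0 g0 IHf IHg.
  transitivity (\int[Q x]_w (f w * Phi (shift a0 w)) + \int[Q x]_w (g w * Phi (shift a0 w))).
    rewrite -ge0_integralD//; try by move=> w _; rewrite mule_ge0.
    + by apply: eq_integral => w _; rewrite ge0_muleDl.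
    + by apply: emeasurable_funM => //; exact: mP.
    + by apply: emeasurable_funM => //; exact: mP.
  rewrite IHf IHg -ge0_integralD//; try by move=> w _; rewrite mule_ge0.
  + by apply: eq_integral => w _; rewrite ge0_muleDl.
  + by apply: emeasurable_funM => //; exact: mP.
  + by apply: emeasurable_funM => //; exact: mP.
- move=> c f c0 mf f0 IH.
  under eq_integral do rewrite -muleA.
  under [RHS]eq_integral do rewrite -muleA.
  rewrite !ge0_integralZl//; try by move=> w _; rewrite mule_ge0.
  + by rewrite IH.
  + by apply: emeasurable_funM => //; exact: mP.
  + by apply: emeasurable_funM => //; exact: mP.
- move=> F f mF F0 nF Ff IH.
  have c1 : \int[Q x]_w (F n w * Phi (shift a0 w)) @[n --> \oo] -->
      \int[Q x]_w (f w * Phi (shift a0 w)).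
    apply: ge0_cvg_integral => //.
    - by move=> n; apply: emeasurable_funM => //; exact: mP.
    - by move=> n w; rewrite mule_ge0.
    - by move=> w i j ij; rewrite lee_wpmul2r//; exact: nF.
    - by move=> w; apply: ge0_nondecreasing_cvgeMr.
  have c2 : \int[Q x]_w (F n w * Phi (shift a0 w)) @[n --> \oo] -->
      \int[Q x]_w (f w * path_expectation Phi (X a w)).
    rewrite (_ : (fun n => _) =
        fun n => \int[Q x]_w (F n w * path_expectation Phi (X a w))); last exact/funext.
    apply: ge0_cvg_integral => //.
    - by move=> n; apply: emeasurable_funM => //; exact: mP.
    - by move=> n w; rewrite mule_ge0.
    - by move=> w i j ij; rewrite lee_wpmul2r//; exact: nF.
    - by move=> w; apply: ge0_nondecreasing_cvgeMr.
  by rewrite -(cvg_lim _ c1)// (cvg_lim _ c2).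
Qed.

End path_functionals.

(** * The pricing semigroup *)

Section pricing.
Context (R : realType) (d dE : measure_display).
Context (Omega : measurableType d) (E : borelMetricType dE R).
Variables (X : R -> Omega -> E) (Q : E -> probability Omega R) (r : E -> R).
Hypothesis XQ : strong_markov_process X Q.
Hypothesis Xrc : forall w t, 0 <= t -> X s w @[s --> t^'+] --> X t w.
Hypotheses (r0 : forall x, 0 <= r x) (mr : measurable_fun setT r).
Local Open Scope ereal_scope.

Notation shift := (@shifted_path R d dE Omega E X Xrc).

Let mX t : (0 <= t)%R -> measurable_fun setT (X t).
Proof. by move=> t0; exact: (markov_coordinate XQ t0). Qed.

Let mEr : measurable_fun setT (EFin \o r).
Proof. exact/measurable_EFinP. Qed.

Let Er0 x : 0 <= (EFin \o r) x.
Proof. by rewrite lee_fin. Qed.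

Lemma measurable_rate_integral dT (T : measurableType dT) (Y : R -> T -> E) t :
  (forall u, (0 <= u)%R -> measurable_fun setT (Y u)) ->
  (forall w u, (0 <= u)%R -> Y s w @[s --> u^'+] --> Y u w) ->
  measurable_fun setT
    (fun w => \int[lebesgue_measure]_(s in `[0%R, t]) (r (Y s w))%:E).
Proof.
move=> mY rcY.
have := @measurable_time_integral R dE _ E T Y mY rcY (fun=> 1) (EFin \o r) `[0%R, t]
  (measurable_cst _) (fun=> lee01) mEr Er0 (measurable_itv _).
rewrite (_ : (fun w => _) = fun w => \int[lebesgue_measure]_(s in `[0%R, t]) (r (Y s w))%:E).
  by apply; move=> u /=; rewrite in_itv/= => /andP[].
by apply/funext => w; apply: eq_integral => s _; rewrite mul1e.
Qed.

Lemma integrated_rate_ge0 t w : 0 <= integrated_rate X r t w.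
Proof. by apply: integral_ge0 => s _; rewrite lee_fin. Qed.

Lemma discount_ge0 t w : 0 <= discount X r t w.
Proof. exact: expeR_ge0. Qed.

Lemma discount_le1 t w : discount X r t w <= 1.
Proof. by rewrite -expeR0 lee_expeR leeNl oppe0 integrated_rate_ge0. Qed.

Lemma discount0 w : discount X r 0 w = 1.
Proof.
by rewrite /discount /integrated_rate set_itv1 integral_set1 oppe0 expeR0.
Qed.

Lemma discount_gt0 t w : integrated_rate X r t w < +oo -> 0 < discount X r t w.
Proof. by move=> h; apply: expeR_gt0; move: h; case: integrated_rate => //= s _; rewrite ltNyr. Qed.

Lemma measurable_discount t : measurable_fun setT (discount X r t).
Proof.
apply: (measurableT_comp (@measurable_expeR R)).
by apply: measurableT_comp => //; exact: measurable_rate_integral.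
Qed.

(** On [[0, t]], [X s] equals [X (min s t)], a process which is right-continuous and, at every time,
    measurable for the past of [t]; joint measurability is then applied over the past. *)
Lemma measurable_discount_past t : (0 <= t)%R ->
  measurable_fun setT (discount X r t : past_type X t -> \bar R).
Proof.
move=> t0.
suff mI : measurable_fun setT (integrated_rate X r t : past_type X t -> \bar R).
  by apply: (measurableT_comp (@measurable_expeR R)); exact: measurableT_comp.
rewrite (_ : integrated_rate X r t = fun w : past_type X t =>
    \int[lebesgue_measure]_(s in `[0%R, t]) (r (X (Num.min s t) w))%:E); last first.
  apply/funext => w; apply: eq_integral => s; rewrite inE/= in_itv/= => /andP[_ st].
  by rewrite min_l.
apply: (@measurable_rate_integral _ (past_type X t) (fun s => X (Num.min s t))).
  move=> u u0 B mB; rewrite setTI; apply: (@natural_filtration_coordinate _ _ _ _ _ X t) => //.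
  by rewrite le_min u0 t0 ge_min lexx orbT.
move=> w u u0; have [ut|tu] := ltP u t.
  have := @Xrc w u u0; apply: cvg_trans; apply: near_eq_cvg.
  by near=> s; rewrite min_l//; near: s; exact: nbhs_right_le.
have : (fun=> X t w) s @[s --> u^'+] --> X t w by exact: cvg_cst.
apply: cvg_trans; apply: near_eq_cvg; near=> s; rewrite min_r//.
by apply: le_trans tu _; apply: ltW; near: s; exact: nbhs_right_gt.
Unshelve. all: end_near. Qed.

Definition path_discount (h : R) (g : mpath E) : \bar R :=
  expeR (- \int[lebesgue_measure]_(s in `[0%R, h]) (r ((g : rc_path E) s))%:E).

Lemma measurable_path_discount h : measurable_fun setT (path_discount h).
Proof.
apply: (measurableT_comp (@measurable_expeR R)); apply: measurableT_comp => //.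
apply: (@measurable_rate_integral _ (mpath E) (fun s g => (g : rc_path E) s)).
  by move=> u u0; exact: measurable_eval.
by move=> g u u0; exact: rc_path_right_continuous.
Qed.

Lemma path_discount_shift0 h w : path_discount h (shift (lexx 0%R) w) = discount X r h w.
Proof.
by congr (expeR (- _)); apply: eq_integral => s _ /=; rewrite add0r.
Qed.

(** The rate integral is cut at [a] and its second piece translated to the path after [a]; the
    extended exponential keeps this valid for infinite integrals. *)
Lemma discountD a (a0 : (0 <= a)%R) h w : (0 <= h)%R ->
  discount X r (a + h) w = discount X r a w * path_discount h (shift a0 w).
Proof.
move=> h0; rewrite /discount /path_discount -expeR_oppD; last 2 first.
- exact: integrated_rate_ge0.
- by apply: integral_ge0 => s _; rewrite lee_fin.
congr (expeR (- _)).
have mrX : measurable_fun setT (fun s : measurableTypeR R => (r (X (Num.max 0%R s) w))%:E).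
  have hj := @jointly_measurable_nonneg_times R dE d E Omega X mX Xrc.
  apply: (measurableT_comp mEr).
  exact: (measurableT_comp hj (pair2_measurable w)).
have E1 (D : set R) : (forall s, D s -> (0 <= s)%R) ->
   \int[lebesgue_measure]_(s in D) (r (X s w))%:E =
   \int[lebesgue_measure]_(s in D) (r (X (Num.max 0%R s) w))%:E.
  by move=> D0; apply: eq_integral => s; rewrite inE => /D0 s0; rewrite max_r.
rewrite /integrated_rate !E1; try by move=> s /=; rewrite in_itv/= => /andP[].
rewrite (_ : `[0%R, (a + h)%R]%classic = `[0%R, a]%classic `|` `]a, (a + h)%R]%classic); last first.
  by rewrite -itv_bndbnd_setU// bnd_simp ?lerDl.
rewrite ge0_integral_setU//=; last 3 first.
- exact: measurable_funTS.
- by move=> s _; rewrite lee_fin.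
- apply/disj_setPS => s [/=]; rewrite !in_itv/= => /andP[_ sa] /andP[as_ _].
  by move: (lt_le_trans as_ sa); rewrite ltxx.
congr (_ + _).
rewrite (@integral_shift R a); last 3 first.
- exact: measurable_itv.
- exact: measurable_funTS.
- by move=> u _; rewrite lee_fin.
rewrite (_ : [set u | _] = `]0%R, h]%classic); last first.
  by apply/seteqP; split => u /=; rewrite !in_itv/= ltrDl lerD2l.
rewrite integral_itv_obnd_cbnd; last first.
  apply: measurable_funTS.
  exact: (measurableT_comp mrX (measurable_funD (measurable_cst a) (@measurable_id _ _ _))).
apply: eq_integral => s; rewrite inE/= in_itv/= => /andP[s0 _].
by rewrite max_r// addr_ge0.
Qed.

Let payoff h (f : E -> \bar R) (g : mpath E) : \bar R :=
  path_discount h g * f ((g : rc_path E) h).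

Let mpayoff h f : (0 <= h)%R -> measurable_fun setT f ->
  measurable_fun setT (payoff h f).
Proof.
move=> h0 mf; apply: emeasurable_funM; first exact: measurable_path_discount.
exact: (measurableT_comp mf (measurable_eval h0)).
Qed.

Let payoff_ge0 h f : (forall x, 0 <= f x) -> forall g, 0 <= payoff h f g.
Proof. by move=> f0 g; rewrite mule_ge0// expeR_ge0. Qed.

Let pricingE h f x : pricing X Q r h f x = path_expectation Q Xrc (payoff h f) x.
Proof.
by apply: eq_integral => w _; rewrite /payoff path_discount_shift0 /= add0r.
Qed.

Lemma measurable_pricing h f : (0 <= h)%R -> measurable_fun setT f ->
  (forall x, 0 <= f x) -> measurable_fun setT (pricing X Q r h f).
Proof.
move=> h0 mf f0; rewrite (funext (pricingE h f)).
by case: (markov_path_event XQ Xrc (mpayoff h0 mf) (payoff_ge0 h f0)).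
Qed.

(** The discount up to [a] is the past factor, and the remaining discount with the payoff is a
    functional of the shifted path. Both the semigroup law and the consistency of the
    eigen-densities follow from this identity. *)
Lemma pricing_markov a h x A f : (0 <= a)%R -> (0 <= h)%R -> natural_filtration X a A ->
  measurable_fun setT f -> (forall x, 0 <= f x) ->
  \int[Q x]_(w in A) (discount X r (a + h) w * f (X (a + h)%R w)) =
  \int[Q x]_(w in A) (discount X r a w * pricing X Q r h f (X a w)).
Proof.
move=> a0 h0 hA mf f0; rewrite [LHS]integral_indicE [RHS]integral_indicE.
transitivity (\int[Q x]_w (((\1_A w)%:E * discount X r a w) * payoff h f (shift a0 w))).
  by apply: eq_integral => w _; rewrite (discountD a0)// !muleA.
rewrite (markov_path_fun XQ)//.
- by apply: eq_integral => w _; rewrite -pricingE muleA.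
- exact: mpayoff.
- exact: payoff_ge0.
- apply: emeasurable_funM; last exact: measurable_discount_past.
  by apply/measurable_EFinP; exact: (@measurable_indic _ (past_type X a)).
- by move=> w; rewrite mule_ge0 ?lee_fin// discount_ge0.
Qed.

Lemma pricing_semigroup a h x f : (0 <= a)%R -> (0 <= h)%R ->
  measurable_fun setT f -> (forall x, 0 <= f x) ->
  pricing X Q r (a + h) f x = pricing X Q r a (pricing X Q r h f) x.
Proof.
move=> a0 h0 mf f0; apply: (@pricing_markov a h x setT f) => //.
exact: natural_filtrationT.
Qed.

Lemma pricing0 f x : measurable_fun setT f -> (forall x, 0 <= f x) ->
  pricing X Q r 0 f x = f x.
Proof.
move=> mf f0; rewrite -[RHS](transition0 XQ x mf f0).
by apply: eq_integral => w _; rewrite discount0 mul1e.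
Qed.

Lemma pricing_le1 t x : (0 <= t)%R -> pricing X Q r t (fun=> 1) x <= 1.
Proof.
move=> t0; apply: (@le_trans _ _ (\int[Q x]_w (cst 1 w))).
  apply: ge0_le_integral => //.
  - by move=> w _; rewrite mule1 discount_ge0.
  - by apply: emeasurable_funM => //; exact: measurable_discount.
  - by move=> w _; rewrite mule1 discount_le1.
by rewrite integral_cst// mul1e probability_le1.
Qed.

End pricing.

(** * Semigroup of a process with a cemetery *)

Section killed_semigroups.
Context (R : realType) (d dE : measure_display).
Context (Omega : measurableType d) (E : borelMetricType dE R).
Variables (Y : R -> Omega -> with_cemetery E) (P : with_cemetery E -> probability Omega R).
Hypothesis YP : killed_strong_markov_process Y P.
Local Open Scope ereal_scope.

Lemma measurable_cemetery1 (x : with_cemetery E) : measurable [set x].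
Proof.
rewrite /measurable/= /cemetery_measurable/=; case: x => [x|].
  by rewrite (_ : _ @^-1` _ = [set x]) ?eqEsubset; [exact: borel_set1|split=> y /=; [case|move->]].
by rewrite (_ : _ @^-1` _ = set0) // -subset0 => y.
Qed.

Definition extend_by0 (f : E -> \bar R) (y : with_cemetery E) : \bar R :=
  if y is Some x then f x else 0.

Lemma measurable_extend_by0 f : measurable_fun setT f ->
  measurable_fun setT (extend_by0 f).
Proof.
move=> mf _ B mB; rewrite setTI /measurable/= /cemetery_measurable/=.
by have := mf measurableT B mB; rewrite setTI.
Qed.

Lemma extend_by0_ge0 f : (forall x, 0 <= f x) -> forall y, 0 <= extend_by0 f y.
Proof. by move=> f0 [x|] /=. Qed.

Lemma killed_semigroupE t f x :
  killed_semigroup Y P t f x = \int[P (Some x)]_w extend_by0 f (Y t w).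
Proof. by []. Qed.

(** The Markov property is applied to [f] extended by 0. When the process is dead at time [t], the
    inner expectation starts at the cemetery and vanishes because that state is absorbing. *)
Lemma killed_semigroupD t s f x : (0 <= t)%R -> (0 <= s)%R ->
  measurable_fun setT f -> (forall y, 0 <= f y) ->
  killed_semigroup Y P (t + s) f x =
  killed_semigroup Y P t (killed_semigroup Y P s f) x.
Proof.
move=> t0 s0 mf f0; have [YM Yabs] := YP.
have hT : natural_filtration Y t setT by exact: natural_filtrationT.
have := @simple_markov_fun R _ _ _ _ Y P YM measurable_cemetery1 (Some x) t s setT
  (extend_by0 f) t0 s0 hT (measurable_extend_by0 mf)
  (extend_by0_ge0 f0).
rewrite !killed_semigroupE => h.
transitivity (\int[P (Some x)]_w ((\1_[set: Omega] w)%:E * extend_by0 f (Y (t + s)%R w))).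
  by apply: eq_integral => w _; rewrite indicT mul1e.
rewrite h; apply: eq_integral => w _; rewrite indicT mul1e.
case: (Y t w) => [y|]//=.
transitivity (\int[P None]_w' (cst 0 w' : \bar R)); last exact: integral0.
have [_ _ start _ _] := YM.
apply: ge0_ae_eq_integral => //.
- apply: (measurableT_comp (measurable_extend_by0 mf)).
  exact: (markov_coordinate YM s0).
- by move=> w' _; exact: extend_by0_ge0.
- by apply: filterS (start None) => w' h0 _; rewrite (Yabs w' 0%R s)// lexx.
Qed.

Lemma killed_semigroup_le1 t x : (0 <= t)%R -> killed_semigroup Y P t (fun=> 1) x <= 1.
Proof.
move=> t0; rewrite killed_semigroupE; have [YM _] := YP.
apply: (@le_trans _ _ (\int[P (Some x)]_w (cst 1 w))).
  apply: ge0_le_integral => //.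
  - by move=> w _; exact: extend_by0_ge0.
  - apply: (measurableT_comp (measurable_extend_by0 (measurable_cst 1))).
    exact: (markov_coordinate YM t0).
  - by move=> w _; case: (Y t w) => [y|] /=; rewrite ?lexx ?lee01.
by rewrite integral_cst// mul1e probability_le1.
Qed.

End killed_semigroups.

Section density_semigroups.
Context (R : realType) (d d' dE : measure_display).
Context (Omega : measurableType d) (Omega' : measurableType d') (E : borelMetricType dE R).
Variables (X : R -> Omega -> E) (Q : E -> probability Omega R) (r : E -> R).
Variables (Y : R -> Omega' -> with_cemetery E) (P : with_cemetery E -> probability Omega' R).
Variable m : {sigma_finite_measure set E -> \bar R}.
Variable p : R -> E -> E -> R.
Hypothesis XQ : strong_markov_process X Q.
Hypothesis Xrc : forall w t, 0 <= t -> X s w @[s --> t^'+] --> X t w.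
Hypotheses (r0 : forall x, 0 <= r x) (mr : measurable_fun setT r).
Hypothesis YP : killed_strong_markov_process Y P.
Hypothesis E_sep : exists2 D : set E, countable D & dense D.
Hypothesis pc : forall t, 0 < t -> continuous (fun z : E * E => p t z.1 z.2).
Hypothesis p0 : forall t x y, 0 < t -> 0 < p t x y.
Hypothesis pP : has_density m (pricing X Q r) p.
Hypothesis pK : has_density m (killed_semigroup Y P) (fun t x y => p t y x).
Local Open Scope ereal_scope.

Let pkernel t : (0 < t)%R -> mkernel (p t).
Proof. by move=> t0; apply: measurable_fun_continuous2 => //; exact: pc. Qed.

Lemma pricing_act t f x : (0 < t)%R -> measurable_fun setT f -> (forall y, 0 <= f y) ->
  pricing X Q r t f x = act m (p t) f x.
Proof. exact: pP. Qed.

Lemma killed_act t f x : (0 < t)%R -> measurable_fun setT f -> (forall y, 0 <= f y) ->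
  killed_semigroup Y P t f x = act m (flip p t) f x.
Proof. exact: pK. Qed.

Lemma pricing_submarkov : submarkov_semigroup m p.
Proof.
split=> //; last by move=> t x t0; rewrite -pricing_act//; apply: pricing_le1 => //; exact: ltW.
move=> t s f x t0 s0 mf f0; rewrite -pricing_act//; last exact: addr_gt0.
rewrite (pricing_semigroup XQ Xrc)//; try exact: ltW.
have -> : pricing X Q r s f = act m (p s) f by apply/funext => y; rewrite pricing_act.
rewrite pricing_act//; first by apply: measurable_act => // [|? ?]; [exact: pkernel|exact/ltW/p0].
by move=> y; apply: act_ge0 => // y1 y2; exact/ltW/p0.
Qed.

Lemma dual_submarkov : submarkov_semigroup m (flip p).
Proof.
split.
- by move=> t t0; apply: mkernelC; exact: pkernel.
- by move=> t x y t0; exact: p0.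
- move=> t s f x t0 s0 mf f0; rewrite -killed_act//; last exact: addr_gt0.
  rewrite killed_semigroupD//; try exact: ltW.
  have -> : killed_semigroup Y P s f = act m (flip p s) f by apply/funext => y; rewrite killed_act.
  rewrite killed_act//; first by apply: measurable_act => //; [apply: mkernelC; exact: pkernel|move=> ? ?; exact/ltW/p0].
  by move=> y; apply: act_ge0 => // y1 y2; exact/ltW/p0.
- by move=> t x t0; rewrite -killed_act//; apply: killed_semigroup_le1 => //; exact: ltW.
Qed.

End density_semigroups.

(** * Occupation times and irreducibility *)

Section occupation_times.
Context (R : realType) (d dE : measure_display).
Context (Omega : measurableType d) (E : borelMetricType dE R).
Variables (X : R -> Omega -> E) (P : E -> probability Omega R).
Hypothesis mX : forall t, 0 <= t -> measurable_fun setT (X t).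
Hypothesis Xrc : forall w t, 0 <= t -> X s w @[s --> t^'+] --> X t w.
Local Open Scope ereal_scope.

Lemma measurable_hitting t (B : set E) : (0 <= t)%R -> measurable B -> measurable (X t @^-1` B).
Proof. by move=> t0 mB; rewrite -[X in measurable X]setTI; exact: mX. Qed.

Section weight.
Variables (k : R -> R) (x : E) (B : set E).
Hypotheses (mk : measurable_fun setT (k : measurableTypeR R -> R)).
Hypotheses (k0 : forall t, (0 <= k t)%R) (mB : measurable B).

Let D : set R := `[0%R, +oo[%classic.

Let D0 u : D u -> (0 <= u)%R.
Proof. by rewrite /D/= in_itv/= andbT. Qed.

Let mf : measurable_fun setT (fun y : E => (\1_B y)%:E : \bar R).
Proof. by apply/measurable_EFinP; exact: measurable_indic. Qed.

Let mkE : measurable_fun setT ((EFin \o k) : measurableTypeR R -> \bar R).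
Proof. exact/measurable_EFinP. Qed.

Lemma measurable_marginal : measurable_fun (`]0%R, +oo[ : set (measurableTypeR R))
  (fun t => (k t)%:E * P x (X t @^-1` B)).
Proof.
pose F (z : measurableTypeR R * Omega) := (k z.1)%:E * (\1_B (X (Num.max 0%R z.1) z.2))%:E.
have mF : measurable_fun setT F.
  apply: emeasurable_funM; first exact: (measurableT_comp mkE).
  exact: (measurableT_comp mf (jointly_measurable_nonneg_times mX Xrc)).
have F0 z : 0 <= F z by rewrite mule_ge0// lee_fin.
have mG := @measurable_fun_fubini_tonelli_F _ _ _ _ _ (P x) F mF F0.
have : measurable_fun (`]0%R, +oo[ : set (measurableTypeR R)) (fubini_F (P x) F).
  exact: measurable_funTS.
apply: eq_measurable_fun.
move=> t; rewrite inE/= in_itv/= andbT => t0.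
have t0' : (0 <= t)%R by exact: ltW.
rewrite /fubini_F /F/= ge0_integralZl//.
- congr (_ * _).
  rewrite max_r// (_ : (fun w => _) = fun w => (\1_(X t @^-1` B) w)%:E)//.
  by rewrite integral_indic ?setIT//; exact: measurable_hitting.
- by apply: (measurableT_comp mf); apply: mX; rewrite le_max lexx.
- by rewrite lee_fin.
Qed.

(** Tonelli, followed by removal of the endpoint 0: transition densities exist at positive times
    only. *)
Lemma occupation_time :
  \int[P x]_w \int[lebesgue_measure]_(t in `[0%R, +oo[) (k t * \1_B (X t w))%:E =
  \int[lebesgue_measure]_(t in `]0%R, +oo[) ((k t)%:E * P x (X t @^-1` B)).
Proof.
rewrite integral_itv_obnd_cbnd; last exact: measurable_marginal.
have f0 y : 0 <= (\1_B y)%:E :> \bar R by rewrite lee_fin.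
have kE0 u : 0 <= (EFin \o k) u by rewrite lee_fin.
have := @time_integral_tonelli R dE d E Omega X mX Xrc (EFin \o k) (fun y => (\1_B y)%:E) D
  mkE kE0 mf f0 (measurable_itv _) D0 (P x).
under eq_integral do under eq_integral do rewrite -EFinM.
move=> ->; apply: eq_integral => t; rewrite inE => /D0 t0; congr (_ * _).
rewrite (_ : (fun w => _) = fun w => (\1_(X t @^-1` B) w)%:E)//.
by rewrite integral_indic ?setIT//; exact: measurable_hitting.
Qed.

End weight.

Lemma potential_occupation x B : measurable B ->
  potential X P x B = \int[lebesgue_measure]_(t in `]0%R, +oo[) P x (X t @^-1` B).
Proof.
move=> mB; have := @occupation_time (fun=> 1%R) x B (measurable_cst _) (fun=> ler01) mB.
under eq_integral do under eq_integral do rewrite mul1r.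
by rewrite /potential => ->; apply: eq_integral => t _; rewrite mul1e.
Qed.

Lemma resolvent_occupation alpha x B : measurable B ->
  resolvent X P alpha x B =
  \int[lebesgue_measure]_(t in `]0%R, +oo[) ((expR (- (alpha * t)))%:E * P x (X t @^-1` B)).
Proof.
move=> mB; apply: (@occupation_time (fun t => expR (- (alpha * t))%R)) => //.
by apply: measurableT_comp => //; apply: measurableT_comp => //; exact: measurable_funM.
Qed.

Lemma potential_eq0 x B : measurable B ->
  (forall t, (0 < t)%R -> P x (X t @^-1` B) = 0) -> potential X P x B = 0.
Proof.
move=> mB h; rewrite potential_occupation//; apply: integral0_eq => t /=.
by rewrite in_itv/= andbT => t0; exact: h.
Qed.

Lemma resolvent_eq0 alpha x B : measurable B ->
  (forall t, (0 < t)%R -> P x (X t @^-1` B) = 0) -> resolvent X P alpha x B = 0.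
Proof.
move=> mB h; rewrite resolvent_occupation//; apply: integral0_eq => t /=.
by rewrite in_itv/= andbT => t0; rewrite h// mule0.
Qed.

Let measurable_marginal1 x B : measurable B -> measurable_fun (`]0%R, +oo[ : set (measurableTypeR R))
  (fun t => P x (X t @^-1` B)).
Proof.
move=> mB; have := @measurable_marginal (fun=> 1%R) x B (measurable_cst _) (fun=> ler01) mB.
by apply: eq_measurable_fun => t _; rewrite mul1e.
Qed.

Lemma potential_gt0 x B : measurable B ->
  (forall t, (0 < t)%R -> 0 < P x (X t @^-1` B)) -> 0 < potential X P x B.
Proof.
move=> mB h; rewrite potential_occupation// lt0e integral_ge0// andbT.
apply/eqP => i0; set D := `]0%R, +oo[%classic in i0.
have mD : measurable (D : set (measurableTypeR R)) by exact: measurable_itv.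
have /(ae_eq_integral_abs _ mD (measurable_marginal1 x mB)) :
    \int[lebesgue_measure]_(t in D) `|P x (X t @^-1` B)| = 0.
  by rewrite -[RHS]i0; apply: eq_integral => t _; rewrite gee0_abs.
move=> [N [mN N0 DN]].
have : lebesgue_measure D <= lebesgue_measure N.
  apply: le_measure; rewrite ?inE// => t Dt; apply: DN => /= /(_ Dt).
  by move: Dt; rewrite /D/= in_itv/= andbT => /h /[swap] ->; rewrite ltxx.
by rewrite N0 lebesgue_measure_itv/= ltry.
Qed.

Lemma potential_eqy x B c T : measurable B -> (0 < c)%R -> (0 < T)%R ->
  (forall t, (T <= t)%R -> c%:E <= P x (X t @^-1` B)) -> potential X P x B = +oo.
Proof.
move=> mB c0 T0 h; rewrite potential_occupation//; apply/eqP; rewrite -leye_eq.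
have TD : `[T, +oo[%classic `<=` `]0%R, +oo[%classic.
  by move=> t /=; rewrite !in_itv/= !andbT; exact: lt_le_trans.
apply: (@le_trans _ _ (\int[lebesgue_measure]_(t in `[T, +oo[) c%:E)).
  rewrite integral_cst//= lebesgue_measure_itv/= ltry/=.
  by rewrite gt0_muley// lte_fin.
apply: (@le_trans _ _ (\int[lebesgue_measure]_(t in `[T, +oo[) P x (X t @^-1` B))).
  apply: ge0_le_integral => //.
  - by move=> t _; rewrite lee_fin ltW.
  - by apply: measurable_funS (measurable_marginal1 x mB).
  - by move=> t /=; rewrite in_itv/= andbT; exact: h.
by apply: ge0_subset_integral => //; exact: measurable_marginal1.
Qed.

(** Stated for arbitrary sets, to be applied to universally measurable ones, whose integrands may
    fail to be measurable. *)
Lemma le_potential x (B1 B2 : set E) : B1 `<=` B2 -> potential X P x B1 <= potential X P x B2.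
Proof.
move=> B12.
have i0 (B : set E) w : 0 <= \int[lebesgue_measure]_(t in `[0%R, +oo[) (\1_B (X t w))%:E.
  by apply: integral_ge0 => t _; rewrite lee_fin.
apply: le_integral_nonmeas => // w; rewrite integral_mkcond [leRHS]integral_mkcond.
apply: le_integral_nonmeas => t; rewrite !patchE; case: ifP => // _; rewrite lee_fin//.
rewrite !indicE; have [/set_mem/B12/mem_set ->|] := boolP (X t w \in B1) => //.
Qed.

End occupation_times.

Section positive_integrals.
Context {R : realType} d (T : measurableType d).
Variable mu : {sigma_finite_measure set T -> \bar R}.
Local Open Scope ereal_scope.

Lemma integral_indic_gt0 (B : set T) (f : T -> R) : measurable B -> 0 < mu B ->
  measurable_fun setT f -> (forall y, (0 < f y)%R) ->
  0 < \int[mu]_y ((\1_B y)%:E * (f y)%:E).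
Proof.
move=> mB B0 mf f0; have g0 y : 0 <= (\1_B y)%:E * (f y)%:E.
  by rewrite mule_ge0// lee_fin// ltW.
rewrite lt0e integral_ge0 ?andbT; last by move=> y _; exact: g0.
apply/eqP => /(ge0_integral_eq0P mu) => -[||N [mN N0 BN]] //.
  by apply: emeasurable_funM; apply/measurable_EFinP; [exact: measurable_indic|exact: mf].
move: B0; rewrite lt0e => /andP[/eqP B0 _]; apply: B0.
apply/eqP; rewrite eq_le measure_ge0 andbT -N0; apply: le_measure; rewrite ?inE//.
by move=> y By; apply: BN => /= /eqP; rewrite indicE mem_set// mul1e eqe gt_eqF.
Qed.

End positive_integrals.

Section density_absolute_continuity.
Context (R : realType) (d dE : measure_display).
Context (Omega : measurableType d) (E : borelMetricType dE R).
Variables (X : R -> Omega -> E) (Q : E -> probability Omega R) (r : E -> R).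
Variable m : {sigma_finite_measure set E -> \bar R}.
Variable p : R -> E -> E -> R.
Hypothesis XQ : strong_markov_process X Q.
Hypothesis Xrc : forall w t, 0 <= t -> X s w @[s --> t^'+] --> X t w.
Hypothesis rX : short_rate X Q r.
Hypothesis hp : submarkov_semigroup m p.
Hypothesis pA : has_density m (pricing X Q r) p.
Local Open Scope ereal_scope.

Let r0 x : (0 <= r x)%R. Proof. by have [h _ _] := rX; exact: h. Qed.
Let mr : measurable_fun setT r. Proof. by have [_ h _] := rX. Qed.
Let mX t : (0 <= t)%R -> measurable_fun setT (X t).
Proof. by move=> t0; exact: (markov_coordinate XQ t0). Qed.

Let mdisc t : measurable_fun setT (discount X r t) := measurable_discount XQ Xrc r0 mr t.

Let mI (B : set E) : measurable B -> measurable_fun setT (fun y => (\1_B y)%:E : \bar R).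
Proof. by move=> mB; apply/measurable_EFinP; exact: measurable_indic. Qed.

Let I0 (B : set E) y : 0 <= (\1_B y)%:E :> \bar R.
Proof. by rewrite lee_fin. Qed.

Let hitE t x (B : set E) : (0 <= t)%R -> measurable B ->
  Q x (X t @^-1` B) = \int[Q x]_w (\1_B (X t w))%:E.
Proof.
move=> t0 mB; rewrite (_ : (fun w => _) = fun w => (\1_(X t @^-1` B) w)%:E)//.
by rewrite integral_indic ?setIT//; exact: measurable_hitting.
Qed.

Lemma pricing_null t x (B : set E) f : (0 < t)%R -> measurable B -> m B = 0 ->
  measurable_fun setT f -> (forall y, 0 <= f y) ->
  pricing X Q r t (fun y => (\1_B y)%:E * f y) x = 0.
Proof.
move=> t0 mB B0 mf f0; have [mp p0 _ _] := hp; rewrite pA//; last first.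
- by move=> y; rewrite mule_ge0.
- by apply: emeasurable_funM => //; exact: mI.
apply/(ge0_integral_eq0P m).
- by apply: mact_term; [exact: mp|apply: emeasurable_funM => //; exact: mI].
- by move=> y; rewrite mule_ge0// ?mule_ge0// lee_fin ltW// p0.
- exists B; split => // y /= h; apply: contrapT => By; apply: h.
  by rewrite indicE memNset// mul0e mule0.
Qed.

(** The price of the indicator is 0, and the discount is almost surely positive because the
    integrated rate is finite; so the undiscounted probability vanishes as well. *)
Lemma hitting_null t x B : (0 < t)%R -> measurable B -> m B = 0 -> Q x (X t @^-1` B) = 0.
Proof.
move=> t0 mB B0; have t0' := ltW t0; rewrite hitE//.
have mIX : measurable_fun setT (fun w => (\1_B (X t w))%:E : \bar R).
  exact: (measurableT_comp (mI mB) (mX t0')).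
have := pricing_null x t0 mB B0 (measurable_cst 1) (fun=> lee01).
move=> /(ge0_integral_eq0P (Q x)) => h.
apply/(ge0_integral_eq0P (Q x)) => //.
have [_ _ rf] := rX.
have : {ae Q x, forall w, discount X r t w * ((\1_B (X t w))%:E * 1) = 0}.
  apply: h; last by move=> w; rewrite mule1 mule_ge0// discount_ge0.
  apply: emeasurable_funM; first exact: mdisc.
  by rewrite (_ : (fun w => _) = fun w => (\1_B (X t w))%:E)//; apply/funext => w; rewrite mule1.
apply: filterS2 (rf x t t0') => w /discount_gt0 d0; rewrite mule1 => /eqP.
by rewrite mule_eq0 gt_eqF//= => /eqP.
Qed.

Lemma pricing_gt0 t x B : (0 < t)%R -> measurable B -> 0 < m B ->
  0 < pricing X Q r t (fun y => (\1_B y)%:E) x.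
Proof.
move=> t0 mB B0; have [mp p0 _ _] := hp; rewrite pA//; last exact: mI.
under eq_integral do rewrite muleC.
apply: integral_indic_gt0 => //; last by move=> y; exact: p0.
by apply: mkernel1; exact: mp.
Qed.

Lemma hitting_gt0 t x B : (0 < t)%R -> measurable B -> 0 < m B -> 0 < Q x (X t @^-1` B).
Proof.
move=> t0 mB B0; apply: (lt_le_trans (pricing_gt0 x t0 mB B0)).
have t0' := ltW t0; rewrite hitE//; have mIX : measurable_fun setT (fun w => (\1_B (X t w))%:E : \bar R).
  exact: (measurableT_comp (mI mB) (mX t0')).
rewrite /pricing; apply: ge0_le_integral => //.
- by move=> w _; rewrite mule_ge0// discount_ge0.
- by apply: emeasurable_funM => //; exact: mdisc.
- by move=> w _; rewrite -[leRHS]mul1e lee_wpmul2r// (discount_le1 _ r0).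
Qed.

Lemma density_irreducible : full_support m -> irreducible_for X Q m.
Proof.
move=> ms; split; first exact: reference_gt0 ms.
move=> B mB B0 x; apply: (potential_gt0 mX Xrc) => // t t0.
exact: hitting_gt0.
Qed.

Lemma density_absolute_continuity : absolute_continuity X Q m.
Proof.
move=> alpha x _; apply/null_content_dominatesP => B mB B0.
by apply: (resolvent_eq0 mX Xrc) => // t t0; exact: hitting_null.
Qed.

End density_absolute_continuity.

(** * The eigen-measure *)

Section eigen_densities.
Context (R : realType) (d dE : measure_display).
Context (Omega : measurableType d) (E : borelMetricType dE R).
Variables (X : R -> Omega -> E) (Q : E -> probability Omega R) (r : E -> R).
Variable m : {sigma_finite_measure set E -> \bar R}.
Variable p : R -> E -> E -> R.
Hypothesis XQ : strong_markov_process X Q.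
Hypothesis Xrc : forall w t, 0 <= t -> X s w @[s --> t^'+] --> X t w.
Hypothesis rX : short_rate X Q r.
Hypothesis pA : has_density m (pricing X Q r) p.
Variables (lam : R) (pi : E -> R).
Hypotheses (mpi : measurable_fun setT pi) (pi0 : forall x, 0 < pi x).
Hypothesis piE : forall t x, 0 < t ->
  act m (p t) (EFin \o pi) x = (expR (- (lam * t)) * pi x)%:E.
Local Open Scope ereal_scope.

Let r0 x : (0 <= r x)%R. Proof. by have [h _ _] := rX; exact: h. Qed.
Let mr : measurable_fun setT r. Proof. by have [_ h _] := rX. Qed.
Let mX t : (0 <= t)%R -> measurable_fun setT (X t).
Proof. by move=> t0; exact: (markov_coordinate XQ t0). Qed.
Let mdisc t : measurable_fun setT (discount X r t) := measurable_discount XQ Xrc r0 mr t.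
Let mEpi : measurable_fun setT (EFin \o pi). Proof. exact/measurable_EFinP. Qed.
Let Epi0 x : 0 <= (EFin \o pi) x. Proof. by rewrite lee_fin ltW. Qed.

Lemma pricing_eigen t x : (0 <= t)%R ->
  pricing X Q r t (EFin \o pi) x = (expR (- (lam * t)) * pi x)%:E.
Proof.
rewrite le_eqVlt => /orP[/eqP <-|t0]; last by rewrite pA// -piE.
by rewrite (pricing0 r XQ)// mulr0 oppr0 expR0 mul1r.
Qed.

(** Under [Q x] the denominator [pi (X 0 w)] is almost surely the constant [pi x], and leaves the
    integral. *)
Lemma eigen_density_integral t x f : (0 <= t)%R ->
  measurable_fun setT f -> (forall w, 0 <= f w) ->
  \int[Q x]_w (f w * eigen_density X r lam pi t w) =
  (expR (lam * t) / pi x)%:E * \int[Q x]_w (f w * (discount X r t w * (pi (X t w))%:E)).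
Proof.
move=> t0 mf f0; have [_ _ start _ _] := XQ.
have mpiX u : (0 <= u)%R -> measurable_fun setT (fun w => pi (X u w)).
  by move=> u0; exact: (measurableT_comp mpi (mX u0)).
have k0 : (0 <= expR (lam * t) / pi x)%R by rewrite divr_ge0 ?expR_ge0// ltW.
have g0 w : 0 <= f w * (discount X r t w * (pi (X t w))%:E).
  by apply: mule_ge0 => //; apply: mule_ge0; [exact: discount_ge0|rewrite lee_fin ltW].
have mg : measurable_fun setT (fun w => f w * (discount X r t w * (pi (X t w))%:E)).
  apply: emeasurable_funM => //; apply: emeasurable_funM; first exact: mdisc.
  by apply/measurable_EFinP; exact: mpiX.
rewrite -ge0_integralZl ?lee_fin//.
apply: ge0_ae_eq_integral => //.
- apply: emeasurable_funM => //; apply: emeasurable_funM; first exact: mdisc.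
  apply/measurable_EFinP; apply: measurable_funM => //; apply: measurable_funM; first exact: mpiX.
  by apply: measurable_funV; [exact: mpiX|move=> w; exact: pi0].
- exact: measurable_funeM.
- move=> w _; rewrite mule_ge0//; apply: mule_ge0; first exact: discount_ge0.
  by rewrite lee_fin mulr_ge0 ?expR_ge0// divr_ge0// ltW.
- by move=> w _; rewrite mule_ge0// lee_fin.
- apply: filterS (start x) => w + _; rewrite /eigen_density => ->.
  rewrite [RHS]muleCA; congr (_ * _); rewrite [RHS]muleCA; congr (_ * _).
  by rewrite -EFinM; congr EFin; rewrite mulrA mulrAC.
Qed.

Lemma eigen_density_event t x A : (0 <= t)%R -> measurable A ->
  \int[Q x]_(w in A) eigen_density X r lam pi t w =
  (expR (lam * t) / pi x)%:E * \int[Q x]_(w in A) (discount X r t w * (pi (X t w))%:E).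
Proof.
move=> t0 mA; rewrite [LHS]integral_indicE [in RHS]integral_indicE.
apply: eigen_density_integral => //.
by apply/measurable_EFinP; exact: measurable_indic.
Qed.

(** The martingale property of the density: pricing over the period [t - s] multiplies [pi] by
    [exp (- lam (t - s))], which offsets the growth of [exp (lam t)]. *)
Lemma eigen_density_consistent x s t A : (0 <= s <= t)%R -> natural_filtration X s A ->
  \int[Q x]_(w in A) eigen_density X r lam pi t w =
  \int[Q x]_(w in A) eigen_density X r lam pi s w.
Proof.
move=> /andP[s0 st] hA; have mA := natural_filtration_measurable XQ hA.
have t0 : (0 <= t)%R by exact: le_trans st.
have ts0 : (0 <= t - s)%R by rewrite subr_ge0.
rewrite !eigen_density_event//.
have := pricing_markov XQ Xrc r0 mr x s0 ts0 hA mEpi Epi0; rewrite subrKC => ->.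
transitivity ((expR (lam * t) / pi x)%:E * ((expR (- (lam * (t - s))))%:E *
    \int[Q x]_(w in A) (discount X r s w * (pi (X s w))%:E))).
  congr (_ * _); rewrite -ge0_integralZl//.
  - apply: eq_integral => w _; rewrite pricing_eigen// EFinM muleCA//.
  - apply: measurable_funTS; apply: emeasurable_funM; first exact: mdisc.
    by apply/measurable_EFinP; exact: (measurableT_comp mpi (mX s0)).
  - by move=> w _; apply: mule_ge0; [exact: discount_ge0|rewrite lee_fin ltW].
rewrite muleA -EFinM; congr (_%:E * _).
by rewrite mulrAC -expRD; congr (_ / _)%R; congr expR; ring.
Qed.

Lemma eigen_density_total x t : (0 <= t)%R -> \int[Q x]_w eigen_density X r lam pi t w = 1.
Proof.
move=> t0; rewrite eigen_density_event//.
have := pricing_eigen x t0; rewrite /pricing => ->.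
rewrite -EFinM; congr EFin.
by rewrite mulrACA -expRD subrr expR0 mul1r mulVf// gt_eqF.
Qed.

Lemma eigen_measure_hitting Qpi x t B : eigen_measure X Q r lam pi Qpi ->
  (0 <= t)%R -> measurable B ->
  Qpi x (X t @^-1` B) =
  (expR (lam * t) / pi x)%:E * pricing X Q r t (fun y => (\1_B y)%:E * (pi y)%:E) x.
Proof.
move=> hQ t0 mB; rewrite (hQ x t)//; last first.
  by apply: natural_filtration_coordinate => //; rewrite t0 lexx.
rewrite eigen_density_event//; last exact: measurable_hitting.
congr (_ * _); rewrite integral_indicE; apply: eq_integral => w _.
by rewrite muleCA.
Qed.

End eigen_densities.

Section eigen_recurrence.
Context (R : realType) (d dE : measure_display).
Context (Omega : measurableType d) (E : borelMetricType dE R).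
Variables (X : R -> Omega -> E) (Q : E -> probability Omega R) (r : E -> R).
Variable m : {sigma_finite_measure set E -> \bar R}.
Variable p : R -> E -> E -> R.
Hypothesis XQ : strong_markov_process X Q.
Hypothesis Xrc : forall w t, 0 <= t -> X s w @[s --> t^'+] --> X t w.
Hypothesis rX : short_rate X Q r.
Hypothesis m_supp : full_support m.
Hypothesis hp : submarkov_semigroup m p.
Hypothesis pA : has_density m (pricing X Q r) p.
Variables (lam : R) (pi pihat : E -> R).
Hypotheses (mpi : measurable_fun setT pi) (pi0 : forall x, 0 < pi x).
Hypotheses (mpihat : measurable_fun setT pihat) (pihat0 : forall x, 0 < pihat x).
Hypothesis piE : forall t x, 0 < t ->
  act m (p t) (EFin \o pi) x = (expR (- (lam * t)) * pi x)%:E.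
Hypothesis pihatE : forall t x, 0 < t ->
  act m (flip p t) (EFin \o pihat) x = (expR (- (lam * t)) * pihat x)%:E.
Variables (C c alpha T' : R).
Hypotheses (C0 : 0 < C) (alpha0 : 0 < alpha) (T'0 : 0 < T') (c0 : 0 < c).
Hypothesis spec : forall t x y, T' <= t ->
  `|C * expR (lam * t) * p t x y - pi x * pihat y| <= c * expR (- (alpha * t)).
Variable Qpi : E -> probability Omega R.
Hypothesis hQ : eigen_measure X Q r lam pi Qpi.
Local Open Scope ereal_scope.

Let r0 x : (0 <= r x)%R. Proof. by have [h _ _] := rX; exact: h. Qed.
Let mr : measurable_fun setT r. Proof. by have [_ h _] := rX. Qed.
Let mX t : (0 <= t)%R -> measurable_fun setT (X t).
Proof. by move=> t0; exact: (markov_coordinate XQ t0). Qed.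
Let mEpi : measurable_fun setT (EFin \o pi). Proof. exact/measurable_EFinP. Qed.
Let Epi0 x : 0 <= (EFin \o pi) x. Proof. by rewrite lee_fin ltW. Qed.
Let mIpi (B : set E) : measurable B -> measurable_fun setT (fun y => (\1_B y)%:E * (pi y)%:E).
Proof.
move=> mB; apply: emeasurable_funM => //.
by apply/measurable_EFinP; exact: measurable_indic.
Qed.
Let Ipi0 (B : set E) y : 0 <= (\1_B y)%:E * (pi y)%:E.
Proof. by rewrite mule_ge0// lee_fin ltW. Qed.

Let mpihat_gt e : measurable [set y | e < pihat y]%R.
Proof.
rewrite (_ : [set y | _] = pihat @^-1` `]e, +oo[%classic).
  by rewrite -[X in measurable X]setTI; exact: mpihat.
by apply/seteqP; split => y /=; rewrite in_itv/= andbT.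
Qed.

Lemma eigen_potential_null x B : measurable B -> m B = 0 -> potential X Qpi x B = 0.
Proof.
move=> mB B0; apply: (potential_eq0 mX Xrc) => // t t0.
rewrite (eigen_measure_hitting XQ Xrc rX mpi pi0 x hQ (ltW t0) mB).
by rewrite (pricing_null hp pA)// mule0.
Qed.

Lemma large_time_decay (e : R) : (0 < e)%R ->
  exists2 T0 : R, (T' <= T0)%R & forall t, (T0 <= t)%R -> (c * expR (- (alpha * t)) <= e)%R.
Proof.
move=> e0; have T1 : (0 <= c / (alpha * e))%R by rewrite divr_ge0 ?mulr_ge0// ltW.
exists (T' + c / (alpha * e))%R; first by rewrite lerDl.
move=> t Tt; rewrite expRN ler_pdivrMr ?expR_gt0//.
have h := expR_ge1Dx (alpha * t)%R.
have : (c <= e * (alpha * t))%R.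
  rewrite mulrA -ler_pdivrMl ?mulr_gt0// mulrC [(e * _)%R]mulrC.
  by apply: le_trans Tt; rewrite lerDr ltW.
by move=> /le_trans; apply; rewrite ler_wpM2l ?ltW//; lra.
Qed.

(** On a non-null part [B'] of [B] one has [pihat > eps]; once the error is at most
    [pi x * eps / 2], [C * expR (lam * t) * p t x y] is at least [pi x * eps / 2] there. So hitting
    probabilities exceed a fixed [L > 0] from some time on. That time depends on [x], which is
    harmless for a potential at [x]. *)
Lemma eigen_potential_full x B : measurable B -> 0 < m B -> potential X Qpi x B = +oo.
Proof.
move=> mB B0; have [mp p0 _ _] := hp.
have [eps [eps0 B'0]] : exists eps : R, (0 < eps)%R /\ 0 < m (B `&` [set y | eps < pihat y]%R).
  apply: contrapT => h.
  have n0 n : m.-negligible (B `&` [set y | n.+1%:R^-1 < pihat y]%R).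
    apply/negligibleP; first exact: measurableI.
    apply: contrapT => /eqP mn0; apply: h; exists n.+1%:R^-1%R; split; first by rewrite invr_gt0.
    by rewrite lt0e mn0 measure_ge0.
  move: B0; suff -> : m B = 0 by rewrite ltxx.
  apply/negligibleP => //; apply: negligibleS (negligible_bigcup n0) => y By.
  have [n] := ltr_add_invr (pihat0 y); rewrite add0r => yn.
  by exists n.
have mB' : measurable (B `&` [set y | eps < pihat y]%R) by exact: measurableI.
set B' := B `&` _ in B'0 mB'.
have e0 : (0 < pi x * eps / 2)%R by rewrite divr_gt0 ?mulr_gt0.
have [T0 T'T0 T0h] := large_time_decay e0.
have T00 : (0 < T0)%R by exact: lt_le_trans T'T0.
pose k : R := (eps / (2 * C))%R.
have k0 : (0 < k)%R by rewrite divr_gt0 ?mulr_gt0.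
pose L := \int[m]_y (k%:E * ((\1_B' y)%:E * (pi y)%:E)).
have Lle t : (T0 <= t)%R -> L <= Qpi x (X t @^-1` B).
  move=> T0t; have t0 : (0 < t)%R by exact: lt_le_trans T0t.
  have e1 : (0 <= expR (lam * t) / pi x)%R by rewrite divr_ge0 ?expR_ge0// ltW.
  rewrite (eigen_measure_hitting XQ Xrc rX mpi pi0 x hQ (ltW t0) mB) pA//; last exact: mIpi.
  rewrite -ge0_integralZl//; last 2 first.
  - by apply: mact_term; [exact: mp|exact: mIpi].
  - by move=> y _; rewrite mule_ge0// lee_fin ltW// p0.
  apply: ge0_le_integral => //.
  - by move=> y _; rewrite mule_ge0// lee_fin ltW.
  - by apply: measurable_funeM; exact: mIpi.
  - by apply: measurable_funeM; apply: mact_term; [exact: mp|exact: mIpi].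
  move=> y _; rewrite !indicE; have [yB'|_] := boolP (y \in B'); last first.
    rewrite mul0e mule0; apply: mule_ge0; first by rewrite lee_fin.
    apply: mule_ge0; first by rewrite lee_fin ltW// p0.
    by apply: mule_ge0; rewrite lee_fin// ltW.
  have [By ey] : B y /\ (eps < pihat y)%R by move: yB'; rewrite inE.
  rewrite mem_set// !mul1e -!EFinM lee_fin mulrA ler_pM2r//.
  have := spec x y (le_trans T'T0 T0t); rewrite ler_norml => /andP[+ _].
  have := T0h t T0t; set ce := (c * _)%R => h1 h2.
  have h3 : (pi x * eps <= pi x * pihat y)%R by rewrite ler_wpM2l// ltW.
  have h4 : (pi x * eps / 2 <= C * expR (lam * t) * p t x y)%R by lra.
  rewrite /k ler_pdivrMr ?mulr_gt0// -(ler_pM2l (pi0 x)).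
  rewrite (_ : pi x * (_ * _ * (2 * C)) = 2 * (C * expR (lam * t) * p t x y))%R; first by lra.
  by field; rewrite gt_eqF.
(* [L] is a lower bound of a probability, which makes it finite. *)
have Lfin : L \is a fin_num.
  rewrite ge0_fin_numE; last by apply: integral_ge0 => y _; rewrite mule_ge0// lee_fin ltW.
  apply: (le_lt_trans (Lle T0 (lexx _))); apply: (@le_lt_trans _ _ 1); last exact: ltry.
  by apply: probability_le1; apply: (measurable_hitting mX) => //; exact: ltW.
have L0 : (0 < fine L)%R.
  apply: fine_gt0; rewrite ltey_eq Lfin/= andbT /L ge0_integralZl//.
  - by rewrite mule_gt0// integral_indic_gt0.
  - exact: mIpi.
  - by rewrite lee_fin ltW.
apply: (potential_eqy mX Xrc mB L0 T00) => t T0t.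
by rewrite fineK//; exact: Lle.
Qed.

(** Potentials vanish on [m]-null sets and are infinite on the others, so the irreducibility
    measures are those dominated by [m], and [m] is maximal among them. *)
Lemma eigen_irreducible (phi : {sigma_finite_measure set E -> \bar R}) :
  0 < phi setT -> irreducible_for X Qpi phi <-> phi `<< m.
Proof.
move=> phi0; split.
  move=> [_ h]; apply/null_content_dominatesP => B mB B0; apply/eqP.
  rewrite eq_le measure_ge0 andbT leNgt; apply/negP => /(h B mB)/(_ point).
  by rewrite eigen_potential_null// ltxx.
move=> /null_content_dominatesP phim; split=> // B mB B0 x.
rewrite eigen_potential_full// lt0e measure_ge0 andbT; apply/eqP => /(phim B mB) e.
by move: B0; rewrite e ltxx.
Qed.

Lemma eigen_recurrent_R1 : recurrent_R1 X Qpi.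
Proof.
exists m; last by move=> B mB B0 x _; exact: eigen_potential_full.
have m0 := reference_gt0 m_supp.
by split=> [|phi phi0]; [apply/(eigen_irreducible m0)|exact: eigen_irreducible].
Qed.

Section stationary.
Variable nu : probability E R.
Hypothesis nu_int : forall f, measurable_fun setT f -> (forall x, 0 <= f x) ->
  \int[nu]_x f x = \int[m]_x ((C^-1 * (pi x * pihat x))%:E * f x).

Let h0 x : (0 < C^-1 * (pi x * pihat x))%R.
Proof. by rewrite mulr_gt0 ?invr_gt0// mulr_gt0. Qed.

Let mh : measurable_fun setT (fun x => C^-1 * (pi x * pihat x))%R.
Proof. by apply: measurable_funM => //; exact: measurable_funM. Qed.

Let nu_indic (B : set E) : measurable B ->
  nu B = \int[m]_x ((C^-1 * (pi x * pihat x))%:E * (\1_B x)%:E).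
Proof.
move=> mB; rewrite -nu_int; first by rewrite integral_indic// setIT.
- by apply/measurable_EFinP; exact: measurable_indic.
- by move=> x; rewrite lee_fin.
Qed.

Let nu_null (B : set E) : measurable B -> nu B = 0 -> m B = 0.
Proof.
move=> mB nB; apply/eqP; rewrite eq_le measure_ge0 andbT leNgt; apply/negP => B0.
have := integral_indic_gt0 mB B0 mh h0; under eq_integral do rewrite muleC.
by rewrite -nu_indic// nB ltxx.
Qed.

(** Universal measurability is tested against [nu], whose null sets are [m]-null: [B] lies between
    Borel sets with an [m]-null difference. Either both are null and the outer one gives 0, or the
    inner one already has infinite potential. *)
Lemma eigen_recurrent_R0 : recurrent_R0 X Qpi.
Proof.
move=> B /(_ nu)[B1 [B2 [mB1 mB2 B1B BB2 /(nu_null (measurableD mB2 mB1)) d0]]].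
have [B10|B10] := eqVneq (m B1) 0; [left|right] => x.
  apply/eqP; rewrite eq_le; apply/andP; split.
    rewrite -(eigen_potential_null x mB2); first exact: le_potential.
    apply/eqP; rewrite eq_le measure_ge0 andbT.
    have B12 : B1 `<=` B2 by exact: subset_trans BB2.
    have : m (B1 `|` (B2 `\` B1)) <= m B1 + m (B2 `\` B1).
      by apply: measureU2 => //; exact: measurableD.
    by rewrite setDUK// B10 d0 adde0.
  apply: integral_ge0 => w _; apply: integral_ge0 => t _; rewrite lee_fin//.
apply/eqP; rewrite -leye_eq -(eigen_potential_full x mB1); first exact: le_potential.
by rewrite lt0e B10 measure_ge0.
Qed.

(** Moving the kernel onto [pihat] produces [exp (- lam t)], which cancels the factor of the change
    of measure. *)
Lemma eigen_stationary : submarkov_semigroup m (flip p) -> stationary X Qpi nu.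
Proof.
move=> hpC t B t0 mB.
have [mp p0 _ _] := hp.
have mF u : (0 <= u)%R -> measurable_fun setT (fun x => Qpi x (X u @^-1` B)).
  move=> u0; rewrite (_ : (fun x => _) = fun x => (expR (lam * u) / pi x)%:E *
      pricing X Q r u (fun y => (\1_B y)%:E * (pi y)%:E) x); last first.
    by apply/funext => x; exact: (eigen_measure_hitting XQ Xrc rX mpi pi0 x hQ).
  apply: emeasurable_funM; last exact: (measurable_pricing XQ Xrc r0 mr u0 (mIpi mB) (@Ipi0 B)).
  apply/measurable_EFinP; apply: measurable_funM => //.
  exact: measurable_funV.
rewrite nu_int//; last exact: mF.
(* Time 0 has no density and is treated through [pricing0]. *)
move: t0; rewrite le_eqVlt => /orP[/eqP <-|t0].
  rewrite nu_indic//; apply: eq_integral => x _; congr (_ * _).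
  rewrite (eigen_measure_hitting XQ Xrc rX mpi pi0 x hQ)// (pricing0 r XQ)//; last exact: mIpi.
  rewrite mulr0 expR0 muleCA -EFinM mul1r mulVf ?gt_eqF// mulr1//.
transitivity (\int[m]_x ((C^-1 * expR (lam * t))%:E *
    ((pihat x)%:E * act m (p t) (fun y => (\1_B y)%:E * (pi y)%:E) x))).
  apply: eq_integral => x _.
  rewrite (eigen_measure_hitting XQ Xrc rX mpi pi0 x hQ (ltW t0))// pA//; last exact: mIpi.
  rewrite !muleA -!EFinM; congr (_%:E * _); field; rewrite !gt_eqF//.
rewrite ge0_integralZl//; last 3 first.
- apply: emeasurable_funM; first exact/measurable_EFinP.
  by apply: measurable_act => //; [exact: mp|move=> ? ?; exact/ltW/p0|exact: mIpi].
- move=> x _; apply: mule_ge0; first by rewrite lee_fin ltW.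
  by apply: act_ge0 => // ? ?; exact/ltW/p0.
- by rewrite lee_fin mulr_ge0 ?expR_ge0 ?invr_ge0// ltW.
rewrite act_adj//; last 5 first.
- exact: mp.
- by move=> ? ?; exact/ltW/p0.
- exact: mIpi.
- exact/measurable_EFinP.
- by move=> x; rewrite lee_fin ltW.
have pE y : act m (fun x y => p t y x) (fun x => (pihat x)%:E) y =
    (expR (- (lam * t)) * pihat y)%:E by exact: pihatE.
under eq_integral do rewrite pE.
rewrite nu_indic// -ge0_integralZl//; last 3 first.
- apply: emeasurable_funM; last exact: mIpi.
  by apply/measurable_EFinP; exact: measurable_funM.
- by move=> x _; apply: mule_ge0 => //; rewrite lee_fin mulr_ge0 ?expR_ge0// ltW.
- by rewrite lee_fin mulr_ge0 ?expR_ge0 ?invr_ge0// ltW.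
apply: eq_integral => x _; rewrite -!EFinM; congr EFin.
have := expRxMexpNx_1 (lam * t)%R; set a := expR (lam * t); set b := expR _ => ab.
rewrite (_ : C^-1 * a * (b * pihat x * (\1_B x * pi x)) =
  a * b * (C^-1 * (pi x * pihat x) * \1_B x))%R; last by ring.
by rewrite ab mul1r.
Qed.

End stationary.

End eigen_recurrence.

(** * Payoffs *)

Section signed_integrals.
Context {R : realType} d (T : measurableType d).
Variable mu : {measure set T -> \bar R}.
Local Open Scope ereal_scope.

Lemma maxe_ge0_Ml (a x : \bar R) : 0 <= a -> maxe (a * x) 0 = a * maxe x 0.
Proof.
move=> a0; have [x0|x0] := leP x 0.
  by rewrite mule0; apply/max_idPr; exact: mule_ge0_le0.
by apply/max_idPl; rewrite mule_ge0// ltW.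
Qed.

Lemma integral_pos_part (k : T -> \bar R) (f : T -> R) : (forall x, 0 <= k x) ->
  \int[mu]_x (k x * (f x)%:E) =
  \int[mu]_x (k x * (Num.max (f x) 0)%:E) - \int[mu]_x (k x * (Num.max (- f x) 0)%:E).
Proof.
move=> k0; rewrite integralE; congr (_ - _); apply: eq_integral => x _.
  by rewrite funeposE maxe_ge0_Ml// EFin_max.
by rewrite funenegE -muleN maxe_ge0_Ml// EFin_max.
Qed.

Lemma maxr0_add (x : R) : (Num.max x 0 + Num.max (- x) 0 = `|x|)%R.
Proof.
have [x0|x0] := leP 0%R x.
  by rewrite ger0_norm// max_r ?addr0// oppr_le0.
by rewrite ltr0_norm// max_l ?add0r// oppr_ge0 ltW.
Qed.

End signed_integrals.

Section l2_norm.
Context {R : realType} d (T : measurableType d).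
Variable m : {sigma_finite_measure set T -> \bar R}.
Local Open Scope ereal_scope.

(* Cauchy--Schwarz against the constant 1; the slack [e] covers [f = 0]. *)
Lemma l1_le_l2 (f : T -> R) : m setT < +oo -> f \in Lfun m 2%:E ->
  \int[m]_x `|f x|%:E <= (Num.sqrt (fine (m setT)) * fine 'N[m]_2%:E[EFin \o f])%:E.
Proof.
move=> moo fL; have /Lfun2P[mf f2] := fL.
have mfin : m setT \is a fin_num by rewrite ge0_fin_numE.
have Nfin : 'N[m]_2%:E[EFin \o f] \is a fin_num.
  rewrite ge0_fin_numE ?Lnorm_ge0// ltey; apply/eqP => /(eqy_poweR (ltr0n R 2)).
  by rewrite int_sqr_Lnorm => h; rewrite h ltxx in f2.
set M := fine (m setT); set N := fine 'N[m]_2%:E[EFin \o f].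
have N0 : (0 <= N)%R by apply: fine_ge0; exact: Lnorm_ge0.
have M0 : (0 <= M)%R by exact: fine_ge0.
have N2 : \int[m]_x (f x ^+ 2)%:E = (N ^+ 2)%:E.
  by rewrite -int_sqr_Lnorm -(fineK Nfin) poweR_EFin powR_mulrn.
apply/lee_addgt0Pr => e e0; rewrite -EFinD.
have [eta eta0 etae] : exists2 eta : R, (0 < eta)%R & ((Num.sqrt M + eta) * (N + eta) <= Num.sqrt M * N + e)%R.
  pose s := (Num.sqrt M + N + 1)%R.
  have s0 : (0 < s)%R by rewrite ltr_wpDl// addr_ge0// sqrtr_ge0.
  exists (Num.min 1 (e / s))%R; first by rewrite lt_min ltr01 divr_gt0.
  set eta := Num.min _ _; have eta1 : (eta <= 1)%R by rewrite ge_min lexx.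
  have eta0 : (0 <= eta)%R by rewrite le_min ler01 divr_ge0// ltW.
  have : (eta * s <= e)%R by rewrite -ler_pdivlMr// ge_min lexx orbT.
  by rewrite /s; have := sqrtr_ge0 M; nra.
apply: (@le_trans _ _ ((Num.sqrt M + eta) * (N + eta))%:E); last by rewrite lee_fin.
under eq_integral do rewrite -[X in X%:E]mul1r.
have mabs : measurable_fun setT (fun x => `|f x|%R) by exact: measurableT_comp.
apply: (@cauchy_schwarz _ _ _ m (fun=> 1%R) (fun x => `|f x|%R)) => //.
- by rewrite ltr_wpDl// sqrtr_ge0.
- by rewrite ltr_wpDl.
- under eq_integral do rewrite expr1n.
  rewrite integral_cst// mul1e; apply: (@le_trans _ _ M%:E); first by rewrite /M fineK.
  rewrite lee_fin -{1}(sqr_sqrtr M0).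
  by rewrite ler_sqr ?nnegrE ?addr_ge0 ?sqrtr_ge0 ?lerDl ?ltW.
- under eq_integral do rewrite real_normK ?num_real//.
  have eta0' := ltW eta0.
  by rewrite N2 lee_fin ler_sqr ?nnegrE ?addr_ge0// lerDl.
Qed.

End l2_norm.

Section kernel_approximation.
Context {R : realType} (dE : measure_display) (E : measurableType dE).
Variable m : {sigma_finite_measure set E -> \bar R}.
Variable p : R -> E -> E -> R.
Variables (lam : R) (pi pihat : E -> R).
Hypotheses (pi0 : forall x, 0 < pi x) (mpihat : measurable_fun setT pihat)
  (pihat0 : forall x, 0 < pihat x).
Variables (C c alpha T' : R).
Hypotheses (C0 : 0 < C) (c0 : 0 < c).
Hypothesis mp : forall t, T' <= t -> mkernel (p t).
Hypothesis p0 : forall t x y, T' <= t -> 0 < p t x y.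
Hypothesis spec : forall t x y, T' <= t ->
  `|C * expR (lam * t) * p t x y - pi x * pihat y| <= c * expR (- (alpha * t)).
Local Open Scope ereal_scope.

(** The uniform kernel estimate is integrated against [g] as two one-sided inequalities between
    nonnegative integrals. Multiplication by [K = C exp (lam t)] clears the denominators, and the
    upper inequality shows that the price is finite. *)
Lemma kernel_approximation t x (g : E -> R) : (T' <= t)%R -> measurable_fun setT g ->
  (forall y, (0 <= g y)%R) -> \int[m]_y (g y)%:E < +oo -> \int[m]_y (pihat y * g y)%:E < +oo ->
  exists a : R, act m (p t) (EFin \o g) x = a%:E /\
  (`|a - C^-1 * (expR (- (lam * t)) * pi x) * fine (\int[m]_y (pihat y * g y)%:E)| <=
    C^-1 * c * expR (- ((lam + alpha) * t)) * fine (\int[m]_y (g y)%:E))%R.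
Proof.
move=> Tt mg g0 gfin bfin.
set G := \int[m]_y (g y)%:E in gfin *; set b := \int[m]_y (pihat y * g y)%:E in bfin *.
have G0 : 0 <= G by apply: integral_ge0 => y _; rewrite lee_fin.
have b0 : 0 <= b by apply: integral_ge0 => y _; rewrite lee_fin mulr_ge0// ltW.
have fG : G \is a fin_num by rewrite ge0_fin_numE.
have fb : b \is a fin_num by rewrite ge0_fin_numE.
set K := (C * expR (lam * t))%R; have K0 : (0 < K)%R by rewrite mulr_gt0 ?expR_gt0.
set e := (c * expR (- (alpha * t)))%R; have e0 : (0 < e)%R by rewrite mulr_gt0 ?expR_gt0.
have mEg : measurable_fun setT (EFin \o g) by exact/measurable_EFinP.
have mb : measurable_fun setT (fun y => (pihat y * g y)%:E).
  by apply/measurable_EFinP; exact: measurable_funM.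
have ma : measurable_fun setT (fun y => (p t x y)%:E * (EFin \o g) y).
  by apply: mact_term => //; exact: mp.
have a0 y : 0 <= (p t x y)%:E * (EFin \o g) y.
  by apply: mule_ge0; rewrite lee_fin// ltW// p0.
set a := act m (p t) (EFin \o g) x.
have Ka : \int[m]_y (K%:E * ((p t x y)%:E * (EFin \o g) y)) = K%:E * a.
  by rewrite ge0_integralZl// lee_fin ltW.
have pb : \int[m]_y ((pi x)%:E * (pihat y * g y)%:E) = (pi x)%:E * b.
  by rewrite ge0_integralZl ?lee_fin ?ltW// => y _; rewrite lee_fin mulr_ge0// ltW.
have eG : \int[m]_y (e%:E * (g y)%:E) = e%:E * G.
  by rewrite ge0_integralZl ?lee_fin ?ltW// => y _; rewrite lee_fin.
have h1 : K%:E * a <= (pi x)%:E * b + e%:E * G.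
  rewrite -Ka -pb -eG -ge0_integralD//; last 4 first.
  - by move=> y _; rewrite -EFinM lee_fin !mulr_ge0// ltW.
  - exact: measurable_funeM.
  - by move=> y _; rewrite -EFinM lee_fin !mulr_ge0// ltW.
  - exact: measurable_funeM.
  apply: ge0_le_integral => //.
  - by move=> y _; apply: mule_ge0 => //; rewrite lee_fin ltW.
  - exact: measurable_funeM.
  - by apply: emeasurable_funD; exact: measurable_funeM.
  move=> y _; rewrite /= -!EFinM -EFinD lee_fin mulrA mulrA -mulrDl ler_wpM2r//.
  by have := spec x y Tt; rewrite ler_norml -/K -/e => /andP[_ h]; lra.
have h2 : (pi x)%:E * b <= K%:E * a + e%:E * G.
  rewrite -Ka -pb -eG -ge0_integralD//; last 4 first.
  - by move=> y _; apply: mule_ge0 => //; rewrite lee_fin ltW.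
  - exact: measurable_funeM.
  - by move=> y _; rewrite -EFinM lee_fin !mulr_ge0// ltW.
  - exact: measurable_funeM.
  apply: ge0_le_integral => //.
  - by move=> y _; rewrite -EFinM lee_fin !mulr_ge0// ltW.
  - exact: measurable_funeM.
  - by apply: emeasurable_funD; exact: measurable_funeM.
  move=> y _; rewrite /= -!EFinM -EFinD lee_fin !mulrA -mulrDl ler_wpM2r//.
  by have := spec x y Tt; rewrite ler_norml -/K -/e => /andP[h _]; lra.
have fa : a \is a fin_num.
  rewrite ge0_fin_numE; last exact: integral_ge0.
  rewrite ltey; apply/eqP => ay; move: h1; rewrite ay gt0_muley ?lte_fin// leye_eq.
  by rewrite -(fineK fb) -(fineK fG).
exists (fine a); rewrite fineK//; split=> //.
move: h1 h2; rewrite -(fineK fa) -(fineK fb) -(fineK fG) /= -!EFinM -!EFinD !lee_fin.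
move: (fine a) (fine b) (fine G) => a' b' G' h1 h2.
have KV : (K * (C^-1 * expR (- (lam * t))) = 1)%R.
  by rewrite /K mulrACA divff ?gt_eqF// mul1r expRxMexpNx_1.
have eE : (K * (C^-1 * c * expR (- ((lam + alpha) * t))) = e)%R.
  rewrite (_ : - ((lam + alpha) * t) = - (lam * t) + - (alpha * t))%R; last by ring.
  by rewrite expRD -[RHS]mul1r -KV /e; ring.
rewrite -(ler_pM2l K0) -{1}(gtr0_norm K0) -normrM mulrBr.
rewrite (_ : K * (C^-1 * (expR (- (lam * t)) * pi x) * b') = pi x * b')%R; last first.
  by rewrite -[RHS]mul1r -KV; ring.
rewrite [(K * (_ * G'))%R]mulrA eE ler_norml; apply/andP; split; lra.
Qed.

End kernel_approximation.

Section payoffs.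
Context (R : realType) (d dE : measure_display).
Context (Omega : measurableType d) (E : borelMetricType dE R).
Variables (X : R -> Omega -> E) (Q : E -> probability Omega R) (r : E -> R).
Variable m : {sigma_finite_measure set E -> \bar R}.
Variable p : R -> E -> E -> R.
Hypothesis hp : submarkov_semigroup m p.
Hypothesis pA : has_density m (pricing X Q r) p.
Variables (lam : R) (pi pihat : E -> R).
Hypotheses (mpi : measurable_fun setT pi) (pi0 : forall x, 0 < pi x).
Hypotheses (mpihat : measurable_fun setT pihat) (pihat0 : forall x, 0 < pihat x).
Hypothesis pihat2 : (\int[m]_x (pihat x ^+ 2)%:E < +oo)%E.
Variables (C c alpha T' : R).
Hypotheses (C0 : 0 < C) (T'0 : 0 < T') (c0 : 0 < c).
Hypothesis spec : forall t x y, T' <= t ->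
  `|C * expR (lam * t) * p t x y - pi x * pihat y| <= c * expR (- (alpha * t)).
Variable nu : probability E R.
Hypothesis nu_int : forall f, measurable_fun setT f -> (forall x, 0 <= f x)%E ->
  (\int[nu]_x f x = \int[m]_x ((C^-1 * (pi x * pihat x))%:E * f x))%E.
Local Open Scope ereal_scope.

Section positive_payoff.
Variable g : E -> R.
Hypotheses (mg : measurable_fun setT g) (g0 : forall x, (0 <= g x)%R).

Lemma stationary_payoff : \int[nu]_x ((pi x)^-1%:E * (g x)%:E) =
  (C^-1)%:E * \int[m]_x ((pihat x)%:E * (g x)%:E).
Proof.
rewrite nu_int; first last.
- by move=> x; rewrite -EFinM lee_fin mulr_ge0 ?invr_ge0// ltW.
- apply: emeasurable_funM; apply/measurable_EFinP => //.
  exact: measurable_funV.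
rewrite -ge0_integralZl//.
- apply: eq_integral => x _; rewrite -!EFinM; congr EFin.
  by field; rewrite !gt_eqF.
- by apply: emeasurable_funM; exact/measurable_EFinP.
- by move=> x _; rewrite -EFinM lee_fin mulr_ge0// ltW.
- by rewrite lee_fin invr_ge0 ltW.
Qed.

End positive_payoff.

Variable f : E -> R.
Hypothesis fL : f \in Lfun m 2%:E.

Let mf : measurable_fun setT f. Proof. by have /Lfun2P[] := fL. Qed.

Let fpos x := Num.max (f x) 0%R.
Let fneg x := Num.max (- f x)%R 0%R.

Let mpos : measurable_fun setT fpos.
Proof. exact: measurable_maxr. Qed.

Let mneg : measurable_fun setT fneg.
Proof. by apply: measurable_maxr => //; exact: measurableT_comp. Qed.

Let pos0 x : (0 <= fpos x)%R. Proof. by rewrite le_max lexx orbT. Qed.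
Let neg0 x : (0 <= fneg x)%R. Proof. by rewrite le_max lexx orbT. Qed.

Let posle x : (fpos x <= `|f x|)%R.
Proof. by rewrite -maxr0_add lerDl; exact: neg0. Qed.

Let negle x : (fneg x <= `|f x|)%R.
Proof. by rewrite -maxr0_add lerDr; exact: pos0. Qed.

Let pairing_lty (g : E -> R) : measurable_fun setT g -> (forall x, (0 <= g x)%R) ->
  (forall x, (g x <= `|f x|)%R) -> \int[m]_x (pihat x * g x)%:E < +oo.
Proof.
move=> mg g0 gf; have /Lfun2P[_ f2] := fL.
have ph0 x : (0 <= pihat x)%R by exact: ltW.
apply: (@le_lt_trans _ _ (\int[m]_x (pihat x * `|f x|)%:E)).
  apply: ge0_le_integral => //.
  - by move=> x _; rewrite lee_fin mulr_ge0.
  - by apply/measurable_EFinP; exact: measurable_funM.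
  - by apply/measurable_EFinP; apply: measurable_funM => //; exact: measurableT_comp.
  - by move=> x _; rewrite lee_fin ler_wpM2l.
apply: l2_pairing_fin => //; first exact: measurableT_comp.
by under eq_integral do rewrite real_normK ?num_real//.
Qed.

Let bpos := \int[m]_x (pihat x * fpos x)%:E.
Let bneg := \int[m]_x (pihat x * fneg x)%:E.

Let bpos_fin : bpos \is a fin_num.
Proof.
rewrite ge0_fin_numE; first exact: pairing_lty.
by apply: integral_ge0 => x _; rewrite lee_fin mulr_ge0// ltW.
Qed.

Let bneg_fin : bneg \is a fin_num.
Proof.
rewrite ge0_fin_numE; first exact: pairing_lty.
by apply: integral_ge0 => x _; rewrite lee_fin mulr_ge0// ltW.
Qed.

Let payoff_coefE : \int[nu]_x (f x / pi x)%:E = (C^-1)%:E * (bpos - bneg).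
Proof.
transitivity (\int[nu]_x ((pi x)^-1%:E * (f x)%:E)).
  by apply: eq_integral => x _; rewrite -EFinM mulrC.
rewrite integral_pos_part; last by move=> x; rewrite lee_fin invr_ge0 ltW.
rewrite (stationary_payoff mpos pos0) (stationary_payoff mneg neg0).
by symmetry; apply: muleBr => //; exact: fin_num_adde_defr.
Qed.

Lemma payoff_coefficient : \int[nu]_x (f x / pi x)%:E =
  (C^-1)%:E * \int[m]_x (f x * pihat x)%:E.
Proof.
rewrite payoff_coefE; congr (_ * _); symmetry.
transitivity (\int[m]_x ((pihat x)%:E * (f x)%:E)).
  by apply: eq_integral => x _; rewrite -EFinM mulrC.
by rewrite integral_pos_part// => x; rewrite lee_fin ltW.
Qed.

(** The errors of the positive and negative parts add up to a multiple of the L^1 norm of [f], and a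
    finite [m] bounds this norm by the L^2 norm. *)
Lemma payoff_approximation t x : m setT < +oo -> (T' <= t)%R ->
  `|pricing X Q r t (EFin \o f) x
     - (\int[nu]_y (f y / pi y)%:E) * (expR (- (lam * t)) * pi x)%:E|
  <= (C^-1 * c * Num.sqrt (fine (m setT)))%:E * 'N[m]_2%:E[EFin \o f]
     * (expR (- ((lam + alpha) * t)))%:E.
Proof.
move=> moo Tt; have t0 : (0 < t)%R by exact: lt_le_trans Tt.
have [mp p0 _ _] := hp.
have mpT u : (T' <= u)%R -> mkernel (p u) by move=> Tu; apply: mp; exact: lt_le_trans Tu.
have p0T u y z : (T' <= u)%R -> (0 < p u y z)%R by move=> Tu; apply: p0; exact: lt_le_trans Tu.
have l1 := l1_le_l2 moo fL.
have Gfin (g : E -> R) : measurable_fun setT g -> (forall y, (0 <= g y)%R) ->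
    (forall y, (g y <= `|f y|)%R) -> \int[m]_y (g y)%:E < +oo.
  move=> mg g0 gf; apply: (@le_lt_trans _ _ (\int[m]_x `|f x|%:E)); last exact: le_lt_trans l1 (ltry _).
  apply: ge0_le_integral => //.
  - by move=> y _; rewrite lee_fin.
  - exact/measurable_EFinP.
  - by apply/measurable_EFinP; exact: measurableT_comp.
  - by move=> y _; rewrite lee_fin.
have [ap [apE hap]] := kernel_approximation pi0 mpihat pihat0 C0 c0 mpT p0T spec
  x Tt mpos pos0 (Gfin _ mpos pos0 posle) (pairing_lty mpos pos0 posle).
have [an [anE han]] := kernel_approximation pi0 mpihat pihat0 C0 c0 mpT p0T spec
  x Tt mneg neg0 (Gfin _ mneg neg0 negle) (pairing_lty mneg neg0 negle).
have -> : pricing X Q r t (EFin \o f) x = (ap - an)%:E.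
  rewrite /pricing integral_pos_part; last by move=> w; exact: discount_ge0.
  have actE (g : E -> R) : measurable_fun setT g -> (forall y, (0 <= g y)%R) ->
      pricing X Q r t (EFin \o g) x = act m (p t) (EFin \o g) x.
    by move=> mg g0; apply: pA => //; exact/measurable_EFinP.
  by rewrite EFinB -apE -anE -!actE.
rewrite payoff_coefE.
have Nfin : 'N[m]_2%:E[EFin \o f] \is a fin_num.
  have /Lfun2P[_ f2] := fL.
  rewrite ge0_fin_numE ?Lnorm_ge0// ltey; apply/eqP => /(eqy_poweR (ltr0n R 2)).
  by rewrite int_sqr_Lnorm => h; rewrite h ltxx in f2.
have GE : (fine (\int[m]_y (fpos y)%:E) + fine (\int[m]_y (fneg y)%:E))%:E =
    \int[m]_y `|f y|%:E.
  rewrite EFinD !fineK; last 2 first.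
  - by rewrite ge0_fin_numE ?Gfin// integral_ge0// => y _; rewrite lee_fin.
  - by rewrite ge0_fin_numE ?Gfin// integral_ge0// => y _; rewrite lee_fin.
  rewrite -ge0_integralD//; try by move=> y _; rewrite lee_fin.
  + by apply: eq_integral => y _; rewrite -EFinD maxr0_add.
  + exact/measurable_EFinP.
  + exact/measurable_EFinP.
rewrite -(fineK bpos_fin) -(fineK bneg_fin) -[X in _ <= _ * X * _](fineK Nfin).
rewrite -!EFinB -?EFinM -?EFinB abse_EFin lee_fin.
move: l1 hap han; rewrite -GE lee_fin -/bpos -/bneg.
move: (fine bpos) (fine bneg) (fine (\int[m]_y (fpos y)%:E)) (fine (\int[m]_y (fneg y)%:E))
  (fine 'N[m]_2%:E[EFin \o f]) => b1 b2 G1 G2 N.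
set e := expR _; set e' := expR _; set M := Num.sqrt _ => l1 h1 h2.
rewrite (_ : ap - an - C^-1 * (b1 - b2) * (e * pi x) =
  (ap - C^-1 * (e * pi x) * b1) - (an - C^-1 * (e * pi x) * b2))%R; last by ring.
apply: (le_trans (ler_normB _ _)); apply: (le_trans (lerD h1 h2)).
rewrite -mulrDr (_ : C^-1 * c * M * N * e' = C^-1 * c * e' * (M * N))%R; last by ring.
by rewrite ler_wpM2l// !mulr_ge0 ?expR_ge0 ?invr_ge0// ltW.
Qed.

End payoffs.

(** * Assembly of the five statements *)

Theorem theorem5p1 (R : realType) (dE d d' : measure_display)
    (E : borelMetricType dE R)
    (Omega : measurableType d) (Omega' : measurableType d')
    (X : R -> Omega -> E) (Q : E -> probability Omega R) (r : E -> R)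
    (m : {sigma_finite_measure set E -> \bar R})
    (Xhat : R -> Omega' -> with_cemetery E)
    (Qhat : with_cemetery E -> probability Omega' R)
    (p : R -> E -> E -> R) (T : R)
    (E_lc : locally_compact [set: E])
    (E_sep : exists2 D : set E, countable D & dense D)
    (E_two : exists x y : E, x <> y)
    (X_hunt : conservative_hunt_process X Q)
    (r_rate : short_rate X Q r)
    (m_supp : full_support m)
    (Xhat_markov : killed_strong_markov_process Xhat Qhat)
    (X_dual : in_duality m (pricing X Q r) (killed_semigroup Xhat Qhat))
    (A1_cont : forall t, 0 < t -> continuous (fun z : E * E => p t z.1 z.2))
    (A1_pos : forall t x y, 0 < t -> 0 < p t x y)
    (A1_density : has_density m (pricing X Q r) p)
    (A1_dual : has_density m (killed_semigroup Xhat Qhat)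
                 (fun t x y => p t y x))
    (A2 : forall t, 0 < t ->
      (\int[m]_y \int[m]_x (p t x y ^+ 2)%:E < +oo)%E)
    (T_gt0 : 0 < T)
    (A3 : forall t, T <= t ->
      (ereal_sup [set \int[m]_y (p t x y ^+ 2)%:E | x in [set: E]] < +oo)%E /\
      (ereal_sup [set \int[m]_y (p t y x ^+ 2)%:E | x in [set: E]] < +oo)%E) :
  (* (i) *)
  (irreducible_for X Q m /\ absolute_continuity X Q m) /\
  (* (ii) *)
  exists (lam : R) (pi pihat : E -> R),
  [/\ 0 <= lam, admissible_eigenfunction m pi,
      admissible_eigenfunction m pihat,
      (forall t, 0 < t -> eigenfunction_of m (p t) (expR (- (lam * t))) pi) &
      (forall t, 0 < t ->
        eigenfunction_of m (fun x y => p t y x) (expR (- (lam * t))) pihat)] /\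
  (forall t, 0 < t -> unique_eigenfunction m (p t) pi) /\
  (forall t, 0 < t -> unique_eigenfunction m (fun x y => p t y x) pihat) /\
  (* (iii) *)
  let C : R := \int[m]_x (pi x * pihat x) in
  exists c alpha T' : R,
  [/\ 0 < c, 0 < alpha, 0 < T' &
      forall t x y, T' <= t ->
        `|C * expR (lam * t) * p t x y - pi x * pihat y|
          <= c * expR (- (alpha * t))] /\
  exists varsigma : probability E R,
  (forall B, measurable B ->
    varsigma B = ((C^-1)%:E * \int[m]_(x in B) (pi x * pihat x)%:E)%E) /\
  (* (iv): the densities are consistent probability densities, and under any
     family of laws which they define X is recurrent *)
  (forall x t, 0 <= t -> (\int[Q x]_w eigen_density X r lam pi t w = 1)%E) /\
  (forall x s t A, 0 <= s <= t -> natural_filtration X s A ->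
    (\int[Q x]_(w in A) eigen_density X r lam pi t w =
     \int[Q x]_(w in A) eigen_density X r lam pi s w)%E) /\
  (forall Qpi : E -> probability Omega R,
    eigen_measure X Q r lam pi Qpi ->
    [/\ recurrent_R0 X Qpi, recurrent_R1 X Qpi & stationary X Qpi varsigma]) /\
  (* (v) *)
  ((m [set: E] < +oo)%E ->
    (forall f : E -> R, f \in Lfun m 2%:E ->
      (\int[varsigma]_x (f x / pi x)%:E =
       (C^-1)%:E * \int[m]_x (f x * pihat x)%:E)%E) /\
    exists K : R, forall (f : E -> R) t x, f \in Lfun m 2%:E -> T' <= t ->
      (`|pricing X Q r t (EFin \o f) x
         - (\int[varsigma]_y (f y / pi y)%:E) * (expR (- (lam * t)) * pi x)%:E|
       <= K%:E * 'N[m]_2%:E[EFin \o f] * (expR (- ((lam + alpha) * t)))%:E)%E).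
Proof.
have [XQ cadlag _] := X_hunt.
have Xrc w t : 0 <= t -> X s w @[s --> t^'+] --> X t w by have [h _] := cadlag w; exact: h.
have [r0 mr _] := r_rate.
have hp := pricing_submarkov XQ Xrc r0 mr E_sep A1_cont A1_pos A1_density.
have hpC := dual_submarkov Xhat_markov E_sep A1_cont A1_pos A1_dual.
split.
  split; first exact: (density_irreducible XQ Xrc r_rate hp A1_density m_supp).
  exact: (density_absolute_continuity XQ Xrc r_rate hp A1_density).
have [lam [pi [pihat [c [alpha [T' [[lam0 api apihat piE pihatE] [[C0 CE uq uqh]
  [c0 alpha0 T'0 spec]]]]]]]]] := kernel_spectral m_supp hp hpC A1_cont A2 T_gt0 A3.
have [pi0 _ _ /Lfun2P[mpi _]] := api; have [pihat0 _ _ /Lfun2P[mpihat pihat2]] := apihat.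
exists lam, pi, pihat; split.
  split=> // t t0 x.
    by rewrite -piE//; apply: eq_integral => y _; rewrite EFinM.
  by rewrite -pihatE//; apply: eq_integral => y _; rewrite EFinM.
split=> //; split=> //.
move=> C; exists c, alpha, T'; split=> //.
have h0 x : 0 <= C^-1 * (pi x * pihat x).
  by rewrite mulr_ge0 ?invr_ge0 ?mulr_ge0// ltW.
have mpp : measurable_fun setT (fun x => pi x * pihat x) by exact: measurable_funM.
have mh : measurable_fun setT (fun x => C^-1 * (pi x * pihat x)) by exact: measurable_funM.
have intE (A : set E) : measurable A -> (\int[m]_(x in A) (C^-1 * (pi x * pihat x))%:E =
    (C^-1)%:E * \int[m]_(x in A) (pi x * pihat x)%:E)%E.
  move=> mA; under eq_integral do rewrite EFinM.
  rewrite ge0_integralZl//.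
  - by apply: measurable_funTS; exact/measurable_EFinP.
  - by move=> x _; rewrite lee_fin mulr_ge0// ltW.
  - by rewrite lee_fin invr_ge0 ltW.
(* [CE] says that the extended integral is the real number [C], so that dividing by it does give a
   probability. *)
have h1 : (\int[m]_x (C^-1 * (pi x * pihat x))%:E = 1)%E.
  by rewrite intE// CE -EFinM mulVf// gt_eqF.
have [nu [nuE nu_int]] := density_probability mh h0 h1.
exists nu; split; first by move=> B mB; rewrite nuE intE.
split; first by move=> x t t0; exact: (eigen_density_total XQ Xrc r_rate A1_density mpi pi0 piE).
split.
  move=> x s t A st hA.
  exact: (eigen_density_consistent XQ Xrc r_rate A1_density mpi pi0 piE).
split.
  move=> Qpi hQ; split.
  - exact: (eigen_recurrent_R0 XQ Xrc r_rate hp A1_density mpi pi0 mpihat pihat0 C0 alpha0 T'0 c0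
      spec hQ nu_int).
  - exact: (eigen_recurrent_R1 XQ Xrc r_rate m_supp hp A1_density mpi pi0 mpihat pihat0 C0 alpha0
      T'0 c0 spec hQ).
  - exact: (eigen_stationary XQ Xrc r_rate hp A1_density mpi pi0 mpihat pihat0 pihatE C0 hQ
      nu_int hpC).
move=> moo; split.
  by move=> f fL; exact: (payoff_coefficient mpi pi0 mpihat pihat0 pihat2 C0 nu_int fL).
(* The kernel error divided by [C], times the constant comparing the L^1 and L^2 norms. *)
exists (C^-1 * c * Num.sqrt (fine (m setT))) => f t x fL Tt.
exact: (payoff_approximation hp A1_density mpi pi0 mpihat pihat0 pihat2 C0 T'0 c0 spec nu_int
  fL x moo Tt).
Qed.
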